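(* Fix $\ell\ge 3$ and for each $m$ let $\mathbf D_m=(D^{(1)}(m),\dots,D^{(\ell)}(m))$ be a collection of $\ell$ independent random dice, with $D^{(k)}(m)$ having $n_k(m)=f_k(m)\,m\le m$ faces. Suppose that for each $k=1,\dots,\ell$, as $m\to\infty$, (i) $f_k(m)\to f_k(\infty)\in(0,1]$; (ii) $\mathbf p_k(m)\to\mathbf p_k(\infty)\in(0,1]$, $\sigma_k(m)\to\sigma_k(\infty)\in(0,\infty)$, and $\gamma_k(m)\to\gamma_k(\infty)\in[-1,1]$. Let $(X_1,\dots,X_\ell)$ be a centered Gaussian vector with covariance matrix $\Sigma$ given by $\Sigma_{kk}=1$, $\Sigma_{k-1,k}=\Sigma_{k,k-1}=\gamma_k(\infty)$ (indices modulo $\ell$), and all other entries $0$. Suppose in addition that for every $k\in\{1,\dots,\ell\}$ $$\lim_{m\to\infty}\mathbb P\big(D^{(k)}_1(m)=D^{(k+1)}_1(m)\big)=0$$ and $$\frac12-\mathbf p_k-\frac12\,\mathbb P\big(D^{(k)}_1=D^{(k+1)}_1\big)=o(m^{-1/2}),\quad m\to\infty.$$ Then $$\mathbb P\big(X_j>0,\ j=1,\dots,\ell\big)\le\liminf_{m\to\infty}\mathbb P\big(D^{(1)}\triangleright\cdots\triangleright D^{(\ell)}\triangleright D^{(1)}\big)\le\limsup_{m\to\infty}\mathbb P\big(D^{(1)}\triangleright\cdots\triangleright D^{(\ell)}\triangleright D^{(1)}\big)\le\mathbb P\big(X_j\ge0,\ j=1,\dots,\ell\big).$$ In particular, when the Gaussian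 vector $(X_1,\dots,X_\ell)$ is non-degenerate, $$\lim_{m\to\infty}\mathbb P\big(D^{(1)}\triangleright\cdots\triangleright D^{(\ell)}\triangleright D^{(1)}\big)=\mathbb P\big(X_j\ge0,\ j=1,\dots,\ell\big).$$
   Context: Indices of dice are cyclic modulo $\ell$: $D^{(0)}=D^{(\ell)}$, $D^{(\ell+1)}=D^{(1)}$, and likewise for all quantities indexed by $k$. A random die with $n$ faces and law $\mathcal L$ is a vector $D=(D_1,\dots,D_n)$ of i.i.d. real random variables with law $\mathcal L$. Dice in a collection are independent if all the random variables $\{D^{(k)}_i\}_{k,i}$ are mutually independent. For each $m$, the die $D^{(k)}=D^{(k)}(m)$ has some law $\mathcal L^{(k)}_m$, which may depend on both $k$ and $m$, and $n_k=n_k(m)\le m$ faces; $f_k=f_k(m)=n_k/m$. Dependence on $m$ is often omitted. For dice (vectors) $A,B$, $A\triangleright B$ means $\#\{(i,j):A_i>B_j\}>\#\{(i,j):B_j>A_i\}$. In the following four probabilities, $D^{(k)}_1,D^{(k)}_2$ stand for independent variables with law $\mathcal L^{(k)}_m$ (independent across dice): $\mathbf p_k=\mathbb P(D^{(k)}_1>D^{(k+1)}_1)$; $\mathbf q_k=\mathbb P(D^{(k)}_1>D^{(k+1)}_1,\ D^{(k)}_2>D^{(k+1)}_1)$; $\mathbf r_k=\mathbb P(D^{(k)}_1>D^{(k+1)}_1,\ D^{(k)}_1>D^{(k+1)}_2)$; $\mathbf s_k=\mathbb P(D^{(k-1)}_1>D^{(k)}_1>D^{(k+1)}_1)$. $\sigma_k=\big[f_kf_{k+1}\big(f_k(\mathbf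 q_k-\mathbf p_k^2)+f_{k+1}(\mathbf r_k-\mathbf p_k^2)\big)\big]^{1/2}$ and $\gamma_k=\dfrac{1}{\sigma_{k-1}\sigma_k}f_{k-1}f_kf_{k+1}(\mathbf s_k-\mathbf p_{k-1}\mathbf p_k)$. All of these depend on $m$. A Gaussian vector is non-degenerate if its covariance matrix is invertible. *)

(* Defs.v *)
From HB Require Import structures.
From mathcomp Require Import all_boot all_order all_algebra.
From mathcomp Require Import all_classical all_reals all_analysis.

Set Implicit Arguments.
Unset Strict Implicit.
Unset Printing Implicit Defensive.

Import Order.TTheory GRing.Theory Num.Theory.
Import numFieldNormedType.Exports.

Local Open Scope classical_set_scope.
Local Open Scope ring_scope.

Definition mutually_independent d (Omega : measurableType d) (R : realType)
    (P : probability Omega R) (I : finType) (X : I -> {RV P >-> R}) : Prop :=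
  forall (J : {set I}) (B : I -> set R), (forall i, measurable (B i)) ->
    P (\bigcap_(i in [set` J]) (X i @^-1` B i)) =
    (\prod_(i in J) P (X i @^-1` B i))%E.

(* The k-th die has the faces [D k i], [i : 'I_(n k)], of common law [L k];
   independence is over all the pairs (die, face).  Dice are numbered from 0 to
   l - 1, and the cyclic successor and predecessor are [ordS] and [ord_pred]. *)
Definition independent_random_dice d (Omega : measurableType d) (R : realType)
    (P : probability Omega R) (l : nat) (n : 'I_l -> nat)
    (L : 'I_l -> probability R R)
    (D : forall k : 'I_l, 'I_(n k) -> {RV P >-> R}) : Prop :=
  (forall k i (A : set R), measurable A -> distribution P (D k i) A = L k A) /\
  mutually_independent (fun u : {k : 'I_l & 'I_(n k)} => D (tag u) (tagged u)).

Definition beats (R : realType) (a b : nat) (A : 'I_a -> R) (B : 'I_b -> R) :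
    Prop :=
  (#|[pred ij : 'I_a * 'I_b | (B ij.2 > A ij.1)%R]| <
   #|[pred ij : 'I_a * 'I_b | (A ij.1 > B ij.2)%R]|)%N.

Definition cyclic_chain d (Omega : measurableType d) (R : realType)
    (P : probability Omega R) (l : nat) (n : 'I_l -> nat)
    (D : forall k : 'I_l, 'I_(n k) -> {RV P >-> R}) : set Omega :=
  [set w | forall k : 'I_l,
     beats (fun i => D k i w) (fun j => D (ordS k) j w)].

(* Joint laws of independent faces are product measures of the laws of the dice,
   so that two independent faces make sense even for a die with one face. *)
Definition pk (R : realType) (l : nat) (L : 'I_l -> probability R R)
    (k : 'I_l) : R :=
  fine ((L k \x L (ordS k))%E [set z | z.1 > z.2]).

Definition tie (R : realType) (l : nat) (L : 'I_l -> probability R R)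
    (k : 'I_l) : R :=
  fine ((L k \x L (ordS k))%E [set z | z.1 = z.2]).

Definition qk (R : realType) (l : nat) (L : 'I_l -> probability R R)
    (k : 'I_l) : R :=
  fine (((L k \x L k) \x L (ordS k))%E
    [set z | z.1.1 > z.2 /\ z.1.2 > z.2]).

Definition rk (R : realType) (l : nat) (L : 'I_l -> probability R R)
    (k : 'I_l) : R :=
  fine ((L k \x (L (ordS k) \x L (ordS k)))%E
    [set z | z.1 > z.2.1 /\ z.1 > z.2.2]).

Definition sk (R : realType) (l : nat) (L : 'I_l -> probability R R)
    (k : 'I_l) : R :=
  fine (((L (ord_pred k) \x L k) \x L (ordS k))%E
    [set z | z.1.1 > z.1.2 /\ z.1.2 > z.2]).

Definition sigmak (R : realType) (l : nat) (L : 'I_l -> probability R R)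
    (f : 'I_l -> R) (k : 'I_l) : R :=
  Num.sqrt (f k * f (ordS k) *
    (f k * (qk L k - pk L k ^+ 2) + f (ordS k) * (rk L k - pk L k ^+ 2))).

Definition gammak (R : realType) (l : nat) (L : 'I_l -> probability R R)
    (f : 'I_l -> R) (k : 'I_l) : R :=
  (sigmak L f (ord_pred k) * sigmak L f k)^-1 *
  (f (ord_pred k) * f k * f (ordS k)) * (sk L k - pk L (ord_pred k) * pk L k).

(* [normal_prob mu 0] is uniform on `[0, 1], not the Dirac mass at [mu]. *)
Definition gaussian_law (R : realType) (mu s : R) (A : set R) : \bar R :=
  if s == 0 then \d_mu A else normal_prob mu s A.

Definition gaussian_vector d (Omega : measurableType d) (R : realType)
    (P : probability Omega R) (l : nat) (X : 'I_l -> {RV P >-> R}) : Prop :=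
  forall a : 'I_l -> R, exists mu s : R, forall A : set R, measurable A ->
    P ((fun w => \sum_j a j * X j w) @^-1` A) = gaussian_law mu s A.

Definition centered d (Omega : measurableType d) (R : realType)
    (P : probability Omega R) (l : nat) (X : 'I_l -> {RV P >-> R}) : Prop :=
  forall k, ('E_P[X k] = 0)%E.

(* [fine] is harmless for Gaussian vectors, whose covariances are finite. *)
Definition covariance_mx d (Omega : measurableType d) (R : realType)
    (P : probability Omega R) (l : nat) (X : 'I_l -> {RV P >-> R}) : 'M[R]_l :=
  \matrix_(i, j) fine (covariance P (X i) (X j)).

Definition nondegenerate_vector d (Omega : measurableType d) (R : realType)
    (P : probability Omega R) (l : nat) (X : 'I_l -> {RV P >-> R}) : Prop :=
  covariance_mx X \in unitmx.

(* The branches are exclusive as soon as l >= 3. *)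
Definition cyclic_cov (R : realType) (l : nat) (g : 'I_l -> R) : 'M[R]_l :=
  \matrix_(i, j)
    if i == j then 1
    else if i == ord_pred j then g j
    else if j == ord_pred i then g i
    else 0.

(* Main.v *)
Require Import Defs.
From HB Require Import structures.
From mathcomp Require Import all_boot all_order all_algebra.
From mathcomp Require Import all_classical all_reals all_analysis.
From mathcomp Require Import measurable_realfun ring lra.

Set Implicit Arguments.
Unset Strict Implicit.
Unset Printing Implicit Defensive.

Import Order.TTheory GRing.Theory Num.Theory.
Import numFieldNormedType.Exports.

Local Open Scope classical_set_scope.
Local Open Scope ring_scope.

(* The die [k] beats its successor exactly when the U-statistic [excess k], the
   sum over all pairs of faces of the kernel [half] minus half of the number of
   pairs, is positive.  Its Hoeffding decomposition has a degenerate remainder of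
   variance O(m^2), which is negligible at the scale m^(3/2), a linear part,
   which is a sum over the faces of independent bounded variables of order
   m^(-1/2) after scaling, and a bias, which is negligible by the balance
   hypothesis.  Multiplying the integrals of cos (and sin) face by face shows
   that the integral of cos (t . V + c), for V the vector of the rescaled
   excesses, tends to exp (- Q t / 2) cos c, where Q is the limiting quadratic
   form of the covariances; the same value is obtained for the Gaussian vector X
   by solving the differential equation satisfied by t |-> E cos (t Z + c).
   Products of polynomials in the sines of the coordinates approximate the
   indicator of the orthant on large boxes, and Chebyshev's inequality takes care
   of the complement of the boxes.  As every coordinate of X has variance 1, the
   boundary of the orthant is a null set for X, degenerate or not, so that the
   probabilities converge. *)

(** * Elementary bounds *)

(** The phase [c] lets a single family of real integrals carry both cosine and sine moments ([c = 0]
    and [c = - pi / 2]), so complex characteristic functions are avoided. Products of such cosines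
    are sums of them, hence their convergence passes to all trigonometric polynomials. The limit
    vector enters through linear combinations only, whose laws are one-dimensional: a singular
    covariance, without density in dimension [l], needs no separate argument beyond Dirac laws on
    the line. The orders of magnitude are these. After division by [m ^ (3/2)] each of the at most
    [l m] faces contributes a term of size [m ^ (- 1/2)], so that third-order errors add up to
    [m ^ (- 1/2)]; the remainder has the same order in mean. Two mismatches have to be absorbed. The
    kernel counts a tie for one half while [sigmak] and [gammak] use strict comparisons: the
    covariances differ by multiples of the tie probabilities, which tend to 0. Sines are periodic,
    so a test function says nothing far away: second moments bounded uniformly in [m] are needed
    there. *)

Section elementary_bounds.
Variable R : realType.
Implicit Types x y : R.

(** Turns a bound on the derivative into a bound on the function. Iterated from [cos] and [sin], it
    gives the Taylor remainders below, without the sharp factorials. *)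
Lemma MVT_origin (f f' : R -> R) : (forall x : R, is_derive x 1 f (f' x)) ->
  f 0 = 0 -> forall y, exists2 c, `|c| <= `|y| & f y = f' c * y.
Proof.
move=> df f0 y.
have cf a b : {within `[a, b], continuous f}.
  by apply: derivable_within_continuous => x _; exact: ex_derive.
have [y0|y0|<-] := ltgtP 0 y.
- have [c + fc] := MVT y0 (fun x _ => df x) (cf 0 y).
  rewrite in_itv/= => /andP[c0 cy]; exists c.
    by rewrite !gtr0_norm// ltW.
  by move: fc; rewrite f0 !subr0.
- have [c + fc] := MVT y0 (fun x _ => df x) (cf y 0).
  rewrite in_itv/= => /andP[c0 cy]; exists c.
    by rewrite !ltr0_norm// lerN2 ltW.
  by move: fc; rewrite f0 !sub0r mulrN => /oppr_inj.
- by exists 0; rewrite ?f0 ?mulr0.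
Qed.

Lemma norm_sin_le y : `|sin y| <= `|y|.
Proof.
have [c _ ->] := MVT_origin (f' := cos) (fun x => is_derive_sin x) (@sin0 R) y.
by rewrite normrM ler_piMl// ler_norml cos_geN1 cos_le1.
Qed.

Lemma norm_cosB1_le y : `|cos y - 1| <= y ^+ 2.
Proof.
have d x : is_derive x (1:R) (fun x => cos x - 1) (- sin x).
  by rewrite -[- sin x]subr0; apply: is_deriveB.
have [|c cy ->] := MVT_origin d _ y; first by rewrite cos0 subrr.
rewrite normrM normrN -real_normK ?num_real// expr2 ler_wpM2r//.
exact: le_trans (norm_sin_le _) cy.
Qed.

Lemma norm_sinB_le y : `|sin y - y| <= `|y| ^+ 3.
Proof.
have d x : is_derive x (1:R) (fun x => sin x - x) (cos x - 1).
  by apply: is_deriveB.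
have [|c cy ->] := MVT_origin d _ y; first by rewrite sin0 subrr.
rewrite normrM exprSr ler_wpM2r// (le_trans (norm_cosB1_le _))//.
by rewrite -real_normK ?num_real// lerXn2r ?nnegrE.
Qed.

Lemma norm_cos2_le y : `|cos y - 1 + y ^+ 2 / 2| <= `|y| ^+ 4.
Proof.
have d x : is_derive x (1:R) (fun x => cos x - 1 + x ^+ 2 / 2) (x - sin x).
  have -> : (fun x : R => cos x - 1 + x ^+ 2 / 2) =
      (fun x => cos x - 1) + 2^-1 \*: ((@id R) * (@id R)).
    by apply/funext => z; rewrite !fctE/= expr2 mulrC.
  have d1 : is_derive x (1:R) (fun x => cos x - 1) (- sin x).
    by rewrite -[- sin x]subr0; apply: is_deriveB.
  have d2 : is_derive x (1:R) (2^-1 \*: ((@id R) * (@id R))) x.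
    apply: (is_derive_eq (is_deriveZ _ (is_deriveM (is_derive_id _ _) (is_derive_id _ _)))).
    by rewrite /GRing.scale/=; lra.
  by apply: (is_derive_eq (is_deriveD d1 d2)); rewrite addrC.
have [|c cy ->] := MVT_origin d _ y; first by rewrite cos0 expr0n/= mul0r addr0 subrr.
rewrite normrM exprSr ler_wpM2r// distrC (le_trans (norm_sinB_le _))//.
by rewrite lerXn2r ?nnegrE.
Qed.

(** Squeezed between [1 - x] and [1 / (1 + x) <= 1 - x + x ^ 2], both consequences of
    [1 + y <= expR y]. *)
Lemma norm_expRN_le x : 0 <= x -> `|expR (- x) - 1 + x| <= x ^+ 2.
Proof.
move=> x0; have := expR_ge1Dx (- x) => h.
have x1 : 0 < 1 + x by lra.
have h2 : expR (- x) <= (1 + x)^-1.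
  by rewrite expRN lef_pV2 ?posrE ?expR_gt0// expR_ge1Dx.
have h3 : (1 + x)^-1 <= 1 - x + x ^+ 2.
  rewrite -[leLHS]mul1r ler_pdivrMr//; nra.
rewrite ger0_norm; lra.
Qed.

End elementary_bounds.
(** * Integrals of bounded measurable functions *)

(** Integrable for every probability measure and stable under the operations used below, so that
    most integrability side conditions become syntactic. *)
Definition bmf d (T : measurableType d) (R : realType) (f : T -> R) : Prop :=
  measurable_fun setT f /\ exists M : R, forall x, `|f x| <= M.

Section bmf.
Context d (T : measurableType d) (R : realType) (P : probability T R).
Implicit Types f g : T -> R.

Lemma bmf_integrable f : bmf f -> P.-integrable setT (EFin \o f).
Proof.
move=> [mf [M fM]]; apply: measurable_bounded_integrable => //.
  by rewrite [X in (X < _)%E]probability_setT ltry.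
by exists M; split; [exact: num_real|move=> x Mx y _; exact: le_trans (fM y) (ltW Mx)].
Qed.

Lemma bmf_cst (c : R) : bmf (fun _ : T => c).
Proof. by split; [exact: measurable_cst|exists `|c|]. Qed.

Lemma bmfD f g : bmf f -> bmf g -> bmf (fun x => f x + g x).
Proof.
move=> [mf [M fM]] [mg [N gN]]; split; first exact: measurable_funD.
by exists (M + N) => x; rewrite (le_trans (ler_normD _ _))// lerD.
Qed.

Lemma bmfM f g : bmf f -> bmf g -> bmf (fun x => f x * g x).
Proof.
move=> [mf [M fM]] [mg [N gN]]; split; first exact: measurable_funM.
by exists (M * N) => x; rewrite normrM ler_pM.
Qed.

Lemma bmfN f : bmf f -> bmf (fun x => - f x).
Proof.
move=> [mf [M fM]]; split; first exact: measurable_funN.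
by exists M => x; rewrite normrN.
Qed.

Lemma bmfB f g : bmf f -> bmf g -> bmf (fun x => f x - g x).
Proof. by move=> bf bg; apply: bmfD => //; exact: bmfN. Qed.

Lemma bmfX f n : bmf f -> bmf (fun x => f x ^+ n).
Proof.
move=> bf; elim: n => [|n IH]; first by under eq_fun do rewrite expr0; exact: bmf_cst.
by under eq_fun do rewrite exprS; exact: bmfM.
Qed.

Lemma bmf_norm f : bmf f -> bmf (fun x => `|f x|).
Proof.
move=> [mf [M fM]]; split; last by exists M => x; rewrite normr_id.
exact: measurableT_comp.
Qed.

Lemma bmf_sum (I : Type) (s : seq I) (p : pred I) (F : I -> T -> R) :
  (forall i, bmf (F i)) -> bmf (fun x => \sum_(i <- s | p i) F i x).
Proof.
move=> bF; elim: s => [|i s IH].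
  by under eq_fun do rewrite big_nil; exact: bmf_cst.
under eq_fun do rewrite big_cons; case: (p i) => //.
exact: bmfD.
Qed.

Lemma bmf_comp d' (T' : measurableType d') (h : T' -> T) f :
  measurable_fun setT h -> bmf f -> bmf (f \o h).
Proof.
by move=> mh [mf [M fM]]; split; [exact: measurableT_comp|exists M => x; exact: fM].
Qed.

Lemma bmf_cos f : measurable_fun setT f -> bmf (fun x => cos (f x)).
Proof.
move=> mf; split; last by exists 1 => x; rewrite ler_norml cos_geN1 cos_le1.
exact: (measurableT_comp (continuous_measurable_fun (@continuous_cos R)) mf).
Qed.

Lemma bmf_sin f : measurable_fun setT f -> bmf (fun x => sin (f x)).
Proof.
move=> mf; split; last by exists 1 => x; rewrite ler_norml sin_geN1 sin_le1.
exact: (measurableT_comp (continuous_measurable_fun (@continuous_sin R)) mf).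
Qed.

Lemma bmf_indic (A : set T) : measurable A -> bmf (\1_A : T -> R).
Proof.
move=> mA; split; first exact: measurable_indic.
by exists 1 => x; rewrite indicE; case: (x \in A); rewrite ?normr1 ?normr0.
Qed.

Lemma Rint_cst (c : R) : \int[P]_x c = c.
Proof. by rewrite Rintegral_cst// [X in fine X]probability_setT/= mulr1. Qed.

Lemma Rint_sum (I : Type) (s : seq I) (p : pred I) (F : I -> T -> R) :
  (forall i, P.-integrable setT (EFin \o F i)) ->
  \int[P]_x (\sum_(i <- s | p i) F i x) = \sum_(i <- s | p i) \int[P]_x F i x.
Proof.
(* Integrability of the partial sums is carried through the induction, since additivity asks for
   it. *)
move=> iF; have H : P.-integrable setT (EFin \o (fun x => \sum_(i <- s | p i) F i x)) /\
   \int[P]_x (\sum_(i <- s | p i) F i x) = \sum_(i <- s | p i) \int[P]_x F i x; last by case: H.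
elim: s => [|i s [IH1 IH2]].
  rewrite big_nil; split.
    under eq_fun do rewrite big_nil; exact: bmf_integrable (bmf_cst _).
  under eq_Rintegral do rewrite big_nil; exact: Rint_cst.
rewrite big_cons; case: ifPn => pi.
  split.
    rewrite /comp; under eq_fun do rewrite big_cons pi EFinD.
    by apply: integrableD; [exact: measurableT|exact: iF|exact: IH1].
  under eq_Rintegral do rewrite big_cons pi.
  by rewrite RintegralD ?IH2.
split; first by under eq_fun do rewrite big_cons (negbTE pi).
by under eq_Rintegral do rewrite big_cons (negbTE pi).
Qed.

Lemma Rint_indic (A : set T) : measurable A -> \int[P]_x (\1_A x : R) = fine (P A).
Proof. by move=> mA; rewrite /Rintegral integral_indic// setIT. Qed.

Lemma ler_Rint_norm f (M : R) : P.-integrable setT (EFin \o f) ->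
  (forall x, `|f x| <= M) -> `|\int[P]_x f x| <= M.
Proof.
move=> fi fM; apply: (le_trans (le_normr_Rintegral _ fi)) => //.
rewrite -[leRHS](Rint_cst M); apply: le_Rintegral => //.
- exact: integrable_abse fi.
- exact: bmf_integrable (bmf_cst _).
Qed.

End bmf.
Arguments bmf_integrable {d T R P f}.

Ltac solve_bmf := repeat first [exact: bmf_cst | done | apply: bmfB | apply: bmfD
  | apply: bmfM | apply: bmfX | apply: bmfN | apply: bmf_cos | apply: bmf_sin].

Section bmf_integral.
Context d (T : measurableType d) (R : realType) (P : probability T R).
Implicit Types f g : T -> R.

Lemma RintD f g : bmf f -> bmf g ->
  \int[P]_x (f x + g x) = \int[P]_x f x + \int[P]_x g x.
Proof. by move=> bf bg; rewrite RintegralD//; exact: bmf_integrable. Qed.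

Lemma RintB f g : bmf f -> bmf g ->
  \int[P]_x (f x - g x) = \int[P]_x f x - \int[P]_x g x.
Proof. by move=> bf bg; rewrite RintegralB//; exact: bmf_integrable. Qed.

Lemma RintZl f c : bmf f -> \int[P]_x (c * f x) = c * \int[P]_x f x.
Proof. by move=> bf; rewrite RintegralZl//; exact: bmf_integrable. Qed.

Lemma RintZr f c : bmf f -> \int[P]_x (f x * c) = \int[P]_x f x * c.
Proof. by move=> bf; rewrite RintegralZr//; exact: bmf_integrable. Qed.

Lemma ler_Rint f g : bmf f -> bmf g -> (forall x, f x <= g x) ->
  \int[P]_x f x <= \int[P]_x g x.
Proof. by move=> bf bg fg; apply: le_Rintegral => //; exact: bmf_integrable. Qed.

End bmf_integral.
(** * Independence *)

Section independence.
Context d (Omega : measurableType d) (R : realType) (P : probability Omega R).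
Context (I : finType) (X : I -> {RV P >-> R}).
Hypothesis hX : mutually_independent X.

(** The pi-system of cylinder events that leave [X v] free. *)
Definition off (v : I) : set (set Omega) :=
  [set E | exists2 C : I -> set R, (forall i, measurable (C i)) &
     E = \bigcap_(i in [set i | i != v]) (X i @^-1` C i)].

Lemma off_measurable v : off v `<=` measurable.
Proof.
move=> _ [C mC ->]; apply: fin_bigcap_measurable => [|i _]; first exact: finite_finset.
by rewrite -[_ @^-1` _]setTI; exact: measurable_funP.
Qed.

Lemma sigma_off_measurable v : <<s off v >> `<=` measurable.
Proof. apply: smallest_sub; [exact: sigma_algebra_measurable|exact: off_measurable]. Qed.

(** Both sides are finite measures in [E]: the restriction of [P] to an event and a multiple of [P].
    They agree on the pi-system [off v], hence on the sigma-algebra it generates. *)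
Lemma off_indep v (A : set R) (E : set Omega) : measurable A -> <<s off v >> E ->
  P (X v @^-1` A `&` E) = (P (X v @^-1` A) * P E)%E.
Proof.
move=> mA; have mXA : measurable (X v @^-1` A).
  by rewrite -[_ @^-1` _]setTI; exact: measurable_funP.
have p0 : 0 <= fine (P (X v @^-1` A)) by exact: fine_ge0.
pose m1 : {measure set Omega -> \bar R} := mrestr P mXA.
pose m2 : {measure set Omega -> \bar R} := mscale (NngNum p0) P.
move=> oE; have -> : P (X v @^-1` A `&` E) = m1 E by rewrite setIC.
have -> : (P (X v @^-1` A) * P E)%E = m2 E.
  by rewrite /m2/= /mscale/= fineK// fin_num_measure.
apply: (g_sigma_algebra_measure_unique (off v) (@off_measurable v) (fun=> setT)) => //.
- by move=> _; exists (fun=> setT) => //; apply/seteqP; split.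
- by rewrite bigcup_const.
- move=> _ _ [C mC ->] [C' mC' ->]; exists (fun i => C i `&` C' i).
    by move=> i; exact: measurableI.
  by rewrite -bigcapI.
- move=> _ [C mC ->].
  rewrite /m1/= /mrestr /m2/= /mscale/= fineK ?fin_num_measure//.
  have TI i : [set` [set: I]%SET] i by rewrite /= inE.
  (* Mutual independence is used twice: over all indices with [A] at [v], then over the indices
     other than [v] to recognise the remaining product. *)
  pose B i := if i == v then A else C i.
  have mB i : measurable (B i) by rewrite /B; case: ifP.
  have := hX [set: I]%SET mB; rewrite (bigD1 v)//=.
  have -> : \bigcap_(i in [set` [set: I]%SET]) (X i @^-1` B i) =
     \bigcap_(i in [set i | i != v]) (X i @^-1` C i) `&` (X v @^-1` A).
    apply/seteqP; split => [w /= H|w /= [H1 H2] i _].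
      split; last by have := H v (TI v); rewrite /B eqxx.
      by move=> i /= iv; have := H i (TI i); rewrite /B (negbTE iv).
    by rewrite /B; case: eqP => [->//|/eqP iv]; exact: H1.
  move=> ->; rewrite {1}/B eqxx; congr (_ * _)%E.
  have := hX [set~ v]%SET mC.
  have -> : \bigcap_(i in [set` [set~ v]%SET]) (X i @^-1` C i) =
     \bigcap_(i in [set i | i != v]) (X i @^-1` C i).
    by apply: eq_bigcapl; split => i/=; rewrite !inE.
  move=> ->; apply: eq_big => [i|i iv]; first by rewrite !inE.
  by rewrite /B ifF//; apply/negbTE; move: iv; rewrite !inE.
- by move=> _; rewrite /m1/= /mrestr setTI (le_lt_trans (probability_le1 _ _)) ?ltry.
Qed.

(* [Omega] with the sigma-algebra generated by all the variables but [X v]. *)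
Definition OmegaOff v := g_sigma_algebraType (off v).

Lemma measurable_off v i : i != v -> measurable_fun setT (X i : OmegaOff v -> R).
Proof.
move=> iv _ A mA; rewrite setTI; apply: sub_gen_smallest.
exists (fun j => if j == i then A else setT) => [j|]; first by case: ifP.
apply/seteqP; split => [w /= XA j jv|w H].
  by case: eqP => [->|].
by have := H i iv; rewrite eqxx.
Qed.

Definition idOff v : Omega -> OmegaOff v := id.

Lemma measurable_idOff v : measurable_fun setT (idOff v).
Proof. by move=> _ A mA; rewrite setTI; exact: sigma_off_measurable mA. Qed.

HB.instance Definition _ v :=
  isMeasurableFun.Build _ _ _ _ (idOff v) (@measurable_idOff v).

Definition pairOff v : Omega -> R * OmegaOff v := fun w => (X v w, w).

Lemma measurable_pairOff v : measurable_fun setT (pairOff v).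
Proof. by apply: measurable_fun_pair => //; exact: measurable_idOff. Qed.

HB.instance Definition _ v :=
  isMeasurableFun.Build _ _ _ _ (pairOff v) (@measurable_pairOff v).

(** Fubini for one variable independent of the others: the pair formed by [X v] and the sample point
    seen in [OmegaOff v] has a product law, so [X v] may be integrated first. Measurability over
    [OmegaOff v] expresses that [F x] does not look at [X v]. *)
Lemma integrate_out v (mu : probability R R) (F : R -> Omega -> R) :
  (forall A, measurable A -> distribution P (X v) A = mu A) ->
  bmf (fun z : R * OmegaOff v => F z.1 z.2) ->
  \int[P]_w F (X v w) w = \int[P]_w (\int[mu]_x F x w).
Proof.
move=> hmu bF; have [mF [M FM]] := bF.
pose PO : probability (OmegaOff v) R := distribution P (idOff v).
pose m : probability (R * OmegaOff v)%type R := distribution P (pairOff v).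
(* A product measure is determined by its values on rectangles, where the equality is
   [off_indep]. *)
have mE A : measurable A -> (mu \x PO)%E A = m A.
  apply: product_measure_unique => {}A B mA mB.
  transitivity (distribution P (X v) A * PO B)%E; last by rewrite hmu.
  exact: (@off_indep v A B).
pose f (z : R * OmegaOff v) := (F z.1 z.2)%:E.
have mf : measurable_fun setT f by exact/measurable_EFinP.
have fi : (mu \x PO)%E.-integrable setT f.
  have b := @bmf_integrable _ _ _ m _ bF.
  have/integrableP[_ H] := b; apply/integrableP; split => //.
  apply: le_lt_trans H; rewrite (eq_measure_integral m)// => A mA _; exact: mE.
rewrite {1}/Rintegral.
transitivity (fine (\int[m]_z f z)).
  congr fine; rewrite integral_distribution//.
  by apply: (@bmf_integrable _ _ _ P (fun w => F (X v w) w)); apply: (bmf_comp (@measurable_pairOff v) bF).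
transitivity (fine (\int[mu \x PO]_z f z)).
  by congr fine; apply/esym/eq_measure_integral => A mA _; exact: mE.
rewrite -integral21_prod_meas1//.
have GE w : fubini_G mu f w = (\int[mu]_x F x w)%:E.
  rewrite /fubini_G /f/= /Rintegral fineK//; apply: integrable_fin_num => //.
  apply: (@bmf_integrable _ _ _ mu (F^~ w)).
  by apply: (bmf_comp (h := fun x => (x, w : OmegaOff v)) _ bF); exact: measurable_fun_pair.
under eq_integral do rewrite GE.
have mG : measurable_fun setT (fun w : OmegaOff v => (\int[mu]_x F x w)%:E).
  have -> : (fun w : OmegaOff v => (\int[mu]_x F x w)%:E) = fubini_G mu f.
    by apply/funext => w; rewrite GE.
  exact: measurable_fubini_G fi.
rewrite /Rintegral integral_distribution//.
apply: (@bmf_integrable _ _ _ P (fun w => \int[mu]_x F x w)); split.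
  exact/measurable_EFinP/(measurableT_comp mG (@measurable_idOff v)).
exists M => w; apply: ler_Rint_norm => [|x]; last exact: FM (x, w).
apply: (@bmf_integrable _ _ _ mu (F^~ w)).
by apply: (bmf_comp (h := fun x => (x, w : OmegaOff v)) _ bF); exact: measurable_fun_pair.
Qed.
End independence.

(** * Sums of independent variables *)

Section clt.
Context d (Omega : measurableType d) (R : realType) (P : probability Omega R).
Context (I : finType) (X : I -> {RV P >-> R}).
Hypothesis hX : mutually_independent X.
Variables (mu : I -> probability R R).
Hypothesis hmu : forall i A, measurable A -> distribution P (X i) A = mu i A.
Variables (psi : I -> R -> R) (b : R).
Hypothesis b1 : b <= 1.
Hypothesis mpsi : forall i, measurable_fun setT (psi i).
Hypothesis psib : forall i x, `|psi i x| <= b.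
Hypothesis psi0 : forall i, \int[mu i]_x psi i x = 0.

Let S s w := \sum_(i <- s) psi i (X i w).
Let var i := \int[mu i]_x psi i x ^+ 2.

Let bpsi i : bmf (psi i).
Proof. by split => //; exists b. Qed.

Let b0 (i : I) : 0 <= b.
Proof. exact: le_trans (normr_ge0 _) (psib i 0). Qed.

(** What permits freezing [S s] while [X v] is integrated out. *)
Lemma bmf_off_sum v s : v \notin s -> bmf (S s : OmegaOff X v -> R).
Proof.
move=> vs; have -> : S s = (fun w => \sum_(i <- s | i != v) psi i (X i w)).
  apply/funext => w; rewrite /S [LHS]big_seq [RHS]big_seq_cond; apply: eq_bigl => i.
  by case: (boolP (i \in s)) => //= iv; apply/esym; apply: contraNneq vs => <-.
elim: {vs} s => [|i s IH].
  by under eq_fun do rewrite big_nil; exact: bmf_cst.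
under eq_fun do rewrite big_cons; case: (boolP (i != v)) => [iv|_ //].
by apply: bmfD => //; exact: (bmf_comp (@measurable_off _ _ _ _ _ X v i iv) (bpsi i)).
Qed.

(** The addition formula plays the role of the factorisation of characteristic functions, the new
    summand being integrated out. *)
Lemma cos_sum_step v s c : v \notin s ->
  \int[P]_w cos (psi v (X v w) + (S s w + c)) =
    (\int[mu v]_x cos (psi v x)) * (\int[P]_w cos (S s w + c)) -
    (\int[mu v]_x sin (psi v x)) * (\int[P]_w sin (S s w + c)).
Proof.
move=> vs; have bS := bmf_off_sum vs.
have bSc : bmf (fun w : OmegaOff X v => S s w + c) by apply: bmfD => //; exact: bmf_cst.
have mSc := bSc.1.
have mS' : measurable_fun setT (fun w : Omega => S s w + c).
  exact: (measurableT_comp mSc (@measurable_idOff _ _ _ _ _ X v)).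
rewrite (integrate_out hX (hmu v) (F := fun x w => cos (psi v x + (S s w + c)))).
  under eq_Rintegral => w _.
    have -> : \int[mu v]_x cos (psi v x + (S s w + c)) =
       (\int[mu v]_x cos (psi v x)) * cos (S s w + c) -
       (\int[mu v]_x sin (psi v x)) * sin (S s w + c).
      under eq_Rintegral do rewrite cosD.
      by rewrite RintB ?RintZr//; solve_bmf.
    over.
  by rewrite RintB ?RintZl//; solve_bmf.
apply: bmf_cos; apply: measurable_funD.
  exact: (measurableT_comp (mpsi v) measurable_fst).
exact: (measurableT_comp mSc measurable_snd).
Qed.

(** Both quantities are compared with [1 - var i / 2]; the two errors are at most [b ^ 4], hence at
    most [b ^ 3] as [b <= 1]. *)
Lemma cos_moment i : `|\int[mu i]_x cos (psi i x) - expR (- (var i / 2))| <= 2 * b ^+ 3.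
Proof.
have bb := b0 i.
have v0 : 0 <= var i by apply: Rintegral_ge0 => x _; exact: sqr_ge0.
have vb : var i <= b ^+ 2.
  apply: le_trans (ler_norm _) _; apply: ler_Rint_norm => [|x].
    by apply: bmf_integrable; solve_bmf.
  by rewrite normrX lerXn2r ?nnegrE ?b0//.
have h1 : `|\int[mu i]_x cos (psi i x) - 1 + var i / 2| <= b ^+ 3.
  have -> : \int[mu i]_x cos (psi i x) - 1 + var i / 2 =
      \int[mu i]_x (cos (psi i x) - 1 + psi i x ^+ 2 / 2).
    rewrite RintD ?RintB ?Rint_cst ?RintZr//;
      by solve_bmf.
  apply: ler_Rint_norm => [|x].
    by apply: bmf_integrable; solve_bmf.
  apply: le_trans (norm_cos2_le _) _.
  apply: (@le_trans _ _ (b ^+ 4)); first by rewrite lerXn2r ?nnegrE.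
  by rewrite [leLHS]exprS ler_piMl ?exprn_ge0.
have h2 := norm_expRN_le (x := var i / 2) (divr_ge0 v0 (ler0n _ 2)).
have h3 : (var i / 2) ^+ 2 <= b ^+ 3.
  apply: (@le_trans _ _ (b ^+ 2 * b ^+ 2)).
    rewrite expr2; apply: ler_pM; rewrite ?divr_ge0//; lra.
  by rewrite -exprD [leLHS]exprS ler_piMl ?exprn_ge0.
have := ler_normB (\int[mu i]_x cos (psi i x) - 1 + var i / 2) (expR (- (var i / 2)) - 1 + var i / 2).
rewrite (_ : _ - _ = \int[mu i]_x cos (psi i x) - expR (- (var i / 2))); last by ring.
lra.
Qed.

(** The first-order term drops out because [psi i] is centered. *)
Lemma sin_moment i : `|\int[mu i]_x sin (psi i x)| <= b ^+ 3.
Proof.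
have -> : \int[mu i]_x sin (psi i x) = \int[mu i]_x (sin (psi i x) - psi i x).
  by rewrite RintB ?psi0 ?subr0//; exact: bmf_sin.
apply: ler_Rint_norm => [|x].
  by apply: bmf_integrable; solve_bmf.
by apply: le_trans (norm_sinB_le _) _; rewrite lerXn2r ?nnegrE ?(b0 i).
Qed.

(* Adding one independent summand multiplies the integral of the cosine by
   [expR (- var / 2)] up to [3 b ^ 3]; the sine terms are of third order. *)
Lemma cos_sum_approx s c : uniq s ->
  `|\int[P]_w cos (S s w + c) - expR (- ((\sum_(i <- s) var i) / 2)) * cos c|
     <= (3 * (size s)%:R) * b ^+ 3.
Proof.
elim: s => [_|v s IH /= /andP[vs us]].
  rewrite big_nil mul0r oppr0 expR0 mul1r mulr0 mul0r /S.
  by under eq_Rintegral do rewrite big_nil add0r; rewrite Rint_cst subrr normr0.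
have -> : \int[P]_w cos (S (v :: s) w + c) = \int[P]_w cos (psi v (X v w) + (S s w + c)).
  by apply: eq_Rintegral => w _; rewrite /S big_cons addrA.
rewrite cos_sum_step// big_cons mulrDl opprD expRD.
have bb := b0 v.
have mSc : measurable_fun setT (fun w : Omega => S s w + c).
  exact: (measurableT_comp (bmfD (bmf_off_sum vs) (bmf_cst _ c)).1 (@measurable_idOff _ _ _ _ _ X v)).
have Cle : `|\int[P]_w cos (S s w + c)| <= 1.
  apply: ler_Rint_norm => [|w]; first by apply: bmf_integrable; solve_bmf.
  by rewrite ler_norml cos_geN1 cos_le1.
have Sle : `|\int[P]_w sin (S s w + c)| <= 1.
  apply: ler_Rint_norm => [|w]; first by apply: bmf_integrable; solve_bmf.
  by rewrite ler_norml sin_geN1 sin_le1.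
have {IH} := IH us; have := cos_moment v; have := sin_moment v.
set C := \int[P]_w cos _ in Cle *; set Sn := \int[P]_w sin _ in Sle *.
set cm := \int[mu v]_x cos _; set sm := \int[mu v]_x sin _.
set e := expR _; set es := expR _; set N : R := (size s)%:R => hs hc IH.
have e01 : `|e| <= 1.
  rewrite ger0_norm ?expR_ge0// -[leRHS]expR0 ler_expR oppr_le0 divr_ge0//.
  by apply: Rintegral_ge0 => x _; exact: sqr_ge0.
(* Each small factor is paired with one of absolute value at most 1, so the errors add up without
   amplification. *)
rewrite (_ : _ - _ = (cm - e) * C - sm * Sn + e * (C - es * cos c)); last by ring.
apply: le_trans (ler_normD _ _) _.
apply: (@le_trans _ _ (2 * b ^+ 3 + b ^+ 3 + 3 * N * b ^+ 3)); last first.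
  by rewrite -natr1 -/N; lra.
apply: lerD; last by rewrite normrM (le_trans _ IH)// ler_piMl.
apply: le_trans (ler_normB _ _) _; apply: lerD; rewrite normrM.
  by rewrite (le_trans _ hc)// ler_piMr.
by rewrite (le_trans _ hs)// ler_piMr.
Qed.

(** Once [X v] is integrated out, the cross term is a multiple of the zero mean of [psi v]. *)
Lemma sum_sq_moment s : uniq s -> \int[P]_w (S s w ^+ 2) = \sum_(i <- s) var i.
Proof.
elim: s => [_|v s IH /= /andP[vs us]].
  by rewrite big_nil /S; under eq_Rintegral do rewrite big_nil expr0n/=; rewrite Rint_cst.
have bS := bmf_off_sum vs.
have bS' : bmf (S s : Omega -> R) := bmf_comp (@measurable_idOff _ _ _ _ _ X v) bS.
have bpsi' := bpsi v.
rewrite big_cons -IH// {IH}.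
have -> : \int[P]_w (S (v :: s) w ^+ 2) = \int[P]_w ((psi v (X v w) + S s w) ^+ 2).
  by apply: eq_Rintegral => w _; rewrite /S big_cons.
rewrite (integrate_out hX (hmu v) (F := fun x w => (psi v x + S s w) ^+ 2)); last first.
  apply: bmfX; apply: bmfD; first exact: (bmf_comp measurable_fst bpsi').
  exact: (bmf_comp measurable_snd bS).
transitivity (\int[P]_w (var v + S s w ^+ 2)).
  apply: eq_Rintegral => w _.
  transitivity (\int[mu v]_x (psi v x ^+ 2 + (psi v x * (S s w *+ 2) + S s w ^+ 2))).
    by apply: eq_Rintegral => x _; ring.
  have bC (k : R) := bmf_cst R k.
  rewrite RintD; [|exact: bmfX|by apply: bmfD => //; exact: bmfM].
  rewrite RintD//; last exact: bmfM.
  by rewrite RintZr ?psi0 ?mul0r ?add0r ?Rint_cst.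
rewrite RintD ?Rint_cst//; first exact: bmf_cst.
exact: bmfX.
Qed.

End clt.

(** * Degenerate kernels *)

Section degenerate_kernel.
Context d (Omega : measurableType d) (R : realType) (P : probability Omega R).
Context (I : finType) (X : I -> {RV P >-> R}).
Hypothesis hX : mutually_independent X.
Variables (mu : I -> probability R R).
Hypothesis hmu : forall i A, measurable A -> distribution P (X i) A = mu i A.
Variables (A B : finType) (u : A -> I) (v : B -> I).
Hypothesis (inju : injective u) (injv : injective v).
Hypothesis uv : forall i j, u i != v j.
Variables (g : R -> R -> R) (C : R).
Hypothesis mg : measurable_fun setT (fun z : R * R => g z.1 z.2).
Hypothesis gC : forall x y, `|g x y| <= C.
Hypothesis gl : forall i y, \int[mu (u i)]_x g x y = 0.
Hypothesis gr : forall j x, \int[mu (v j)]_y g x y = 0.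

Let Y (p : A * B) w := g (X (u p.1) w) (X (v p.2) w).

Let bg d' (T : measurableType d') (f h : T -> R) :
  measurable_fun setT f -> measurable_fun setT h -> bmf (fun w => g (f w) (h w)).
Proof.
move=> mf mh; split; last by exists C.
exact: (measurableT_comp mg (measurable_fun_pair mf mh)).
Qed.

Let bY p : bmf (Y p).
Proof. exact: bg. Qed.

(** Distinct pairs differ in some coordinate. The corresponding variable of [p] occurs in one factor
    only, [uv] excluding the other side, and integrating it out gives 0. *)
Lemma degenerate_cross p q : p != q -> \int[P]_w (Y p w * Y q w) = 0.
Proof.
move=> pq.
have mX k (i : I) : i != k -> measurable_fun setT (fun z : R * OmegaOff X k => X i z.2).
  by move=> ik; exact: (measurableT_comp (@measurable_off _ _ _ _ _ X k i ik) measurable_snd).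
have [e2|n2] := eqVneq p.2 q.2.
  have n1 : p.1 != q.1.
    by apply: contraNneq pq => e1; rewrite [p]surjective_pairing [q]surjective_pairing e1 e2.
  rewrite (integrate_out hX (hmu (u p.1))
    (F := fun x w => g x (X (v p.2) w) * g (X (u q.1) w) (X (v q.2) w))).
    under eq_Rintegral => w _.
      rewrite RintZr ?gl ?mul0r; last by apply: bg => //; exact: measurable_cst.
      over.
    by rewrite Rint_cst.
  apply: bmfM; apply: bg => //=; try exact: measurable_fst.
  - by apply: mX; rewrite eq_sym uv.
  - by apply: mX; rewrite inj_eq// eq_sym.
  - by apply: mX; rewrite eq_sym uv.
rewrite (integrate_out hX (hmu (v p.2))
    (F := fun y w => g (X (u p.1) w) y * g (X (u q.1) w) (X (v q.2) w))).
  under eq_Rintegral => w _.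
    rewrite RintZr ?gr ?mul0r; last by apply: bg => //; exact: measurable_cst.
    over.
  by rewrite Rint_cst.
apply: bmfM; apply: bg => //=; try exact: measurable_fst.
- by apply: mX; rewrite uv.
- by apply: mX; rewrite uv.
- by apply: mX; rewrite inj_eq// eq_sym.
Qed.

(* Distinct terms of the double sum are orthogonal. *)
Lemma degenerate_sum_sq :
  \int[P]_w ((\sum_p Y p w) ^+ 2) <= (#|A| * #|B|)%:R * C ^+ 2.
Proof.
under eq_Rintegral => w _ do rewrite expr2 big_distrl/=.
rewrite Rint_sum; last first.
  by move=> p; apply: bmf_integrable; apply: bmfM => //; exact: bmf_sum.
rewrite (eq_bigr (fun p => \int[P]_w (Y p w ^+ 2))); last first.
  move=> p _; under eq_Rintegral => w _ do rewrite big_distrr/=.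
  rewrite Rint_sum; last by move=> q; apply: bmf_integrable; solve_bmf.
  by rewrite (bigD1 p)//= big1 ?addr0// => q qp; rewrite degenerate_cross// eq_sym.
apply: (@le_trans _ _ (\sum_(p : A * B) C ^+ 2)).
  apply: ler_sum => p _; rewrite -[leRHS](Rint_cst P); apply: ler_Rint; try solve_bmf.
  move=> w; rewrite -real_normK ?num_real// lerXn2r ?nnegrE//.
    exact: le_trans (normr_ge0 _) (gC 0 0).
  exact: gC.
by rewrite sumr_const card_prod mulr_natl.
Qed.

End degenerate_kernel.

(** * Gaussian integrals *)

Section density.
Context d (T : measurableType d) (R : realType).
Variables (mu nu : {measure set T -> \bar R}) (g : T -> R).
Hypothesis mg : measurable_fun setT g.
Hypothesis g0 : forall x, 0 <= g x.
Hypothesis nuE : forall A, measurable A -> nu A = (\int[mu]_(x in A) (g x)%:E)%E.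

Local Open Scope ereal_scope.

Import HBNNSimple.

Let sfun_integral_density (h : {nnsfun T >-> R}) :
  \int[nu]_x (h x)%:E = \int[mu]_x (h x * g x)%:E.
Proof.
have mi r : measurable (h @^-1` [set r]) by [].
rewrite integralT_nnsfun sintegralE.
have -> : (fun x => (h x * g x)%:E) =
    fun x => \sum_(r \in range h) (r * \1_(h @^-1` [set r]) x * g x)%:E.
  apply/funext => x; rewrite fsumEFin//; congr _%:E; rewrite {1}fimfunE.
  rewrite !fsbig_finite//= mulr_suml.
  by [].
rewrite ge0_integral_fsum//; last 2 first.
- move=> r; apply/measurable_EFinP; apply: measurable_funM => //.
  by apply: measurable_funM => //; exact: measurable_indic.
- move=> r x _; rewrite EFinM mule_ge0 ?lee_fin//.
  have := nnfun_muleindic_ge0 h r x; by rewrite lee_fin.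
apply: eq_fsbigr => r; rewrite inE => -[x _ hxr].
have r0 : (0 <= r)%R by rewrite -hxr.
rewrite nuE//.
under [RHS]eq_integral => y _ do rewrite -mulrA EFinM.
rewrite ge0_integralZl//.
- congr *%E; rewrite integral_mkcond; apply: eq_integral => y _.
  by rewrite patchE indicE; case: ifPn => _; rewrite ?mul1r ?mul0r.
- by apply/measurable_EFinP; apply: measurable_funM.
- by move=> y _; rewrite lee_fin mulr_ge0.
Qed.

(** Holds for simple functions by linearity; monotone convergence along one approximating sequence
    passes to the limit on both sides. *)
Lemma ge0_integral_density (h : T -> \bar R) :
  measurable_fun setT h -> (forall x, 0 <= h x) ->
  \int[nu]_x h x = \int[mu]_x (h x * (g x)%:E).
Proof.
move=> mh h0; pose f_ := nnsfun_approx measurableT mh.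
transitivity (limn (fun n => \int[nu]_x (f_ n x)%:E)).
  rewrite -monotone_convergence//.
  - by apply: eq_integral => y _; apply/esym/cvg_lim => //; exact: cvg_nnsfun_approx.
  - by move=> n; exact/measurable_EFinP.
  - by move=> n y _; rewrite lee_fin.
  - by move=> y _ m n mn; rewrite lee_fin; exact/lefP/nd_nnsfun_approx.
transitivity (limn (fun n => \int[mu]_x ((f_ n x)%:E * (g x)%:E))).
  apply: congr_lim; apply/funext => n; rewrite sfun_integral_density.
  by apply: eq_integral => x _; rewrite EFinM.
rewrite -monotone_convergence//.
- apply: eq_integral => y _; apply/cvg_lim => //.
  by apply: cvgeZr => //; exact: cvg_nnsfun_approx.
- by move=> n; apply: emeasurable_funM; exact/measurable_EFinP.
- by move=> n y _; rewrite -EFinM lee_fin mulr_ge0.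
- move=> y _ m n mn; rewrite lee_wpmul2r ?lee_fin//; exact/lefP/nd_nnsfun_approx.
Qed.

End density.

Section normal_integrals.
Variables (R : realType) (m s : R).
Hypothesis s0 : s != 0.
Local Notation leb := (@lebesgue_measure R).
Local Notation p := (normal_pdf m s).
Let q := normal_fun m (Num.sqrt 2 * s).
Let K := normal_peak s * (1 + 4 * s ^+ 2).

Let s2 : 0 < s ^+ 2.
Proof. by rewrite exprn_even_gt0. Qed.

Let p0 x : 0 <= p x := normal_pdf_ge0 m s x.

Let q0 x : 0 <= q x := normal_fun_ge0 m _ x.

(** Half of the Gaussian exponent absorbs the quadratic factor, by [u * expR (- u) <= 1]. The other
    half is [q], proportional to the normal density of doubled variance and therefore integrable. *)
Lemma normal_pdf_sqr_le x : (1 + (x - m) ^+ 2) * p x <= K * q x.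
Proof.
rewrite normal_pdfE// /K /q /normal_fun mulrCA -mulrA ler_pM2l ?normal_peak_gt0//.
set y := x - m.
have -> : (Num.sqrt 2 * s) ^+ 2 = 2 * s ^+ 2 by rewrite exprMn sqr_sqrtr.
set u := y ^+ 2 / (4 * s ^+ 2).
have e1 : - y ^+ 2 / (s ^+ 2 *+ 2) = - u + - u.
  by rewrite /u; field.
have e2 : - y ^+ 2 / ((2 * s ^+ 2) *+ 2) = - u.
  by rewrite /u; field.
have e3 : y ^+ 2 = 4 * s ^+ 2 * u.
  by rewrite /u; field.
rewrite e1 e2 e3 expRD mulrA ler_wpM2r ?expR_ge0//.
have u0 : 0 <= u by rewrite /u divr_ge0 ?sqr_ge0// mulr_ge0// ltW.
have h1 : u * expR (- u) <= 1.
  rewrite expRN ler_pdivrMr ?expR_gt0// mul1r.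
  by have := expR_ge1Dx u; set e := expR u; lra.
have h2 : expR (- u) <= 1 by rewrite -[leRHS]expR0 ler_expR oppr_le0.
rewrite mulrDl mul1r -mulrA; apply: lerD => //.
rewrite (_ : _ * expR _ = 4 * s ^+ 2 * (u * expR (- u))); last by ring.
by rewrite ler_piMr// mulr_ge0// ltW.
Qed.

Lemma normal_dominated_integrable (h : R -> R) c : measurable_fun setT h ->
  (forall x, `|h x| <= c * ((1 + (x - m) ^+ 2) * p x)) ->
  leb.-integrable setT (EFin \o h).
Proof.
move=> mh hc.
have r0 : Num.sqrt 2 * s != 0 :> R by rewrite mulf_neq0// gt_eqF// sqrtr_gt0.
have iq : leb.-integrable setT (EFin \o (fun x => (`|c| * K / normal_peak (Num.sqrt 2 * s)) * normal_pdf m (Num.sqrt 2 * s) x)).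
  rewrite /comp; under eq_fun do rewrite EFinM.
  by apply: integrableZl => //; exact: integrable_normal_pdf.
apply: le_integrable iq => //; first exact/measurable_EFinP.
move=> x _; rewrite lee_fin; apply: le_trans (hc x) _.
have -> : normal_pdf m (Num.sqrt 2 * s) x = normal_peak (Num.sqrt 2 * s) * q x by rewrite normal_pdfE.
rewrite (_ : _ / _ * _ = `|c| * (K * q x)); last by field; rewrite gt_eqF ?normal_peak_gt0.
rewrite ger0_norm; last by rewrite !mulr_ge0 ?normal_peak_ge0// addr_ge0// mulr_ge0// ltW.
apply: (@le_trans _ _ (`|c| * ((1 + (x - m) ^+ 2) * p x))).
  by rewrite ler_wpM2r ?ler_norm// mulr_ge0// addr_ge0 ?sqr_ge0.
by rewrite ler_wpM2l// normal_pdf_sqr_le.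
Qed.

(** The growth condition on [u] is met by both endpoints [m + n.+1] and [m - n.+1] of the intervals
    that exhaust the line. *)
Lemma normal_dominated_cvg0 (h : R -> R) c (u : nat -> R) :
  (forall n, n%:R <= `|u n - m| ^+ 2) ->
  (forall x, `|h x| <= c * ((1 + (x - m) ^+ 2) * p x)) ->
  h (u n) @[n --> \oo] --> (0 : R).
Proof.
move=> un hc; apply/norm_cvg0P.
pose a := `|c| * K * (1 + 4 * s ^+ 2).
apply: (@squeeze_cvgr _ _ _ _ (fun=> 0) (fun n => a * n.+1%:R^-1)); last 2 first.
- exact: cvg_cst.
- rewrite -[X in _ --> X](mulr0 a); apply: cvgMr; exact: cvg_harmonic.
near=> n; rewrite normr_ge0/=; apply: le_trans (hc _) _.
apply: (@le_trans _ _ (`|c| * (K * q (u n)))).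
  apply: le_trans (ler_wpM2l (normr_ge0 c) (normal_pdf_sqr_le _)).
  by rewrite ler_wpM2r ?ler_norm// mulr_ge0// addr_ge0 ?sqr_ge0.
have K0 : 0 <= K by rewrite mulr_ge0 ?normal_peak_ge0// addr_ge0// mulr_ge0// ltW.
suff : q (u n) <= (1 + 4 * s ^+ 2) / n.+1%:R.
  by move=> qn; rewrite (_ : a * _ = `|c| * (K * ((1 + 4 * s ^+ 2) / n.+1%:R))) ?ler_wpM2l//; rewrite /a; ring.
pose w := (u n - m) ^+ 2 / (4 * s ^+ 2).
have -> : q (u n) = expR (- w).
  rewrite /q /normal_fun; congr expR.
  by rewrite exprMn sqr_sqrtr// /w; field.
have d0 : 0 < 4 * s ^+ 2 by apply: mulr_gt0.
have nw : n%:R / (4 * s ^+ 2) <= w.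
  rewrite /w ler_pM2r ?invr_gt0//.
  by have := un n; rewrite real_normK ?num_real.
have w0 : 0 <= w by rewrite (le_trans _ nw)// divr_ge0// mulr_ge0// ltW.
rewrite expRN; apply: (@le_trans _ _ ((1 + w)^-1)).
  by rewrite lef_pV2 ?posrE ?expR_gt0 ?expR_ge1Dx//; lra.
rewrite ler_pdivlMr ?ltr0n// mulrC ler_pdivrMr; last lra.
have : n%:R <= w * (4 * s ^+ 2) by rewrite -ler_pdivrMr.
rewrite -natr1; nra.
Unshelve. all: by end_near.
Qed.

Lemma is_derive_normal_pdf x : is_derive x (1:R) p (- ((x - m) / s ^+ 2) * p x).
Proof.
rewrite normal_pdfE//.
have d0 : is_derive x (1:R) (fun x => - (x - m) ^+ 2 / (s ^+ 2 *+ 2)) (- ((x - m) / s ^+ 2)).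
  have -> : (fun x => - (x - m) ^+ 2 / (s ^+ 2 *+ 2)) =
      - (s ^+ 2 *+ 2)^-1 \*: ((@id R - cst m) * (@id R - cst m)).
    by apply/funext => z; rewrite !fctE/= /GRing.scale/=; ring.
  have d1 : is_derive x (1:R) (@id R - cst m) (1 - 0).
    by apply: is_deriveB.
  apply: (is_derive_eq (is_deriveZ _ (is_deriveM d1 d1))).
  by rewrite /GRing.scale/= !fctE/=; field.
have d2 := is_derive1_comp (is_derive_expR _) d0.
apply: (is_derive_eq (is_deriveZ (normal_peak s) d2)).
by rewrite /GRing.scale/= /normal_fun; ring.
Qed.

(** The fundamental theorem of calculus on growing intervals, with boundary terms that vanish by
    domination. Every integration by parts below is an instance in which [F] is a function times the
    density. *)
Lemma integral_normal_derive (F h : R -> R) (c : R) :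
  (forall x : R, is_derive x (1:R) F (h x)) -> continuous h ->
  (forall x, `|F x| <= c * ((1 + (x - m) ^+ 2) * p x)) ->
  (forall x, `|h x| <= c * ((1 + (x - m) ^+ 2) * p x)) ->
  \int[leb]_x h x = 0.
Proof.
move=> dF ch cF hc.
have mh : measurable_fun setT h := continuous_measurable_fun ch.
have ih := normal_dominated_integrable mh hc.
pose f_ (n : nat) x : \bar R := ((h x)%:E * (\1_(`[m - n.+1%:R, m + n.+1%:R]) x)%:E)%E.
have [] := @dominated_convergence _ _ _ leb setT measurableT f_ (EFin \o h) (fun x => `|(h x)%:E|%E).
- move=> n; apply: emeasurable_funM; apply/measurable_EFinP => //.
- exact/measurable_EFinP.
- apply/aeW => x _; rewrite /f_; apply: cvg_near_cst.
  near=> n; have xn : `|x - m| <= n%:R by near: n; exact: nbhs_infty_ger.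
  rewrite indicE mem_set ?mule1//= in_itv/=.
  by move: xn; rewrite -natr1 ler_norml => /andP[? ?]; apply/andP; split; lra.
- exact: integrable_abse ih.
- apply/aeW => x n _; rewrite /f_ -EFinM /= lee_fin normrM indicE.
  by case: (_ \in _); rewrite ?normr1 ?normr0 ?mulr1 ?mulr0.
move=> _ _ H.
have nn n : n%:R <= n.+1%:R ^+ 2 :> R.
  by rewrite -natrX ler_nat expnS expn1 (leq_trans (leqnSn n))// leq_pmulr.
have Fn n : (\int[leb]_x f_ n x)%E = (F (m + n.+1%:R) - F (m - n.+1%:R))%:E.
  have mn : m - n.+1%:R < m + n.+1%:R by have : 0 < n.+1%:R :> R by []; lra.
  rewrite EFinB -(@continuous_FTC2 _ h F) //; first last.
  - by move=> x _; rewrite derive1E; exact: derive_val.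
  - have ctF x : {for x, continuous F}.
      by apply: differentiable_continuous; apply/derivable1_diffP; exact: ex_derive.
    split => [x _| |]; first exact: ex_derive.
    + exact: cvg_at_right_filter (ctF _).
    + exact: cvg_at_left_filter (ctF _).
  - exact: continuous_subspaceT.
  rewrite [RHS]integral_mkcond; apply: eq_integral => x _.
  by rewrite patchE /f_ indicE; case: ifPn; rewrite ?mule1 ?mule0.
have H2 : (fun n => (\int[leb]_x f_ n x)%E) @ \oo --> (0:R)%:E.
  under eq_fun do rewrite Fn.
  apply: cvg_EFin; first exact: nearW.
  rewrite /comp/= -[X in _ --> X](subrr (0:R)); apply: cvgB.
    apply: (@normal_dominated_cvg0 F c (fun n => m + n.+1%:R)) => // n.
    by rewrite addrC addKr ger0_norm.
  apply: (@normal_dominated_cvg0 F c (fun n => m - n.+1%:R)) => // n.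
  by rewrite addrC addKr normrN ger0_norm.
by have := cvg_unique _ H H2; rewrite /Rintegral => ->.
Unshelve. all: by end_near.
Qed.

Let cp : continuous p := continuous_normal_pdf s0.

Let continuous_shift : continuous (fun x : R => x - m).
Proof. by move=> x; apply: cvgB; [exact: cvg_id|exact: cvg_cst]. Qed.

Let bd0 x : 1 <= 1 + (x - m) ^+ 2.
Proof. by rewrite lerDl sqr_ge0. Qed.

Let bd1 x : `|x - m| <= 1 + (x - m) ^+ 2.
Proof.
rewrite -[(x - m) ^+ 2]real_normK ?num_real//; set y := `|_|.
by have := sqr_ge0 (y - 1); nra.
Qed.

Lemma normal_mean : \int[leb]_x ((x - m) * p x) = 0.
Proof.
have i1 : leb.-integrable setT (EFin \o (fun x => (x - m) * p x)).
  apply: (@normal_dominated_integrable _ 1).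
    by apply: continuous_measurable_fun => x; apply: cvgM; [exact: continuous_shift|exact: cp].
  by move=> x; rewrite mul1r normrM (ger0_norm (p0 x)) ler_wpM2r.
have := @integral_normal_derive p (fun x => - ((x - m) / s ^+ 2) * p x)
  (1 + (s ^+ 2)^-1) is_derive_normal_pdf.
have -> : \int[leb]_x (- ((x - m) / s ^+ 2) * p x) =
    - (s ^+ 2)^-1 * \int[leb]_x ((x - m) * p x).
  by rewrite -RintegralZl//; apply: eq_Rintegral => x _; ring.
move=> H; suff /eqP : - (s ^+ 2)^-1 * \int[leb]_x ((x - m) * p x) = 0.
  by rewrite mulf_eq0 oppr_eq0 invr_eq0 gt_eqF//= => /eqP.
apply: H.
- move=> x; apply: cvgM; last exact: cp.
  by apply: cvgN; apply: cvgM; [exact: continuous_shift|exact: cvg_cst].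
- have : 0 < (s ^+ 2)^-1 by rewrite invr_gt0.
  set k := _^-1 => k0 x; rewrite (ger0_norm (p0 x)) -[leLHS]mul1r mulrA ler_wpM2r//.
  by have := bd0 x; set y := _ ^+ 2; nra.
- have : 0 < (s ^+ 2)^-1 by rewrite invr_gt0.
  set k := _^-1 => k0 x; rewrite normrM (ger0_norm (p0 x)) mulrA ler_wpM2r//.
  rewrite normrN normrM [`|k|]gtr0_norm//.
  by have := bd1 x; set y := _ ^+ 2; have : 0 <= `|x - m| by []; nra.
Qed.

(** The derivative of [(x - m) * p x] is [p x - (x - m) ^ 2 / s ^ 2 * p x], whose integral over the
    line is 0. *)
Lemma normal_variance : \int[leb]_x ((x - m) ^+ 2 * p x) = s ^+ 2.
Proof.
have i2 : leb.-integrable setT (EFin \o (fun x => (x - m) ^+ 2 * p x)).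
  apply: (@normal_dominated_integrable _ 1).
    apply: continuous_measurable_fun => x; apply: cvgM; last exact: cp.
    by apply: cvgM; exact: continuous_shift.
  by move=> x; rewrite mul1r normrM (ger0_norm (p0 x)) ler_wpM2r// normrX real_normK ?num_real// lerDr.
have ip : leb.-integrable setT (EFin \o p) := integrable_normal_pdf m s.
have d1 (x : R) : is_derive x (1:R) (fun x => (x - m) * p x)
    (p x - (x - m) ^+ 2 / s ^+ 2 * p x).
  have d1 : is_derive x (1:R) (@id R - cst m) (1 - 0) by apply: is_deriveB.
  apply: (is_derive_eq (is_deriveM d1 (is_derive_normal_pdf x))).
  by rewrite /GRing.scale/= !fctE/=; ring.
have := @integral_normal_derive _ _ (1 + (s ^+ 2)^-1) d1.
have -> : \int[leb]_x (p x - (x - m) ^+ 2 / s ^+ 2 * p x) =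
    1 - (s ^+ 2)^-1 * \int[leb]_x ((x - m) ^+ 2 * p x).
  rewrite -RintegralZl// -[1](_ : \int[leb]_x p x = 1); last first.
    by rewrite /Rintegral integral_normal_pdf.
  rewrite -RintegralB//.
    by apply: eq_Rintegral => x _; ring.
  by rewrite /comp; under eq_fun do rewrite EFinM; exact: integrableZl.
have k0 : 0 < (s ^+ 2)^-1 by rewrite invr_gt0.
move=> H; suff : 1 - (s ^+ 2)^-1 * \int[leb]_x ((x - m) ^+ 2 * p x) = 0.
  by move/eqP; rewrite subr_eq0 => /eqP/(congr1 ( *%R (s ^+ 2))); rewrite mulr1 mulVKf ?gt_eqF.
apply: H.
- move=> x; apply: cvgB; first exact: cp.
  apply: cvgM; last exact: cp.
  by apply: cvgM; [apply: cvgM; exact: continuous_shift|exact: cvg_cst].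
- move=> x; rewrite normrM (ger0_norm (p0 x)) mulrA ler_wpM2r//.
  move: k0; set k := _^-1 => k0.
  by have := bd1 x; set y := _ ^+ 2; have : 0 <= `|x - m| by []; nra.
- move=> x; rewrite -[X in X - _]mul1r -mulrBl normrM (ger0_norm (p0 x)) mulrA ler_wpM2r//.
  move: k0; set k := _^-1 => k0; apply: (le_trans (ler_normB _ _)).
  rewrite normr1 ger0_norm; last by rewrite mulr_ge0 ?sqr_ge0// ltW.
  by have := sqr_ge0 (x - m); set y := _ ^+ 2; nra.
Qed.

Let is_derive_cosM (k y c t : R) :
  is_derive t (1:R) (fun t => cos (t * y + c) * k) (- (y * sin (t * y + c) * k)).
Proof.
have d0 : is_derive t (1:R) (fun t => t * y + c) y.
  have -> : (fun t => t * y + c) = (y \*: @id R) + cst c.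
    by apply/funext => z; rewrite !fctE/= /GRing.scale/= mulrC.
  by apply: (is_derive_eq (is_deriveD _ _)); rewrite addr0 /GRing.scale/= mulr1.
have d1 := is_derive1_comp (is_derive_cos _) d0.
have -> : (fun t => cos (t * y + c) * k) = k \*: (cos \o (fun t => t * y + c)).
  by apply/funext => z; rewrite /GRing.scale/= mulrC.
by apply: (is_derive_eq (is_deriveZ k d1)); rewrite /GRing.scale/=; ring.
Qed.

Let cont_lin (t c : R) : continuous (fun x : R => t * (x - m) + c).
Proof.
move=> x; apply: cvgD; last exact: cvg_cst.
by apply: cvgM; [exact: cvg_cst|exact: continuous_shift].
Qed.

Let cont_cos (t c : R) : continuous (fun x => cos (t * (x - m) + c) * p x).
Proof.
move=> x; apply: cvgM; last exact: cp.
exact: (continuous_comp (@cont_lin t c x) (@continuous_cos R _)).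
Qed.

Let cont_sin (t c : R) : continuous (fun x => sin (t * (x - m) + c) * p x).
Proof.
move=> x; apply: cvgM; last exact: cp.
exact: (continuous_comp (@cont_lin t c x) (@continuous_sin R _)).
Qed.

Let cont_ysin (t c : R) : continuous (fun x => (x - m) * sin (t * (x - m) + c) * p x).
Proof.
move=> x; rewrite (_ : (fun x => _) = (fun x => (x - m) * (sin (t * (x - m) + c) * p x))).
  by apply: cvgM; [exact: continuous_shift|exact: cont_sin].
by apply/funext => z; rewrite mulrA.
Qed.

Let char (c t : R) := \int[leb]_x (cos (t * (x - m) + c) * p x).

Let ncos (z : R) : `|cos z| <= 1. Proof. by rewrite ler_norml cos_geN1 cos_le1. Qed.
Let nsin (z : R) : `|sin z| <= 1. Proof. by rewrite ler_norml sin_geN1 sin_le1. Qed.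

Let int_cos c t : leb.-integrable setT (EFin \o (fun x => cos (t * (x - m) + c) * p x)).
Proof.
apply: (@normal_dominated_integrable _ 1).
  exact: continuous_measurable_fun (@cont_cos t c).
move=> x; rewrite mul1r normrM (ger0_norm (p0 x)) ler_wpM2r//.
exact: le_trans (ncos _) (bd0 _).
Qed.

Let bd_ysin (t c x : R) : `|(x - m) * sin (t * (x - m) + c) * p x| <= (1 + (x - m) ^+ 2) * p x.
Proof.
rewrite normrM (ger0_norm (p0 x)) ler_wpM2r// normrM.
by apply: le_trans (bd1 x); rewrite ler_piMr.
Qed.

Let int_ysin c t : leb.-integrable setT (EFin \o (fun x => (x - m) * sin (t * (x - m) + c) * p x)).
Proof.
apply: (@normal_dominated_integrable _ 1) => [|x]; last by rewrite mul1r.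
exact: continuous_measurable_fun (@cont_ysin t c).
Qed.

(** Differentiation under the integral sign; the dominating function [(1 + (x - m) ^ 2) * p x] does
    not depend on [t]. *)
Let derive_char c t : is_derive t (1:R) (char c)
  (- \int[leb]_x ((x - m) * sin (t * (x - m) + c) * p x)).
Proof.
pose f t x := cos (t * (x - m) + c) * p x.
have df t0 x : partial1of2 f t0 x = - ((x - m) * sin (t0 * (x - m) + c) * p x).
  rewrite partial1of2E /f; have d := is_derive_cosM (p x) (x - m) c t0.
  exact: derive_val.
have It : t \in `]t - 1, t + 1[ by rewrite in_itv/= ltrBlDr ltrDl ltr01.
have iG : leb.-integrable setT (EFin \o (fun x => (1 + (x - m) ^+ 2) * p x)).
  apply: (@normal_dominated_integrable _ 1).
    apply: continuous_measurable_fun => x; apply: cvgM; last exact: cp.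
    apply: cvgD; first exact: cvg_cst.
    by apply: cvgM; exact: continuous_shift.
  by move=> x; rewrite mul1r ger0_norm// mulr_ge0// (le_trans _ (bd0 x)).
have h1 t0 : `]t - 1, t + 1[%classic t0 -> leb.-integrable setT (EFin \o f t0) by move=> _; exact: int_cos.
have h2 t0 x : `]t - 1, t + 1[%classic t0 -> setT x -> derivable (f^~ x) t0 1.
  by move=> _ _; have d := is_derive_cosM (p x) (x - m) c t0; exact: ex_derive.
have h3 x : 0 <= (1 + (x - m) ^+ 2) * p x.
  by rewrite mulr_ge0// (le_trans _ (bd0 x)).
have h4 t0 x : `]t - 1, t + 1[%classic t0 -> setT x -> `|partial1of2 f t0 x| <= (1 + (x - m) ^+ 2) * p x.
  by move=> _ _; rewrite df normrN; exact: bd_ysin.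
apply: DeriveDef.
  exact: (derivable_under_integral measurableT It h1 h2 h3 iG h4).
rewrite -derive1E (differentiation_under_integral measurableT It h1 h2 h3 iG h4).
under eq_Rintegral do rewrite df -mulN1r.
by rewrite RintegralZl// mulN1r.
Qed.

(** By [parts], the derivative of [char c] at [t] is [- s ^ 2 * t * char c t]. Hence
    [char c t * expR (s ^ 2 * t ^ 2 / 2)] is constant, equal to its value [cos c] at 0; the claim is
    the case [t = 1]. *)
Lemma normal_cos c : \int[leb]_x (cos (x - m + c) * p x) = expR (- (s ^+ 2 / 2)) * cos c.
Proof.
have parts t : \int[leb]_x ((x - m) * sin (t * (x - m) + c) * p x) = s ^+ 2 * t * char c t.
  have d1 (x : R) : is_derive x (1:R) (fun x => sin (t * (x - m) + c) * p x)
     (t * (cos (t * (x - m) + c) * p x) - (s ^+ 2)^-1 * ((x - m) * sin (t * (x - m) + c) * p x)).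
    have d0 : is_derive x (1:R) (fun x => t * (x - m) + c) t.
      have -> : (fun x => t * (x - m) + c) = (t \*: (@id R - cst m)) + cst c.
        by apply/funext => z; rewrite !fctE/=.
      have d1 : is_derive x (1:R) (@id R - cst m) (1 - 0) by apply: is_deriveB.
      apply: (is_derive_eq (is_deriveD (is_deriveZ t d1) (is_derive_cst c x 1))).
      by rewrite addr0 subr0 /GRing.scale/= mulr1.
    have d2 := is_derive1_comp (is_derive_sin _) d0.
    apply: (is_derive_eq (is_deriveM d2 (is_derive_normal_pdf x))).
    by rewrite /GRing.scale/=; ring.
  have k0 : 0 < (s ^+ 2)^-1 by rewrite invr_gt0.
  have := @integral_normal_derive _ _ (1 + `|t| + (s ^+ 2)^-1) d1.
  have -> : \int[leb]_x (t * (cos (t * (x - m) + c) * p x) -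
      (s ^+ 2)^-1 * ((x - m) * sin (t * (x - m) + c) * p x)) =
      t * char c t - (s ^+ 2)^-1 * \int[leb]_x ((x - m) * sin (t * (x - m) + c) * p x).
    rewrite RintegralB// ?RintegralZl//.
    - by rewrite /comp; under eq_fun do rewrite EFinM; apply: integrableZl => //; exact: int_cos.
    - by rewrite /comp; under eq_fun do rewrite EFinM; apply: integrableZl => //; exact: int_ysin.
  set J := \int[leb]_x _; move=> H; suff : t * char c t - (s ^+ 2)^-1 * J = 0.
    by move/eqP; rewrite subr_eq0 => /eqP/(congr1 ( *%R (s ^+ 2))); rewrite mulVKf ?gt_eqF// mulrA.
  apply: H.
  - move=> x; apply: cvgB; (apply: cvgM; first exact: cvg_cst).
      exact: cont_cos.
    exact: cont_ysin.
  - move=> x; rewrite normrM (ger0_norm (p0 x)) mulrA ler_wpM2r//.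
    apply: (le_trans (nsin _)); move: k0; set k := _^-1 => k0.
    by have := bd0 x; set y := _ ^+ 2; have : 0 <= `|t| by []; nra.
  - move=> x; rewrite (le_trans (ler_normB _ _))// normrM [X in _ + X]normrM.
    rewrite (gtr0_norm k0); have := bd_ysin t c x; set A := `|_ * p x|; set B := `|_ * p x|.
    have : B <= p x by rewrite /B normrM (ger0_norm (p0 x)) ler_piMl.
    have := bd0 x; have := p0 x; set y := 1 + _; set P := p x; move: k0; set k := _^-1.
    have : 0 <= `|t| by []; set T := `|t|.
    move=> T0 k0 P0 y1 BP Ay.
    have h1 : T * B <= T * (y * P) by rewrite ler_wpM2l// (le_trans BP)// ler_peMl.
    have h2 : k * A <= k * (y * P) by rewrite ler_wpM2l// ltW.
    have h3 : 0 <= y * P by rewrite mulr_ge0// (le_trans _ y1).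
    have gen (a b w a' b' : R) : a' <= a * w -> b' <= b * w -> 0 <= w ->
      a' + b' <= (1 + a + b) * w by lra.
    exact: gen.
pose f t := char c t * expR (s ^+ 2 / 2 * t ^+ 2) - cos c.
have df (t : R) : is_derive t (1:R) f 0.
  have d0 : is_derive t (1:R) (fun t => s ^+ 2 / 2 * t ^+ 2) (s ^+ 2 * t).
    have -> : (fun t => s ^+ 2 / 2 * t ^+ 2) = (s ^+ 2 / 2) \*: (@id R * @id R).
      by apply/funext => z; rewrite !fctE/= /GRing.scale/= expr2.
    apply: (is_derive_eq (is_deriveZ _ (is_deriveM (is_derive_id _ _) (is_derive_id _ _)))).
    by rewrite /GRing.scale/=; field.
  have d2 := is_derive1_comp (is_derive_expR _) d0.
  apply: (is_derive_eq (is_deriveB (is_deriveM (derive_char c t) d2) (is_derive_cst (cos c) t 1))).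
  by rewrite parts /GRing.scale/=; ring.
have f0 : f 0 = 0.
  rewrite /f expr0n/= mulr0 expR0 mulr1 /char.
  under eq_Rintegral do rewrite mul0r add0r.
  rewrite RintegralZl//; last exact: integrable_normal_pdf.
  by rewrite [X in _ * X](_ : _ = 1) ?mulr1 ?subrr// /Rintegral integral_normal_pdf.
have [z _] := MVT_origin df f0 1.
rewrite mul0r => /eqP; rewrite subr_eq0 expr1n mulr1 => /eqP <-.
rewrite mulrCA -expRD addNr expR0 mulr1 /char.
by apply: eq_Rintegral => x _; rewrite mul1r.
Qed.

End normal_integrals.

Section integral_density.
Context d (T : measurableType d) (R : realType).
Variables (mu nu : {measure set T -> \bar R}) (g : T -> R).
Hypothesis mg : measurable_fun setT g.
Hypothesis g0 : forall x, 0 <= g x.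
Hypothesis nuE : forall A, measurable A -> nu A = (\int[mu]_(x in A) (g x)%:E)%E.

Lemma integrable_density (h : T -> R) : measurable_fun setT h ->
  mu.-integrable setT (EFin \o (fun x => h x * g x)) ->
  nu.-integrable setT (EFin \o h).
Proof.
move=> mh /integrableP[_ hi]; apply/integrableP; split; first exact/measurable_EFinP.
rewrite (ge0_integral_density mg g0 nuE)//; last first.
  by apply: measurableT_comp => //; exact/measurable_EFinP.
apply: le_lt_trans hi; rewrite le_eqVlt; apply/orP; left; apply/eqP.
by apply: eq_integral => x _; rewrite /= normrM (ger0_norm (g0 x)).
Qed.

Lemma Rintegral_density (h : T -> R) : measurable_fun setT h ->
  \int[nu]_x h x = \int[mu]_x (h x * g x).
Proof.
move=> mh; congr fine; rewrite integralE [RHS]integralE.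
have mEh : measurable_fun setT (EFin \o h) by exact/measurable_EFinP.
rewrite !(ge0_integral_density mg g0 nuE)//; try exact: measurable_funepos; try exact: measurable_funeneg.
by congr (_ - _)%E; apply: eq_integral => x _;
  rewrite ?funeposE ?funenegE -?EFinN -?EFin_max/= -EFinM maxr_pMl// ?mulNr mul0r.
Qed.

End integral_density.

(** * Moments of a real Gaussian variable, possibly Dirac *)

Section gaussian_variable.
Context d (T : measurableType d) (R : realType) (P : probability T R).

(** Comparison with [1 + Y ^ 2]. *)
Lemma sqr_integrable_abs (Y : T -> R) : measurable_fun setT Y ->
  P.-integrable setT (EFin \o (fun w => Y w ^+ 2)) -> P.-integrable setT (EFin \o Y).
Proof.
move=> mY iY2; have i1 : P.-integrable setT (EFin \o (fun w => 1 + Y w ^+ 2)).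
  rewrite /comp; under eq_fun do rewrite EFinD.
  by apply: integrableD => //; exact: bmf_integrable (bmf_cst _ _).
apply: le_integrable i1 => //; first exact/measurable_EFinP.
move=> w _; rewrite lee_fin [leRHS]ger0_norm ?addr_ge0 ?sqr_ge0//.
rewrite -[Y w ^+ 2]real_normK ?num_real//.
by have := sqr_ge0 (`|Y w| - 1); have : 0 <= `|Y w| by []; nra.
Qed.

Variables (Y : {RV P >-> R}) (m s : R).
Hypothesis YE : forall A : set R, measurable A -> P (Y @^-1` A) = gaussian_law m s A.

Let DYE A : measurable A -> distribution P Y A = gaussian_law m s A.
Proof. exact: YE. Qed.

(* [lebesgue_measure] lives on [measurableTypeR R], whose display differs from
   the one of the canonical measurable structure of [R]. *)
Let toR : measurableTypeR R -> R := idfun.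

Let mtoR : measurable_fun setT toR.
Proof. by move=> _ A mA; rewrite setTI. Qed.

HB.instance Definition _ := isMeasurableFun.Build _ _ _ _ toR mtoR.

Let leb : {measure set R -> \bar R} :=
  measure_function_pushforward__canonical__measure_function_Measure
    lebesgue_measure mtoR.

Let pdfE : s != 0 -> forall A : set R, measurable A ->
  distribution P Y A = (\int[leb]_(x in A) (normal_pdf m s x)%:E)%E.
Proof.
move=> s0 A mA; rewrite DYE// /gaussian_law (negbTE s0) ge0_integral_pushforward//.
- by apply/measurable_EFinP; apply: measurable_funTS; exact: measurable_normal_pdf.
- by move=> x _; rewrite lee_fin normal_pdf_ge0.
Qed.

Let law_integrable (h : R -> R) : measurable_fun setT h ->
  (distribution P Y).-integrable setT (EFin \o h) ->
  P.-integrable setT (EFin \o (fun w => h (Y w))).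
Proof.
move=> mh /integrableP[_ hi]; apply/integrableP; split.
  by apply/measurable_EFinP; exact: measurableT_comp.
move: hi; rewrite ge0_integral_distribution//.
by apply: measurableT_comp => //; exact/measurable_EFinP.
Qed.

Let gaussian_integral (h : R -> R) : s != 0 -> measurable_fun setT h ->
  lebesgue_measure.-integrable setT (EFin \o (fun x => h x * normal_pdf m s x)) ->
  P.-integrable setT (EFin \o (fun w => h (Y w))) /\
  \int[P]_w h (Y w) = \int[lebesgue_measure]_x (h x * normal_pdf m s x).
Proof.
move=> s0 mh hi.
have mp := measurable_normal_pdf m s; have p0 := normal_pdf_ge0 m s.
have mhp : measurable_fun setT (EFin \o (fun x => h x * normal_pdf m s x)).
  by apply/measurable_EFinP; exact: measurable_funM.
have hi' : leb.-integrable setT (EFin \o (fun x => h x * normal_pdf m s x)).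
  exact: (integrable_pushforward mtoR mhp).
have i2 := law_integrable mh (integrable_density mp p0 (pdfE s0) mh hi').
split => //; transitivity (\int[distribution P Y]_x h x).
  by rewrite /Rintegral integral_distribution//; exact/measurable_EFinP.
rewrite (Rintegral_density mp p0 (pdfE s0))// /Rintegral.
by congr fine; rewrite (integral_pushforward mtoR mhp).
Qed.

(** Dirac laws do occur: linear combinations with coefficients in the kernel of the covariance
    matrix are almost surely constant. *)
Let dirac_integral (h : R -> R) : s = 0 -> measurable_fun setT h ->
  P.-integrable setT (EFin \o (fun w => h (Y w))) /\ \int[P]_w h (Y w) = h m.
Proof.
move=> s0 mh; have mEh : measurable_fun setT (EFin \o h) by exact/measurable_EFinP.
have E (f : R -> \bar R) : measurable_fun setT f -> (\int[distribution P Y]_x f x = f m)%E.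
  move=> mf; rewrite (eq_measure_integral (\d_m)); last first.
    by move=> A mA _; rewrite [LHS]DYE// /gaussian_law s0 eqxx.
  by rewrite integral_dirac// diracT mul1e.
have i1 : P.-integrable setT (EFin \o (fun w => h (Y w))).
  apply: law_integrable => //; apply/integrableP; split => //.
  by rewrite E ?ltry//; exact: measurableT_comp.
by split => //; rewrite /Rintegral -(integral_distribution mEh i1) E.
Qed.

Let msub : measurable_fun setT (fun x : R => x - m).
Proof. exact: measurable_funB. Qed.

Let normal_int (h : R -> R) : s != 0 -> measurable_fun setT h ->
  (forall x, `|h x| <= 1 + (x - m) ^+ 2) ->
  lebesgue_measure.-integrable setT (EFin \o (fun x => h x * normal_pdf m s x)).
Proof.
move=> s0 mh hx; have p0 := normal_pdf_ge0 m s.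
apply: (@normal_dominated_integrable _ m s s0 _ 1).
  by apply: measurable_funM => //; exact: measurable_normal_pdf.
by move=> x; rewrite mul1r normrM (ger0_norm (p0 x)) ler_wpM2r.
Qed.

Let sq_facts : P.-integrable setT (EFin \o (fun w => (Y w - m) ^+ 2)) /\
  \int[P]_w ((Y w - m) ^+ 2) = s ^+ 2.
Proof.
have mh : measurable_fun setT (fun x : R => (x - m) ^+ 2) by exact: measurable_funX.
have [s0|s0] := eqVneq s 0.
  by have [? ->] := dirac_integral s0 mh; rewrite s0 subrr.
have [|? ->] := gaussian_integral s0 mh.
  by apply: normal_int => // x; rewrite ger0_norm ?sqr_ge0// lerDr.
by rewrite normal_variance.
Qed.

Lemma gaussian_integrable2 : P.-integrable setT (EFin \o (fun w => (Y w - m) ^+ 2)).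
Proof. by case: sq_facts. Qed.

Lemma gaussian_integrable : P.-integrable setT (EFin \o Y).
Proof.
have i1 : P.-integrable setT (EFin \o (fun w => Y w - m)).
  apply: sqr_integrable_abs; first exact: measurable_funB.
  exact: gaussian_integrable2.
have -> : EFin \o Y = (fun w => ((Y w - m)%:E + m%:E)%E).
  by apply/funext => w /=; rewrite -EFinD subrK.
by apply: integrableD => //; exact: bmf_integrable (bmf_cst _ _).
Qed.

Lemma gaussian_variance : \int[P]_w ((Y w - m) ^+ 2) = s ^+ 2.
Proof. by case: sq_facts. Qed.

Lemma gaussian_mean : \int[P]_w (Y w - m) = 0.
Proof.
have [s0|s0] := eqVneq s 0.
  by have [? ->] := dirac_integral s0 msub; rewrite subrr.
have [|? ->] := gaussian_integral s0 msub; last by rewrite normal_mean.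
apply: normal_int => // x; rewrite -[(x - m) ^+ 2]real_normK ?num_real//.
by have := sqr_ge0 (`|x - m| - 1); nra.
Qed.

Lemma gaussian_cos c : \int[P]_w cos (Y w - m + c) = expR (- (s ^+ 2 / 2)) * cos c.
Proof.
have mh : measurable_fun setT (fun x : R => cos (x - m + c)).
  by apply: (bmf_cos _).1; exact: measurable_funD.
have [s0|s0] := eqVneq s 0.
  by have [? ->] := dirac_integral s0 mh; rewrite subrr s0 expr0n/= mul0r oppr0 expR0 mul1r add0r.
have [|? ->] := gaussian_integral s0 mh; last by rewrite normal_cos.
apply: normal_int => // x; apply: (@le_trans _ _ 1).
  by rewrite ler_norml cos_geN1 cos_le1.
by rewrite lerDl sqr_ge0.
Qed.

Lemma gaussian_null (x : R) : s != 0 -> P (Y @^-1` [set x]) = 0%E.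
Proof.
move=> s0; rewrite YE// /gaussian_law (negbTE s0).
rewrite /normal_prob null_set_integral//.
by apply: measurable_funTS; apply/measurable_EFinP; exact: measurable_normal_pdf.
exact: lebesgue_measure_set1.
Qed.

End gaussian_variable.

(** * Gaussian vectors *)

Section gaussian_vectors.
Context d (T : measurableType d) (R : realType) (P : probability T R) (l : nat).
Variables (X : 'I_l -> {RV P >-> R}) (S : 'M[R]_l).
Hypothesis hgauss : gaussian_vector X.
Hypothesis hcent : centered X.
Hypothesis hcov : covariance_mx X = S.

Let lin (a : 'I_l -> R) w := \sum_j a j * X j w.

Let lin_law a : exists (Y : {RV P >-> R}) (m s : R), (Y = lin a :> (T -> R)) /\
  forall A : set R, measurable A -> P (Y @^-1` A) = gaussian_law m s A.
Proof.
have [m [s H]] := hgauss a.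
have ml : measurable_fun setT (lin a).
  by apply: measurable_sum => j; exact: measurable_funM.
by exists (mfun_Sub (mem_set ml)), m, s.
Qed.

Let coord_law k : exists m s : R,
  forall A : set R, measurable A -> P (X k @^-1` A) = gaussian_law m s A.
Proof.
have [m [s H]] := hgauss (fun j => (j == k)%:R); exists m, s => A mA.
rewrite -H//; congr (P (_ @^-1` A)); apply/funext => w.
by rewrite (bigD1 k)//= eqxx mul1r big1 ?addr0// => j /negbTE ->; rewrite mul0r.
Qed.

Lemma gaussian_coord_integrable k : P.-integrable setT (EFin \o X k).
Proof.
by have [m [s H]] := coord_law k; exact: gaussian_integrable H.
Qed.

Lemma gaussian_coord_mean k : \int[P]_w X k w = 0.
Proof. by have := hcent k; rewrite unlock /Rintegral => ->. Qed.

Let coord_centered k : exists s : R,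
  forall A : set R, measurable A -> P (X k @^-1` A) = gaussian_law 0 s A.
Proof.
have [m [s H]] := coord_law k; exists s.
have := gaussian_mean H; rewrite RintegralB//.
- rewrite gaussian_coord_mean Rint_cst sub0r => /eqP; rewrite oppr_eq0 => /eqP m0.
  by rewrite -m0.
- exact: gaussian_coord_integrable.
- exact: bmf_integrable (bmf_cst _ _).
Qed.

Lemma gaussian_coord_integrable2 k : P.-integrable setT (EFin \o (fun w => X k w ^+ 2)).
Proof.
have [s H] := coord_centered k; have := gaussian_integrable2 H.
by under eq_fun do rewrite subr0.
Qed.

Let prod_integrable i j : P.-integrable setT (EFin \o (fun w => X i w * X j w)).
Proof.
have i1 : P.-integrable setT (EFin \o (fun w => X i w ^+ 2 + X j w ^+ 2)).
  rewrite /comp; under eq_fun do rewrite EFinD.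
  by apply: integrableD => //; exact: gaussian_coord_integrable2.
apply: le_integrable i1 => //; first by apply/measurable_EFinP; exact: measurable_funM.
move=> w _; rewrite lee_fin [leRHS]ger0_norm ?addr_ge0 ?sqr_ge0// normrM.
rewrite -[X i w ^+ 2]real_normK ?num_real// -[X j w ^+ 2]real_normK ?num_real//.
by have := sqr_ge0 (`|X i w| - `|X j w|); have := sqr_ge0 `|X i w|; have := sqr_ge0 `|X j w|; nra.
Qed.

Lemma gaussian_coord_cov i j : \int[P]_w (X i w * X j w) = S i j.
Proof.
rewrite -hcov mxE covariance.unlock.
have E k : fine 'E_P[X k] = 0 by rewrite (hcent k).
rewrite !E expectation.unlock; congr fine; apply: eq_integral => w _.
by congr (_%:E); congr (_ * _); rewrite /= subr0.
Qed.

(** The definition of a Gaussian vector leaves the parameters of a linear combination unspecified.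
    Linearity forces the mean to be 0, and expanding the square identifies the variance with the
    quadratic form of [S]. *)
Lemma gaussian_vector_cos (a : 'I_l -> R) c :
  \int[P]_w cos (\sum_j a j * X j w + c) =
  expR (- ((\sum_i \sum_j a i * a j * S i j) / 2)) * cos c.
Proof.
have [Y [m [s [YE H]]]] := lin_law a.
have iaX i : P.-integrable setT (EFin \o (fun w => a i * X i w)).
  by rewrite /comp; under eq_fun do rewrite EFinM; apply: integrableZl => //; exact: gaussian_coord_integrable.
have iaXX i j : P.-integrable setT (EFin \o (fun w => a i * a j * (X i w * X j w))).
  by rewrite /comp; under eq_fun do rewrite EFinM; apply: integrableZl => //; exact: prod_integrable.
have m0 : m = 0.
  have := gaussian_mean H; rewrite YE => h.
  have : \int[P]_w (lin a w - m) = - m.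
    rewrite RintegralB//; last 2 first.
    - by rewrite -YE; exact: gaussian_integrable H.
    - exact: bmf_integrable (bmf_cst _ _).
    rewrite Rint_cst /lin Rint_sum// big1 ?sub0r// => i _.
    by rewrite RintegralZl ?gaussian_coord_mean ?mulr0//; exact: gaussian_coord_integrable.
  by rewrite h => /eqP; rewrite eq_sym oppr_eq0 => /eqP.
have s2 : s ^+ 2 = \sum_i \sum_j a i * a j * S i j.
  rewrite -(gaussian_variance H) m0 YE.
  transitivity (\int[P]_w (\sum_(p : 'I_l * 'I_l) a p.1 * a p.2 * (X p.1 w * X p.2 w))).
    apply: eq_Rintegral => w _; rewrite subr0 /lin expr2 big_distrl/=.
    rewrite -(pair_bigA _ (fun i j => a i * a j * (X i w * X j w)))/=.
    by apply: eq_bigr => i _; rewrite big_distrr/=; apply: eq_bigr => j _; ring.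
  rewrite Rint_sum// [RHS]pair_bigA/=; apply: eq_bigr => p _.
  by rewrite RintegralZl ?gaussian_coord_cov.
have := gaussian_cos H c; rewrite YE m0 s2.
by under eq_Rintegral do rewrite subr0.
Qed.

(** A nonzero variance excludes the Dirac case, so the coordinate has a density. *)
Lemma gaussian_coord_null k (x : R) : S k k != 0 -> P (X k @^-1` [set x]) = 0%E.
Proof.
move=> Sk; have [s H] := coord_centered k; apply: (gaussian_null H).
apply: contra_neq Sk => s0; rewrite -gaussian_coord_cov.
have v0 := gaussian_variance H; rewrite s0 expr0n/= in v0.
by rewrite -[RHS]v0; apply: eq_Rintegral => w _; rewrite subr0 expr2.
Qed.

End gaussian_vectors.

(** * Trigonometric test functions *)

Section trigonometric_polynomials.
Variables (R : realType) (l : nat).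
Implicit Types (x : 'I_l -> R) (f g : ('I_l -> R) -> R).

(** Only the generators and the linear operations are constructors, so that limits of integrals
    follow by induction; stability under products is then a lemma. *)
Inductive trigpoly : (('I_l -> R) -> R) -> Prop :=
| trigpoly_cos (t : 'I_l -> R) (c : R) : trigpoly (fun x => cos (\sum_j t j * x j + c))
| trigpolyD f g : trigpoly f -> trigpoly g -> trigpoly (fun x => f x + g x)
| trigpolyZ a f : trigpoly f -> trigpoly (fun x => a * f x).

Lemma trigpoly_cst a : trigpoly (fun=> a).
Proof.
have := trigpolyZ a (trigpoly_cos (fun=> 0) 0); congr trigpoly; apply/funext => x.
by rewrite big1 ?addr0 ?cos0 ?mulr1// => j _; rewrite mul0r.
Qed.

(** The product-to-sum formula on generators, extended by bilinearity. *)
Lemma trigpolyM f g : trigpoly f -> trigpoly g -> trigpoly (fun x => f x * g x).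
Proof.
move=> pf pg; elim: pf => {f} [t c|f f' _ ihf _ ihf'|a f _ ihf].
- elim: pg => {g} [u b|g g' _ ihg _ ihg'|a g _ ihg].
  + have := trigpolyZ (2^-1) (trigpolyD (trigpoly_cos (fun j => t j + u j) (c + b))
      (trigpoly_cos (fun j => t j - u j) (c - b))).
    congr trigpoly; apply/funext => x.
    have -> : \sum_j (t j + u j) * x j = \sum_j t j * x j + \sum_j u j * x j.
      by rewrite -big_split; apply: eq_bigr => j _; rewrite mulrDl.
    have -> : \sum_j (t j - u j) * x j = \sum_j t j * x j - \sum_j u j * x j.
      by rewrite -sumrB; apply: eq_bigr => j _; rewrite mulrBl.
    set A := \sum_j _; set B := \sum_j _.
    rewrite (_ : A + B + (c + b) = (A + c) + (B + b)); last ring.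
    rewrite (_ : A - B + (c - b) = (A + c) - (B + b)); last ring.
    by rewrite cosD cosB; field.
  + have := trigpolyD ihg ihg'; congr trigpoly; apply/funext => x; ring.
  + have := trigpolyZ a ihg; congr trigpoly; apply/funext => x; ring.
- have := trigpolyD ihf ihf'; congr trigpoly; apply/funext => x; ring.
- have := trigpolyZ a ihf; congr trigpoly; apply/funext => x; ring.
Qed.

Lemma trigpolyX f n : trigpoly f -> trigpoly (fun x => f x ^+ n).
Proof.
move=> pf; elim: n => [|n ih].
  by have := trigpoly_cst 1; congr trigpoly; apply/funext => x; rewrite expr0.
by have := trigpolyM pf ih; congr trigpoly; apply/funext => x; rewrite exprS.
Qed.

Lemma trigpolyBl a f : trigpoly f -> trigpoly (fun x => a - f x).
Proof.
move=> pf; have := trigpolyD (trigpoly_cst a) (trigpolyZ (-1) pf).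
by congr trigpoly; apply/funext => x; rewrite mulN1r.
Qed.

Lemma trigpoly_prod (F : 'I_l -> ('I_l -> R) -> R) :
  (forall j, trigpoly (F j)) -> trigpoly (fun x => \prod_j F j x).
Proof.
move=> pF; elim: (index_enum _) => [|j s ih].
  by have := trigpoly_cst 1; congr trigpoly; apply/funext => x; rewrite big_nil.
by have := trigpolyM (pF j) ih; congr trigpoly; apply/funext => x; rewrite big_cons.
Qed.

Lemma trigpoly_sin_coord j (a c : R) : trigpoly (fun x => sin (a * (x j - c))).
Proof.
have := trigpoly_cos (fun i => if i == j then a else 0) (- (a * c) - pi / 2).
congr trigpoly; apply/funext => x; rewrite (bigD1 j)//= eqxx big1 ?addr0; last first.
  by move=> i /negbTE ->; rewrite mul0r.
by rewrite addrA -mulrBr cosB cos_pihalf sin_pihalf mulr0 add0r mulr1.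
Qed.

Lemma trigpoly_bmf d (T : measurableType d) (V : 'I_l -> T -> R) f :
  (forall j, measurable_fun setT (V j)) -> trigpoly f -> bmf (fun w => f (V^~ w)).
Proof.
move=> mV; elim => {f} [t c|f g _ bf _ bg|a f _ bf]; last 2 first.
- exact: bmfD.
- by apply: bmfM => //; exact: bmf_cst.
apply: bmf_cos; apply: measurable_funD => //.
by apply: measurable_sum => j; exact: measurable_funM.
Qed.

(** Stands for convergence in law: the spaces change with [m], so only integrals of test functions
    are compared. *)
Lemma trigpoly_cvg (d : nat -> measure_display) (T : forall m, measurableType (d m))
    (P : forall m, probability (T m) R) (V : forall m, 'I_l -> T m -> R)
    dX (TX : measurableType dX) (PX : probability TX R) (X : 'I_l -> TX -> R) f :
  (forall m j, measurable_fun setT (V m j)) -> (forall j, measurable_fun setT (X j)) ->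
  (forall t c, (fun m => \int[P m]_w cos (\sum_j t j * V m j w + c)) @ \oo -->
     \int[PX]_w cos (\sum_j t j * X j w + c)) ->
  trigpoly f ->
  (fun m => \int[P m]_w f (V m ^~ w)) @ \oo --> \int[PX]_w f (X^~ w).
Proof.
move=> mV mX H; elim => {f} [t c|f g pf cf pg cg|a f pf cf]; first exact: H.
- rewrite RintD; try exact: trigpoly_bmf.
  rewrite (_ : (fun m => _) = (fun m => \int[P m]_w f (V m ^~ w) + \int[P m]_w g (V m ^~ w))).
    exact: cvgD.
  by apply/funext => m; rewrite RintD//; exact: trigpoly_bmf.
- rewrite RintZl; try exact: trigpoly_bmf.
  rewrite (_ : (fun m => _) = (fun m => a * \int[P m]_w f (V m ^~ w))).
    by apply: cvgM => //; exact: cvg_cst.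
  by apply/funext => m; rewrite RintZl//; exact: trigpoly_bmf.
Qed.

End trigonometric_polynomials.

(** * Polynomials close to a step function *)

Section bernoulli_bounds.
Variable R : realType.
Implicit Types u t : R.

Lemma bernoulli_ge u k : 0 <= u <= 1 -> 1 - k%:R * u <= (1 - u) ^+ k.
Proof.
move=> /andP[u0 u1]; elim: k => [|k ih]; first by rewrite mul0r subr0 expr0.
rewrite exprS -natr1; apply: (@le_trans _ _ ((1 - u) * (1 - k%:R * u))).
  by have : 0 <= k%:R * u ^+ 2; [rewrite mulr_ge0 ?sqr_ge0|nra].
by rewrite ler_wpM2l// subr_ge0.
Qed.

Lemma bernoulliD u k : 0 <= u -> 1 + k%:R * u <= (1 + u) ^+ k.
Proof.
move=> u0; elim: k => [|k ih]; first by rewrite mul0r addr0 expr0.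
rewrite exprS -natr1; apply: (@le_trans _ _ ((1 + u) * (1 + k%:R * u))).
  by have : 0 <= k%:R * u ^+ 2; [rewrite mulr_ge0 ?sqr_ge0|nra].
by rewrite ler_wpM2l// addr_ge0.
Qed.

(** Since [k * u <= (1 + u) ^ k] and [(1 - u) * (1 + u) <= 1]. *)
Lemma bernoulli_le u k : 0 <= u <= 1 -> (1 - u) ^+ k * (k%:R * u) <= 1.
Proof.
move=> /andP[u0 u1]; apply: (@le_trans _ _ ((1 - u) ^+ k * (1 + u) ^+ k)).
  apply: ler_wpM2l; first by rewrite exprn_ge0// subr_ge0.
  by apply: le_trans (bernoulliD k u0); rewrite lerDr.
by rewrite -exprMn exprn_ile1// ?mulr_ge0 ?subr_ge0 ?addr_ge0//; nra.
Qed.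

(* As [n] grows this polynomial tends to [1] for [t < 1/2] and to [0] for
   [t > 1/2]. *)
Definition step_poly n t := (1 - t ^+ n) ^+ (2 ^ n)%N.

Lemma step_poly_itv n t : 0 <= t <= 1 -> 0 <= step_poly n t <= 1.
Proof.
move=> /andP[t0 t1]; have h : 0 <= t ^+ n <= 1 by rewrite exprn_ge0// exprn_ile1.
by rewrite exprn_ge0 ?exprn_ile1//; lra.
Qed.

(** Bernoulli's inequality with [u = t ^ n] and [k = 2 ^ n]: the product [k * u = (2 * t) ^ n] is
    what makes 1/2 the threshold. *)
Lemma step_poly_ge n t : 0 <= t <= 1 -> 1 - (2 * t) ^+ n <= step_poly n t.
Proof.
move=> /andP[t0 t1]; have h : 0 <= t ^+ n <= 1 by rewrite exprn_ge0// exprn_ile1.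
by apply: le_trans (bernoulli_ge _ h); rewrite natrX exprMn.
Qed.

Lemma step_poly_le n t : 0 <= t <= 1 -> step_poly n t * (2 * t) ^+ n <= 1.
Proof.
move=> /andP[t0 t1]; have h : 0 <= t ^+ n <= 1 by rewrite exprn_ge0// exprn_ile1.
by apply: le_trans (bernoulli_le (2 ^ n)%N h); rewrite natrX exprMn.
Qed.

End bernoulli_bounds.

Section test_function.
Variables (R : realType) (l : nat) (c delta eps M : R).
Hypotheses (delta0 : 0 < delta) (eps0 : 0 < eps) (M0 : 0 < M) (deltaM : delta <= M).

(** Brings a coordinate into [[0, 1]], with the value 1/2 at [y = c]. For [|y - c| <= M / 2] the
    sine has the sign of [y - c], so [step_poly n (t y)] approximates the indicator of [y > c]. *)
Let t (y : R) := (1 - sin (M^-1 * (y - c))) / 2.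

Let t01 y : 0 <= t y <= 1.
Proof.
have := sin_geN1 (M^-1 * (y - c)); have := sin_le1 (M^-1 * (y - c)).
rewrite /t; set s := sin _ => ? ?; apply/andP; split; lra.
Qed.

Let sin_lower (z : R) : 0 <= z <= 2^-1 -> z / 2 <= sin z.
Proof.
move=> /andP[z0 z1]; have := norm_sinB_le z; rewrite (ger0_norm z0) ler_norml => /andP[+ _].
have : z ^+ 3 <= z / 2; last lra.
by rewrite exprS ler_wpM2l// expr2; nra.
Qed.

(** The gap between [2 * t y] and 1 when [y] is in the box and at distance at least [delta] from
    [c]: the argument of the sine is then at least [2 * eta] in absolute value, and
    [z / 2 <= sin z]. *)
Let eta := delta / (2 * M).

Let eta0 : 0 < eta. Proof. by rewrite divr_gt0// mulr_gt0. Qed.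

Let eta1 : eta <= 1.
Proof.
by rewrite ler_pdivrMr ?mulr_gt0// mul1r; move: M0 deltaM; set a := M; set b := delta; lra.
Qed.

Let t_above y : c + delta <= y -> y - c <= M / 2 -> 2 * t y <= 1 - eta.
Proof.
move=> y1 y2; have z1 : 0 <= M^-1 * (y - c) <= 2^-1.
  apply/andP; split; last by rewrite mulrC ler_pdivrMr// mulrC.
  apply: mulr_ge0; first by rewrite invr_ge0 ltW.
  by move: delta0 y1; set dd := delta; lra.
have := sin_lower z1; rewrite /t.
have : 2 * eta <= M^-1 * (y - c).
  rewrite (_ : 2 * eta = M^-1 * delta); last by rewrite /eta; field; rewrite gt_eqF.
  by rewrite ler_wpM2l ?invr_ge0 ?(ltW M0)//; lra.
have gen (e z a : R) : 2 * e <= z -> z / 2 <= a -> 2 * ((1 - a) / 2) <= 1 - e by lra.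
exact: gen.
Qed.

Let t_below y : y <= c - delta -> c - y <= M / 2 -> 1 + eta <= 2 * t y.
Proof.
move=> y1 y2; have z1 : 0 <= M^-1 * (c - y) <= 2^-1.
  apply/andP; split; last by rewrite mulrC ler_pdivrMr// mulrC.
  apply: mulr_ge0; first by rewrite invr_ge0 ltW.
  by move: delta0 y1; set dd := delta; lra.
have := sin_lower z1; rewrite /t (_ : y - c = - (c - y)); last by rewrite opprB.
rewrite mulrN sinN opprK.
have : 2 * eta <= M^-1 * (c - y).
  rewrite (_ : 2 * eta = M^-1 * delta); last by rewrite /eta; field; rewrite gt_eqF.
  by rewrite ler_wpM2l ?invr_ge0 ?(ltW M0)//; lra.
have gen (e z a : R) : 2 * e <= z -> z / 2 <= a -> 1 + e <= 2 * ((1 + a) / 2) by lra.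
exact: gen.
Qed.

(** Outside the box a single quadratic term reaches 1, which makes both estimates on the test
    function trivial there. *)
Let far (y : R) : M / 2 < `|y - c| -> 1 <= 4 * (y - c) ^+ 2 / M ^+ 2.
Proof.
move=> h; rewrite ler_pdivlMr ?exprn_gt0// mul1r -[(y - c) ^+ 2]real_normK ?num_real//.
have : 0 < M / 2 by rewrite divr_gt0.
set a := `|_| in h *; nra.
Qed.

(** [F] is a product over the coordinates: one factor near 0 suffices for the upper estimate, while
    the lower one needs all [l] factors near 1. The strip of half-width [delta] around the boundary
    is left uncontrolled. *)
Lemma orthant_test_function : exists F : ('I_l -> R) -> R,
  [/\ trigpoly F,
      forall x : 'I_l -> R, (forall j, c + delta <= x j) ->
        1 - eps <= F x + \sum_j 4 * (x j - c) ^+ 2 / M ^+ 2,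
      forall (x : 'I_l -> R) j, x j <= c - delta ->
        F x <= eps + \sum_j 4 * (x j - c) ^+ 2 / M ^+ 2 &
      forall x : 'I_l -> R, 0 <= F x <= 1].
Proof.
(* One lower bound on [(1 + eta) ^ n] yields both estimates, because
   [(1 - eta) * (1 + eta) <= 1]. *)
have [n [n1 n2]] : exists n, l%:R * (1 - eta) ^+ n <= eps /\ 1 <= eps * (1 + eta) ^+ n.
  have k0 : 0 < eta * eps by rewrite mulr_gt0.
  have [n hn] : exists n : nat, l.+1%:R / (eta * eps) <= n%:R.
    by have [n _ hn] := nbhs_infty_ger (l.+1%:R / (eta * eps)); exists n; apply: hn => /=.
  have {}hn : l.+1%:R <= eps * (1 + eta) ^+ n.
    move: hn; rewrite ler_pdivrMr// => hn; apply: (le_trans hn).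
    rewrite (_ : n%:R * _ = eps * (n%:R * eta)); last by ring.
    by rewrite ler_wpM2l ?(ltW eps0)//; apply: le_trans (bernoulliD n (ltW eta0)); rewrite lerDr.
  exists n; split; last by apply: le_trans hn; rewrite ler1n.
  have e1 : 0 < (1 + eta) ^+ n by rewrite exprn_gt0// addr_gt0.
  rewrite -(ler_pM2r e1); apply: le_trans hn.
  rewrite -mulrA -exprMn; apply: (@le_trans _ _ l%:R); last by rewrite ler_nat.
  rewrite ler_piMr// exprn_ile1 ?mulr_ge0 ?subr_ge0 ?addr_ge0// ?(ltW eta0)//.
  by have := sqr_ge0 eta; move: (eta) => e; nra.
pose F (x : 'I_l -> R) := \prod_j step_poly n (t (x j)).
have q01 y := step_poly_itv n (t01 y).
have F01 x : 0 <= F x <= 1.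
  rewrite prodr_ge0; last by move=> j _; case/andP: (q01 (x j)).
  by apply: prodr_ile1 => j _; exact: q01.
have s0 x : 0 <= \sum_(j < l) 4 * (x j - c) ^+ 2 / M ^+ 2.
  by apply: sumr_ge0 => j _; rewrite divr_ge0 ?sqr_ge0// mulr_ge0// sqr_ge0.
have s1 x j : M / 2 < `|x j - c| -> 1 <= \sum_(j < l) 4 * (x j - c) ^+ 2 / M ^+ 2.
  move=> h; apply: le_trans (far h) _; rewrite (bigD1 j)//= lerDl.
  by apply: sumr_ge0 => i _; rewrite divr_ge0 ?sqr_ge0// mulr_ge0// sqr_ge0.
exists F; split => //.
- apply: trigpoly_prod => j; apply: trigpolyX; apply: trigpolyBl; apply: trigpolyX.
  have := trigpolyZ 2^-1 (trigpolyBl 1 (trigpoly_sin_coord j M^-1 c)).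
  by congr trigpoly; apply/funext => x; rewrite mulrC.
- move=> x xc; have [/forallP near|] := boolP [forall j, `|x j - c| <= M / 2]; last first.
    rewrite negb_forall => /existsP[j]; rewrite -ltNge => /s1 h.
    have /andP[F0 _] := F01 x; apply: (@le_trans _ _ (0 + 1)); last exact: lerD.
    by rewrite add0r gerBl ltW.
  apply: (@le_trans _ _ (F x)); last by rewrite lerDl s0.
  have a0 : 0 <= 1 - eta by rewrite subr_ge0.
  have a1 : 1 - eta <= 1 by rewrite gerBl ltW.
  pose u := (1 - eta) ^+ n; have u01 : 0 <= u <= 1 by rewrite exprn_ge0 ?exprn_ile1.
  apply: (@le_trans _ _ ((1 - u) ^+ l)).
    by apply: le_trans (bernoulli_ge l u01); rewrite lerB.
  rewrite -[X in _ ^+ X](card_ord l) -prodr_const; apply: ler_prod => j _.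
  rewrite subr_ge0; case/andP: (u01) => _ ->/=.
  apply: le_trans (step_poly_ge n (t01 (x j))); rewrite lerB// lerXn2r ?nnegrE//.
    by case/andP: (t01 (x j)) => ? _; rewrite mulr_ge0.
  apply: t_above => //; exact: le_trans (ler_norm _) (near j).
- move=> x j xc; have [near|/s1 h] := lerP `|x j - c| (M / 2); last first.
    have /andP[_ F1] := F01 x; apply: (le_trans F1); apply: (le_trans h).
    by rewrite lerDr ltW.
  apply: (@le_trans _ _ eps); last by rewrite lerDl s0.
  apply: (@le_trans _ _ (step_poly n (t (x j)))).
    rewrite /F (bigD1 j)//= ler_piMr//; first by case/andP: (q01 (x j)).
    by apply: prodr_ile1 => i _; exact: q01.
  have bt : 1 + eta <= 2 * t (x j).
    apply: t_below => //; apply: le_trans near; rewrite distrC; exact: ler_norm.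
  have e1 : 0 < (1 + eta) ^+ n by rewrite exprn_gt0// addr_gt0.
  rewrite -(ler_pM2r e1); apply: le_trans n2.
  apply: le_trans (step_poly_le n (t01 (x j))).
  apply: ler_wpM2l; first by case/andP: (q01 (x j)).
  by rewrite lerXn2r ?nnegrE// ?(le_trans _ bt)// addr_ge0// ltW.
Qed.

End test_function.

(** * From test functions to probabilities of orthants *)

Section orthant_bounds.
Context (R : realType) (l : nat) d (T : measurableType d) (P : probability T R).
Variables (V : 'I_l -> T -> R).
Hypothesis mV : forall j, measurable_fun setT (V j).
Hypothesis iV2 : forall j, P.-integrable setT (EFin \o (fun w => V j w ^+ 2)).

Lemma measurable_orthant_ge a : measurable [set w | forall j, a <= V j w].
Proof.
rewrite (_ : [set w | _] = \bigcap_(j in [set: 'I_l]) [set w | a <= V j w]).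
  apply: fin_bigcap_measurable => [|j _]; first exact: finite_finset.
  by rewrite -[X in measurable X]setTI; apply: measurable_fun_le.
by apply/seteqP; split => [w H j _|w H j]; exact: H.
Qed.

Lemma measurable_orthant_gt a : measurable [set w | forall j, a < V j w].
Proof.
rewrite (_ : [set w | _] = \bigcap_(j in [set: 'I_l]) [set w | a < V j w]).
  apply: fin_bigcap_measurable => [|j _]; first exact: finite_finset.
  rewrite (_ : [set w | _] = ~` [set w | V j w <= a]).
    by apply: measurableC; rewrite -[X in measurable X]setTI; apply: measurable_fun_le.
  by apply/seteqP; split => w /=; rewrite ltNge => /negP.
by apply/seteqP; split => [w H j _|w H j]; exact: H.
Qed.

Variables (F : ('I_l -> R) -> R) (c delta eps M B : R).
Hypothesis pF : trigpoly F.
Hypothesis F01 : forall x : 'I_l -> R, 0 <= F x <= 1.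
Hypothesis Fge : forall x : 'I_l -> R, (forall j, c + delta <= x j) ->
  1 - eps <= F x + \sum_j 4 * (x j - c) ^+ 2 / M ^+ 2.
Hypothesis Fle : forall (x : 'I_l -> R) j, x j <= c - delta ->
  F x <= eps + \sum_j 4 * (x j - c) ^+ 2 / M ^+ 2.
Hypothesis eps0 : 0 < eps.
Hypothesis V2B : forall j, \int[P]_w (V j w ^+ 2) <= B.
Hypothesis MB : l%:R * (8 * (B + c ^+ 2) / M ^+ 2) <= eps.

Let Q w := \sum_j 4 * (V j w - c) ^+ 2 / M ^+ 2.

Let iterm j : P.-integrable setT (EFin \o (fun w => 8 / M ^+ 2 * (V j w ^+ 2 + c ^+ 2))).
Proof.
rewrite /comp; under eq_fun do rewrite EFinM EFinD.
apply: integrableZl => //; apply: integrableD => //; first exact: iV2.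
exact: bmf_integrable (bmf_cst _ (c ^+ 2)).
Qed.

Let sum_integrable (G : 'I_l -> T -> R) : (forall j, P.-integrable setT (EFin \o G j)) ->
  P.-integrable setT (EFin \o (fun w => \sum_j G j w)).
Proof.
move=> iG; elim: (index_enum _) => [|j s ih].
  by under eq_fun do rewrite /= big_nil; exact: bmf_integrable (bmf_cst _ 0).
rewrite /comp; under eq_fun do rewrite big_cons EFinD.
by apply: integrableD => //; exact: iG.
Qed.

(** Dominates [Q] by [(v - c) ^ 2 <= 2 * (v ^ 2 + c ^ 2)], in terms of the second moments bounded by
    [B]; this is the origin of the 8 in [MB]. *)
Let Q' w := \sum_j 8 / M ^+ 2 * (V j w ^+ 2 + c ^+ 2).

Let iQ' : P.-integrable setT (EFin \o Q').
Proof. exact: sum_integrable. Qed.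

Let QQ' w : Q w <= Q' w.
Proof.
apply: ler_sum => j _; rewrite [leRHS]mulrAC ler_wpM2r ?invr_ge0 ?sqr_ge0//.
by have := sqr_ge0 (V j w + c); nra.
Qed.

Let EQ' : \int[P]_w Q' w <= eps.
Proof.
apply: le_trans MB; rewrite Rint_sum//.
apply: (@le_trans _ _ (\sum_(j < l) 8 * (B + c ^+ 2) / M ^+ 2)).
  apply: ler_sum => j _; rewrite RintegralZl//; last first.
    rewrite /comp; under eq_fun do rewrite EFinD.
    by apply: integrableD => //; [exact: iV2|exact: bmf_integrable (bmf_cst _ (c ^+ 2))].
  rewrite RintegralD//; last exact: bmf_integrable (bmf_cst _ (c ^+ 2)).
  rewrite Rint_cst [leLHS]mulrAC ler_wpM2r ?invr_ge0 ?sqr_ge0// ler_wpM2l// lerD2r.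
  exact: V2B.
by rewrite sumr_const card_ord [leRHS]mulr_natl.
Qed.

Let bF : bmf (fun w => F (V^~ w)) := trigpoly_bmf mV pF.

(** One [eps] is the error of [F] inside the box, the other is the Chebyshev term [EQ']. *)
Lemma orthant_le_test :
  fine (P [set w | forall j, c + delta <= V j w]) <= \int[P]_w F (V^~ w) + 2 * eps.
Proof.
set A := [set w | _]; have mA : measurable A := measurable_orthant_ge _.
rewrite -Rint_indic//.
apply: (@le_trans _ _ (\int[P]_w (F (V^~ w) + eps + Q' w))).
  apply: le_Rintegral => //.
  - exact: bmf_integrable (bmf_indic _ mA).
  - rewrite /comp; under eq_fun do rewrite EFinD; apply: integrableD => //.
    by apply: bmf_integrable (bmfD bF (bmf_cst _ eps)).
  move=> w _; have /andP[F0 _] := F01 (V^~ w).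
  have Q'0 : 0 <= Q' w.
    apply: le_trans (QQ' w); apply: sumr_ge0 => j _.
    by rewrite divr_ge0 ?sqr_ge0// mulr_ge0// sqr_ge0.
  rewrite indicE; have [/set_mem Aw|_] := boolP (w \in A); last first.
    by rewrite addr_ge0// addr_ge0// ltW.
  have := Fge Aw; rewrite lerBlDr => h; apply: (le_trans h).
  by rewrite addrAC lerD2l; exact: QQ'.
rewrite RintegralD//; last by apply: bmf_integrable (bmfD bF (bmf_cst _ eps)).
rewrite RintD ?Rint_cst//; last exact: bmf_cst.
by move: EQ'; set q := \int[P]_w Q' w; set g := \int[P]_w F _; lra.
Qed.

Lemma test_le_orthant :
  \int[P]_w F (V^~ w) <= fine (P [set w | forall j, c - delta < V j w]) + 2 * eps.
Proof.
set A := [set w | _]; have mA : measurable A := measurable_orthant_gt _.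
rewrite -Rint_indic//.
apply: (@le_trans _ _ (\int[P]_w ((\1_A w : R) + eps + Q' w))).
  apply: le_Rintegral => //.
  - exact: bmf_integrable.
  - rewrite /comp; under eq_fun do rewrite EFinD; apply: integrableD => //.
    by apply: bmf_integrable (bmfD (bmf_indic _ mA) (bmf_cst _ eps)).
  move=> w _; have /andP[_ F1] := F01 (V^~ w).
  have Q'0 : 0 <= Q' w.
    apply: le_trans (QQ' w); apply: sumr_ge0 => j _.
    by rewrite divr_ge0 ?sqr_ge0// mulr_ge0// sqr_ge0.
  rewrite indicE; have [_|/negP nA] := boolP (w \in A).
    by rewrite (le_trans F1)// -addrA lerDl addr_ge0// ltW.
  have [j /negP] : exists j, ~ (c - delta < V j w).
    by apply/existsNP => H; apply: nA; rewrite inE.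
  rewrite -leNgt => Vj; have h := @Fle (V^~ w) j Vj; apply: (le_trans h).
  by rewrite add0r lerD2l; exact: QQ'.
rewrite RintegralD//; last by apply: bmf_integrable (bmfD (bmf_indic _ mA) (bmf_cst _ eps)).
rewrite RintD ?Rint_cst//; [|exact: bmf_indic|exact: bmf_cst].
by move: EQ'; set q := \int[P]_w Q' w; set g := \int[P]_w _; lra.
Qed.

End orthant_bounds.

Section orthant_continuity.
Context (R : realType) (l : nat) d (T : measurableType d) (P : probability T R).
Variables (X : 'I_l -> T -> R).
Hypothesis mX : forall j, measurable_fun setT (X j).
Hypothesis X0 : forall j, P (X j @^-1` [set 0]) = 0%E.

(** A point of the closed orthant outside the open one has a zero coordinate, so it is charged to
    one of [l] null sets. *)
Lemma orthant_boundary :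
  P [set w | forall j, 0 < X j w] = P [set w | forall j, 0 <= X j w].
Proof.
have mp := measurable_orthant_gt mX 0; have mg := measurable_orthant_ge mX 0.
have mN j : measurable (X j @^-1` [set 0]) by rewrite -[X in measurable X]setTI; exact: mX.
rewrite -[LHS]fineK ?fin_num_measure// -[RHS]fineK ?fin_num_measure//; congr _%:E.
apply/eqP; rewrite eq_le; apply/andP; split.
  by rewrite fine_le ?fin_num_measure// le_measure ?inE// => w /= H j; exact: ltW.
set A := [set w | forall j, 0 < X j w] in mp *; set B := [set w | _] in mg *.
have N0 j : \int[P]_w (\1_(X j @^-1` [set 0]) w : R) = 0 by rewrite Rint_indic ?X0.
apply: (@le_trans _ _ (\int[P]_w ((\1_A w : R) + \sum_j \1_(X j @^-1` [set 0]) w))).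
  rewrite -Rint_indic//; apply: ler_Rint; first exact: bmf_indic.
    by apply: bmfD; [exact: bmf_indic|apply: bmf_sum => j; exact: bmf_indic].
  move=> w; rewrite ![\1_A _]indicE [\1_B _]indicE.
  have S0 : 0 <= \sum_j (\1_(X j @^-1` [set 0]) w : R) by apply: sumr_ge0.
  have [/set_mem Bw|_] := boolP (w \in B); last by rewrite addr_ge0.
  have [_|/negP nA] := boolP (w \in A); first by rewrite lerDl.
  have [j /negP Xj] : exists j, ~ (0 < X j w).
    by apply/existsNP => H; apply: nA; rewrite inE.
  rewrite add0r (bigD1 j)//= indicE mem_set ?lerDl; last first.
    by apply/eqP; rewrite eq_le Bw andbT leNgt.
  by apply: sumr_ge0.
rewrite RintD; [|exact: bmf_indic|by apply: bmf_sum => j; exact: bmf_indic].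
rewrite Rint_sum; last by move=> j; apply: bmf_integrable (bmf_indic _ (mN j)).
by rewrite Rint_indic// big1 ?addr0.
Qed.

(** Continuity of measures. From inside the limit is the open orthant, whence the use of
    [orthant_boundary]. The thresholds are those of test functions with [c = delta] and
    [c = - delta]. *)
Lemma orthant_approx (e : R) : 0 < e -> exists2 delta, 0 < delta &
  fine (P [set w | forall j, 0 <= X j w]) - e <=
    fine (P [set w | forall j, delta + delta <= X j w]) /\
  fine (P [set w | forall j, - delta - delta < X j w]) <=
    fine (P [set w | forall j, 0 <= X j w]) + e.
Proof.
move=> e0; pose r (n : nat) : R := n.+1%:R^-1.
have r0 n : 0 < r n by rewrite invr_gt0.
have rle n m : (n <= m)%N -> r m <= r n by move=> nm; rewrite lef_pV2 ?posrE// ler_nat.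
have rc : r @ \oo --> (0 : R) := cvg_harmonic.
have small (x : R) : 0 < x -> exists n, r n <= x.
  by move=> x0; have [n _ /(_ n (leqnn _)) h] := (cvgr_le _ rc) x x0; exists n.
have up : (fun n => P [set w | forall j, r n <= X j w]) @ \oo -->
    P [set w | forall j, 0 <= X j w].
  rewrite -orthant_boundary.
  have -> : [set w | forall j, 0 < X j w] = \bigcup_n [set w | forall j, r n <= X j w].
    apply/seteqP; split => [w /= H|w [n _ /= H] j]; last exact: lt_le_trans (H j).
    have /choice[N HN] j : exists n, r n <= X j w by exact: small.
    exists (\max_j N j)%N => //= j; apply: le_trans (HN j); apply: rle.
    exact: leq_bigmax.
  apply: nondecreasing_cvg_mu.
  - by move=> n; exact: measurable_orthant_ge.
  - by apply: bigcupT_measurable => n; exact: measurable_orthant_ge.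
  - by move=> n m nm; apply/subsetPset => w /= H j; apply: le_trans (H j); exact: rle.
have down : (fun n => P [set w | forall j, - r n < X j w]) @ \oo -->
    P [set w | forall j, 0 <= X j w].
  have -> : [set w | forall j, 0 <= X j w] = \bigcap_n [set w | forall j, - r n < X j w].
    apply/seteqP; split => [w /= H n _ j|w H j].
      by apply: lt_le_trans (H j); rewrite oppr_lt0.
    rewrite leNgt; apply/negP => Xj; have [|n h] := small (- X j w); first by rewrite oppr_gt0.
    by have := H n I j; rewrite ltrNl ltNge h.
  apply: nonincreasing_cvg_mu.
  - by rewrite (le_lt_trans (probability_le1 _ _)) ?ltry//; exact: measurable_orthant_gt.
  - by move=> n; exact: measurable_orthant_gt.
  - by apply: bigcapT_measurable => n; exact: measurable_orthant_gt.
  - by move=> n m nm; apply/subsetPset => w /= H j; apply: le_lt_trans (H j); rewrite lerN2; exact: rle.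
have fin A : measurable A -> P A \is a fin_num by exact: fin_num_measure.
have {}up : (fun n => fine (P [set w | forall j, r n <= X j w])) @ \oo -->
    fine (P [set w | forall j, 0 <= X j w]).
  by apply: fine_cvg; rewrite fineK ?fin//; exact: measurable_orthant_ge.
have {}down : (fun n => fine (P [set w | forall j, - r n < X j w])) @ \oo -->
    fine (P [set w | forall j, 0 <= X j w]).
  by apply: fine_cvg; rewrite fineK ?fin//; exact: measurable_orthant_ge.
near \oo => n; exists (r n / 2); first by rewrite divr_gt0.
rewrite -opprD -splitr; split.
  by near: n; apply: (cvgr_ge _ up); rewrite gtrBl.
by near: n; apply: (cvgr_le _ down); rewrite ltrDl.
Unshelve. all: by end_near.
Qed.

End orthant_continuity.

(** Test functions centered at [delta] and [- delta] have strips that start, respectively end, at 0.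
    They thus bracket the probability for [V m] at the exact threshold, and the thickened boundary
    is measured under the fixed law of [X] only. *)
Lemma orthant_cvg (R : realType) (l : nat)
    (d : nat -> measure_display) (T : forall m, measurableType (d m))
    (P : forall m, probability (T m) R) (V : forall m, 'I_l -> T m -> R)
    dX (TX : measurableType dX) (PX : probability TX R) (X : 'I_l -> TX -> R) (B : R) :
  (forall m j, bmf (V m j)) ->
  (\forall m \near \oo, forall j, \int[P m]_w (V m j w ^+ 2) <= B) ->
  (forall j, measurable_fun setT (X j)) ->
  (forall j, PX.-integrable setT (EFin \o (fun w => X j w ^+ 2))) ->
  (forall j, \int[PX]_w (X j w ^+ 2) <= B) ->
  (forall j, PX (X j @^-1` [set 0]) = 0%E) ->
  (forall t c, (fun m => \int[P m]_w cos (\sum_j t j * V m j w + c)) @ \oo -->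
     \int[PX]_w cos (\sum_j t j * X j w + c)) ->
  (fun m => fine (P m [set w | forall j, 0 < V m j w])) @ \oo -->
    fine (PX [set w | forall j, 0 <= X j w]).
Proof.
move=> bV VB mX iX2 XB X0 H; apply/cvgrPdist_le => e e0.
(* Two [eps] for comparing [X] with the test function, two for [V m], one for the convergence of
   integrals and one for [orthant_approx]. *)
pose eps := e / 6; have eps0 : 0 < eps by rewrite divr_gt0.
have [delta delta0 [dlow dup]] := orthant_approx mX X0 eps0.
have [M [M0 deltaM MB]] : exists M, [/\ 0 < M, delta <= M & l%:R * (8 * (B + delta ^+ 2) / M ^+ 2) <= eps].
  pose K := l%:R * (8 * (`|B| + delta ^+ 2)).
  have K0 : 0 <= K by rewrite !mulr_ge0// addr_ge0 ?sqr_ge0.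
  have M1 : 1 <= 1 + delta + K / eps by rewrite -addrA lerDl addr_ge0 ?(ltW delta0)// divr_ge0// ltW.
  (* The summand 1 ensures [M <= M ^ 2], so that [K / eps <= M] is enough. *)
  exists (1 + delta + K / eps); split.
  - exact: lt_le_trans M1.
  - by rewrite addrAC lerDr addr_ge0// divr_ge0// ltW.
  - rewrite mulrA ler_pdivrMr ?exprn_gt0 ?(lt_le_trans _ M1)//.
    apply: (@le_trans _ _ K); first by rewrite ler_wpM2l// ler_wpM2l// lerD2r ler_norm.
    apply: (@le_trans _ _ (eps * (1 + delta + K / eps))).
      rewrite mulrDr mulrCA divff ?gt_eqF// mulr1 lerDr mulr_ge0 ?(ltW eps0)// addr_ge0// ltW//.
    by rewrite ler_wpM2l ?(ltW eps0)// expr2 ler_peMl// (le_trans _ M1).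
have mV m j := (bV m j).1.
have iV2 m j := bmf_integrable (P := P m) (bmfX 2 (bV m j)).
have [F1 [pF1 F1ge F1le F101]] := orthant_test_function l delta delta0 eps0 M0 deltaM.
have [F2 [pF2 F2ge F2le F201]] := orthant_test_function l (- delta) delta0 eps0 M0 deltaM.
have MB' : l%:R * (8 * (B + (- delta) ^+ 2) / M ^+ 2) <= eps by rewrite sqrrN.
have c1 := trigpoly_cvg mV mX H pF1; have c2 := trigpoly_cvg mV mX H pF2.
have X1 := orthant_le_test mX iX2 pF1 F101 F1ge eps0 XB MB.
have X2 := test_le_orthant mX iX2 pF2 F201 F2le eps0 XB MB'.
near=> m; have VBm : forall j, \int[P m]_w (V m j w ^+ 2) <= B by near: m.
have V1 := test_le_orthant (mV m) (iV2 m) pF1 F101 F1le eps0 VBm MB.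
have V2 := orthant_le_test (mV m) (iV2 m) pF2 F201 F2ge eps0 VBm MB'.
rewrite subrr in V1; rewrite addNr in V2.
have V20 : fine (P m [set w | forall j, 0 < V m j w]) <= fine (P m [set w | forall j, 0 <= V m j w]).
  have m1 := measurable_orthant_gt (mV m) 0; have m2 := measurable_orthant_ge (mV m) 0.
  by rewrite fine_le ?fin_num_measure// le_measure ?inE// => w /= h j; exact: ltW.
have C1 : `|\int[PX]_w F1 (X^~ w) - \int[P m]_w F1 (V m ^~ w)| <= eps.
  by near: m; move/cvgrPdist_le : c1; exact.
have C2 : `|\int[PX]_w F2 (X^~ w) - \int[P m]_w F2 (V m ^~ w)| <= eps.
  by near: m; move/cvgrPdist_le : c2; exact.
rewrite ler_norml in C1; rewrite ler_norml in C2.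
case/andP: C1 => a1 a2; case/andP: C2 => b1 b2.
rewrite ler_norml; move: X1 X2 V1 V2 V20 dlow dup.
rewrite (_ : e = 6 * eps); last by rewrite /eps; field.
set p1 := \int[PX]_w F1 _ in a1 a2 *; set p2 := \int[PX]_w F2 _ in b1 b2 *.
set q1 := \int[P m]_w F1 _ in a1 a2 *; set q2 := \int[P m]_w F2 _ in b1 b2 *.
move: (eps) (fine _) (fine _) (fine _) (fine _) (fine _) a1 a2 b1 b2 => ? ? ? ? ? ? ? ? ? ? ? ? ? ? ? ? ?.
by apply/andP; split; lra.
Unshelve. all: by end_near.
Qed.

(** * Iterated integrals of bounded functions *)

Section fubini_bounded.
Context d1 d2 (T1 : measurableType d1) (T2 : measurableType d2) (R : realType).
Variables (mu : probability T1 R) (nu : probability T2 R).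
Implicit Type h : T1 * T2 -> R.

Let prod : probability (T1 * T2)%type R := (mu \x nu)%E.

Lemma bmf_section1 h x : bmf h -> bmf (fun y => h (x, y)).
Proof. by apply: (bmf_comp (h := fun y => (x, y))); exact: measurable_fun_pair. Qed.

Lemma bmf_section2 h y : bmf h -> bmf (fun x => h (x, y)).
Proof. by apply: (bmf_comp (h := fun x => (x, y))); exact: measurable_fun_pair. Qed.

Let fubini_FE h : bmf h ->
  fubini_F nu (EFin \o h) = fun x => (\int[nu]_y h (x, y))%:E.
Proof.
move=> bh; apply/funext => x; rewrite /fubini_F /Rintegral fineK//.
by apply: integrable_fin_num => //; apply: (bmf_integrable (bmf_section1 x bh)).
Qed.

Let fubini_GE h : bmf h ->
  fubini_G mu (EFin \o h) = fun y => (\int[mu]_x h (x, y))%:E.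
Proof.
move=> bh; apply/funext => y; rewrite /fubini_G /Rintegral fineK//.
by apply: integrable_fin_num => //; apply: (bmf_integrable (bmf_section2 y bh)).
Qed.

Lemma bmf_Rint1 h : bmf h -> bmf (fun x => \int[nu]_y h (x, y)).
Proof.
move=> bh; split.
  have := measurable_fubini_F (bmf_integrable (P := prod) bh).
  by rewrite (fubini_FE bh) => /measurable_EFinP.
have [_ [C hC]] := bh; exists C => x; apply: ler_Rint_norm => //.
exact: bmf_integrable (bmf_section1 x bh).
Qed.

Lemma bmf_Rint2 h : bmf h -> bmf (fun y => \int[mu]_x h (x, y)).
Proof.
move=> bh; split.
  have := measurable_fubini_G (bmf_integrable (P := prod) bh).
  by rewrite (fubini_GE bh) => /measurable_EFinP.
have [_ [C hC]] := bh; exists C => y; apply: ler_Rint_norm => //.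
exact: bmf_integrable (bmf_section2 y bh).
Qed.

Lemma Rint_prod1 h : bmf h ->
  fine (\int[mu \x nu]_z (h z)%:E)%E = \int[mu]_x \int[nu]_y h (x, y).
Proof.
move=> bh; rewrite /Rintegral -[LHS](congr1 fine (integral12_prod_meas1 (bmf_integrable (P := prod) bh))).
by rewrite (fubini_FE bh).
Qed.

Lemma Rint_prod2 h : bmf h ->
  fine (\int[mu \x nu]_z (h z)%:E)%E = \int[nu]_y \int[mu]_x h (x, y).
Proof.
move=> bh; rewrite /Rintegral -[LHS](congr1 fine (integral21_prod_meas1 (bmf_integrable (P := prod) bh))).
by rewrite (fubini_GE bh).
Qed.

Lemma Rint_exchange h : bmf h ->
  \int[mu]_x \int[nu]_y h (x, y) = \int[nu]_y \int[mu]_x h (x, y).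
Proof. by move=> bh; rewrite -Rint_prod1// Rint_prod2. Qed.

Lemma fine_prod_measure (A : set (T1 * T2)) : measurable A ->
  fine ((mu \x nu)%E A) = fine (\int[mu \x nu]_z (\1_A z)%:E)%E.
Proof. by move=> mA; rewrite integral_indic// setIT. Qed.

End fubini_bounded.

(** * Comparison of two faces *)

Section comparison_kernels.
Variable R : realType.

Definition gtm (x y : R) : R := (y < x)%R%:R.
Definition eqm (x y : R) : R := (x == y)%:R.

Lemma measurable_gt d (T : measurableType d) (f g : T -> R) :
  measurable_fun setT f -> measurable_fun setT g -> measurable [set w | f w > g w].
Proof.
move=> mf mg; rewrite (_ : [set w | _] = ~` [set w | f w <= g w]).
  by apply: measurableC; rewrite -[X in measurable X]setTI; exact: measurable_fun_le.
by apply/seteqP; split => w /=; rewrite ltNge => /negP.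
Qed.

Lemma measurable_eq d (T : measurableType d) (f g : T -> R) :
  measurable_fun setT f -> measurable_fun setT g -> measurable [set w | f w = g w].
Proof.
move=> mf mg; rewrite (_ : [set w | _] = [set w | f w <= g w] `&` [set w | g w <= f w]).
  by apply: measurableI; rewrite -[X in measurable X]setTI; exact: measurable_fun_le.
apply/seteqP; split => w /= => [->//|[h1 h2]].
by apply/eqP; rewrite eq_le h1.
Qed.

Lemma gtmE d (T : measurableType d) (f g : T -> R) :
  (fun w => gtm (f w) (g w)) = \1_[set w | f w > g w].
Proof. by apply/funext => w; rewrite indicE /gtm; congr (nat_of_bool _)%:R; apply/idP/idP; rewrite inE. Qed.

Lemma eqmE d (T : measurableType d) (f g : T -> R) :
  (fun w => eqm (f w) (g w)) = \1_[set w | f w = g w].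
Proof. by apply/funext => w; rewrite indicE /eqm; congr (nat_of_bool _)%:R; apply/eqP/idP; rewrite inE. Qed.

Lemma bmf_gtm d (T : measurableType d) (f g : T -> R) :
  measurable_fun setT f -> measurable_fun setT g -> bmf (fun w => gtm (f w) (g w)).
Proof. by move=> mf mg; rewrite gtmE; apply: bmf_indic; exact: measurable_gt. Qed.

Lemma bmf_eqm d (T : measurableType d) (f g : T -> R) :
  measurable_fun setT f -> measurable_fun setT g -> bmf (fun w => eqm (f w) (g w)).
Proof. by move=> mf mg; rewrite eqmE; apply: bmf_indic; exact: measurable_eq. Qed.

Lemma gtm_itv x y : 0 <= gtm x y <= 1. Proof. by rewrite /gtm; case: (_ < _)%R; rewrite ?lexx ?ler01. Qed.
Lemma eqm_itv x y : 0 <= eqm x y <= 1. Proof. by rewrite /eqm; case: (_ == _); rewrite ?lexx ?ler01. Qed.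

Lemma Rint_itv01 d (T : measurableType d) (P : probability T R) (f : T -> R) :
  bmf f -> (forall w, 0 <= f w <= 1) -> 0 <= \int[P]_w f w <= 1.
Proof.
move=> bf f01; apply/andP; split.
  by apply: Rintegral_ge0 => w _; case/andP: (f01 w).
rewrite -[leRHS](Rint_cst P); apply: ler_Rint => //; first exact: bmf_cst.
by move=> w; case/andP: (f01 w).
Qed.

End comparison_kernels.

(** * Projections of the comparison kernel and their covariances *)

Section dice_laws.
Variables (R : realType) (l : nat) (L : 'I_l -> probability R R).
Implicit Types k : 'I_l.

(** All four functions are indexed by the first die of the comparison: [win k] and [draw k] take a
    face of die [k], whereas [lose k] and [draw' k] take a face of [ordS k]. *)
Definition win k x := \int[L (ordS k)]_y gtm x y.
Definition lose k y := \int[L k]_x gtm x y.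
Definition draw k x := \int[L (ordS k)]_y eqm x y.
Definition draw' k y := \int[L k]_x eqm x y.

Let bg : bmf (fun z : R * R => gtm z.1 z.2).
Proof. exact: bmf_gtm. Qed.

Let be : bmf (fun z : R * R => eqm z.1 z.2).
Proof. exact: bmf_eqm. Qed.

Lemma bmf_win k : bmf (win k). Proof. exact: (bmf_Rint1 (L k) (L (ordS k)) bg). Qed.
Lemma bmf_lose k : bmf (lose k). Proof. exact: (bmf_Rint2 (L k) (L (ordS k)) bg). Qed.
Lemma bmf_draw k : bmf (draw k). Proof. exact: (bmf_Rint1 (L k) (L (ordS k)) be). Qed.
Lemma bmf_draw' k : bmf (draw' k). Proof. exact: (bmf_Rint2 (L k) (L (ordS k)) be). Qed.

Lemma win_itv k x : 0 <= win k x <= 1.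
Proof. by apply: Rint_itv01 => [|y]; [exact: bmf_gtm|exact: gtm_itv]. Qed.
Lemma lose_itv k x : 0 <= lose k x <= 1.
Proof. by apply: Rint_itv01 => [|y]; [exact: bmf_gtm|exact: gtm_itv]. Qed.
Lemma draw_itv k x : 0 <= draw k x <= 1.
Proof. by apply: Rint_itv01 => [|y]; [exact: bmf_eqm|exact: eqm_itv]. Qed.
Lemma draw'_itv k x : 0 <= draw' k x <= 1.
Proof. by apply: Rint_itv01 => [|y]; [exact: bmf_eqm|exact: eqm_itv]. Qed.

Lemma pk_win k : pk L k = \int[L k]_x win k x.
Proof.
rewrite /pk fine_prod_measure; last exact: measurable_gt.
by rewrite -gtmE (Rint_prod1 _ _ bg).
Qed.

Lemma pk_lose k : pk L k = \int[L (ordS k)]_y lose k y.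
Proof. by rewrite pk_win /win (Rint_exchange _ _ bg). Qed.

Lemma tie_draw k : tie L k = \int[L k]_x draw k x.
Proof.
rewrite /tie fine_prod_measure; last exact: measurable_eq.
by rewrite -eqmE (Rint_prod1 _ _ be).
Qed.

Lemma tie_draw' k : tie L k = \int[L (ordS k)]_y draw' k y.
Proof. by rewrite tie_draw /draw (Rint_exchange _ _ be). Qed.

(** Given the common face, the two comparisons are independent with the same probability. *)
Lemma rk_win k : rk L k = \int[L k]_x win k x ^+ 2.
Proof.
pose h (z : R * (R * R)) := gtm z.1 z.2.1 * gtm z.1 z.2.2.
have m1 : measurable_fun setT (fun z : R * (R * R) => z.2.1) by exact: measurableT_comp.
have m2 : measurable_fun setT (fun z : R * (R * R) => z.2.2) by exact: measurableT_comp.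
have bh : bmf h by apply: bmfM; exact: bmf_gtm.
have mA : measurable [set z : R * (R * R) | z.1 > z.2.1 /\ z.1 > z.2.2].
  by apply: measurableI; exact: measurable_gt.
rewrite /rk fine_prod_measure//.
have -> : \1_[set z : R * (R * R) | z.1 > z.2.1 /\ z.1 > z.2.2] = h.
  apply/funext => z; rewrite indicE /h /gtm -natrM mulnb; congr (nat_of_bool _)%:R.
  by apply/idP/andP; rewrite inE.
rewrite (Rint_prod1 _ _ bh); apply: eq_Rintegral => x _.
have bhx := bmf_section1 x bh.
rewrite [LHS](Rint_prod1 _ _ bhx) /h/=.
transitivity (\int[L (ordS k)]_y (gtm x y * win k x)).
  by apply: eq_Rintegral => y _; rewrite RintZl//; exact: bmf_gtm.
by rewrite RintZr ?expr2//; exact: bmf_gtm.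
Qed.

Lemma qk_lose k : qk L k = \int[L (ordS k)]_y lose k y ^+ 2.
Proof.
pose h (z : R * R * R) := gtm z.1.1 z.2 * gtm z.1.2 z.2.
have m1 : measurable_fun setT (fun z : R * R * R => z.1.1) by exact: measurableT_comp.
have m2 : measurable_fun setT (fun z : R * R * R => z.1.2) by exact: measurableT_comp.
have bh : bmf h by apply: bmfM; exact: bmf_gtm.
have mA : measurable [set z : R * R * R | z.1.1 > z.2 /\ z.1.2 > z.2].
  by apply: measurableI; exact: measurable_gt.
rewrite /qk fine_prod_measure//.
have -> : \1_[set z : R * R * R | z.1.1 > z.2 /\ z.1.2 > z.2] = h.
  apply/funext => z; rewrite indicE /h /gtm -natrM mulnb; congr (nat_of_bool _)%:R.
  by apply/idP/andP; rewrite inE.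
rewrite (Rint_prod2 _ _ bh); apply: eq_Rintegral => y _.
have bhy := bmf_section2 y bh.
rewrite [LHS](Rint_prod1 _ _ bhy) /h/=.
transitivity (\int[L k]_x (gtm x y * lose k y)).
  by apply: eq_Rintegral => x _; rewrite RintZl//; exact: bmf_gtm.
by rewrite RintZr ?expr2//; exact: bmf_gtm.
Qed.

(** Given the middle face, the comparisons with the two neighbouring dice are independent. *)
Lemma sk_lose_win k : sk L k = \int[L k]_x (lose (ord_pred k) x * win k x).
Proof.
pose h (z : R * R * R) := gtm z.1.1 z.1.2 * gtm z.1.2 z.2.
have m1 : measurable_fun setT (fun z : R * R * R => z.1.1) by exact: measurableT_comp.
have m2 : measurable_fun setT (fun z : R * R * R => z.1.2) by exact: measurableT_comp.
have bh : bmf h by apply: bmfM; exact: bmf_gtm.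
have mA : measurable [set z : R * R * R | z.1.1 > z.1.2 /\ z.1.2 > z.2].
  by apply: measurableI; exact: measurable_gt.
rewrite /sk fine_prod_measure//.
have -> : \1_[set z : R * R * R | z.1.1 > z.1.2 /\ z.1.2 > z.2] = h.
  apply/funext => z; rewrite indicE /h /gtm -natrM mulnb; congr (nat_of_bool _)%:R.
  by apply/idP/andP; rewrite inE.
rewrite (Rint_prod1 _ _ bh) /h/=.
have bh' : bmf (fun u : R * R => gtm u.1 u.2 * win k u.2).
  by apply: bmfM => //; exact: (bmf_comp measurable_snd (bmf_win k)).
transitivity (fine (\int[L (ord_pred k) \x L k]_u (gtm u.1 u.2 * win k u.2)%:E)%E).
  by apply: eq_Rintegral => u _; rewrite RintZl//; exact: bmf_gtm.
rewrite (Rint_prod2 _ _ bh')/=; apply: eq_Rintegral => y _.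
by rewrite RintZr//; exact: bmf_gtm.
Qed.

(* Ties count for one half, so that a die beats another one exactly when the
   sum of [half] over all pairs of faces exceeds half of the number of pairs. *)
Definition half (x y : R) : R := gtm x y + 2^-1 * eqm x y.
Definition wind k x := win k x + 2^-1 * draw k x.
Definition losed k y := lose k y + 2^-1 * draw' k y.
Definition kap k := pk L k + 2^-1 * tie L k.
(** The second-order component of [half], whose first-order projections are [wind] and [losed]. *)
Definition hoeffding_rest k x y := half x y - wind k x - losed k y + kap k.

Lemma bmf_half d (T : measurableType d) (f g : T -> R) :
  measurable_fun setT f -> measurable_fun setT g -> bmf (fun w => half (f w) (g w)).
Proof.
by move=> mf mg; apply: bmfD; [exact: bmf_gtm|apply: bmfM; [exact: bmf_cst|exact: bmf_eqm]].
Qed.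

Lemma bmf_wind k : bmf (wind k).
Proof. by apply: bmfD; [exact: bmf_win|apply: bmfM; [exact: bmf_cst|exact: bmf_draw]]. Qed.

Lemma bmf_losed k : bmf (losed k).
Proof. by apply: bmfD; [exact: bmf_lose|apply: bmfM; [exact: bmf_cst|exact: bmf_draw']]. Qed.

Lemma pk_itv k : 0 <= pk L k <= 1.
Proof. by rewrite pk_win; apply: Rint_itv01 => [|x]; [exact: bmf_win|exact: win_itv]. Qed.

Lemma tie_itv k : 0 <= tie L k <= 1.
Proof. by rewrite tie_draw; apply: Rint_itv01 => [|x]; [exact: bmf_draw|exact: draw_itv]. Qed.

Lemma Rint_half1 k x : \int[L (ordS k)]_y half x y = wind k x.
Proof.
rewrite RintD; [|exact: bmf_gtm|by apply: bmfM; [exact: bmf_cst|exact: bmf_eqm]].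
by rewrite RintZl//; exact: bmf_eqm.
Qed.

Lemma Rint_half2 k y : \int[L k]_x half x y = losed k y.
Proof.
rewrite RintD; [|exact: bmf_gtm|by apply: bmfM; [exact: bmf_cst|exact: bmf_eqm]].
by rewrite RintZl//; exact: bmf_eqm.
Qed.

Lemma Rint_wind k : \int[L k]_x wind k x = kap k.
Proof.
rewrite RintD; [|exact: bmf_win|by apply: bmfM; [exact: bmf_cst|exact: bmf_draw]].
by rewrite RintZl -?pk_win -?tie_draw//; exact: bmf_draw.
Qed.

Lemma Rint_losed k : \int[L (ordS k)]_y losed k y = kap k.
Proof.
rewrite RintD; [|exact: bmf_lose|by apply: bmfM; [exact: bmf_cst|exact: bmf_draw']].
by rewrite RintZl -?pk_lose -?tie_draw'//; exact: bmf_draw'.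
Qed.

Lemma wind_itv k x : 0 <= wind k x <= 2.
Proof.
have := win_itv k x; have := draw_itv k x; rewrite /wind.
by move=> /andP[? ?] /andP[? ?]; apply/andP; split; lra.
Qed.

Lemma losed_itv k x : 0 <= losed k x <= 2.
Proof.
have := lose_itv k x; have := draw'_itv k x; rewrite /losed.
by move=> /andP[? ?] /andP[? ?]; apply/andP; split; lra.
Qed.

Lemma kap_itv k : 0 <= kap k <= 2.
Proof.
have := pk_itv k; have := tie_itv k; rewrite /kap.
by move=> /andP[? ?] /andP[? ?]; apply/andP; split; lra.
Qed.

Lemma half_itv x y : 0 <= half x y <= 2.
Proof.
have := gtm_itv x y; have := eqm_itv x y; rewrite /half.
by move=> /andP[? ?] /andP[? ?]; apply/andP; split; lra.
Qed.

(** Two terms of each sign, each in [[0, 2]]; the constants are crude, only boundedness matters. *)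
Lemma hoeffding_rest_le k x y : `|hoeffding_rest k x y| <= 4.
Proof.
have := half_itv x y; have := wind_itv k x; have := losed_itv k y; have := kap_itv k.
rewrite /hoeffding_rest ler_norml.
by move=> /andP[? ?] /andP[? ?] /andP[? ?] /andP[? ?]; apply/andP; split; lra.
Qed.

Lemma measurable_hoeffding_rest k :
  measurable_fun setT (fun z : R * R => hoeffding_rest k z.1 z.2).
Proof.
apply: (bmfD (bmfB (bmfB (bmf_half _ _) _) _) (bmf_cst _ _)).1 => //.
  exact: (bmf_comp measurable_fst (bmf_wind k)).
exact: (bmf_comp measurable_snd (bmf_losed k)).
Qed.

Lemma hoeffding_rest_l k y : \int[L k]_x hoeffding_rest k x y = 0.
Proof.
have bh : bmf (fun x => half x y) by exact: bmf_half.
have bw := bmf_wind k; have bC (c : R) := bmf_cst R c.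
rewrite RintD; [|by apply: bmfB => //; exact: bmfB|by []].
rewrite RintB//; last exact: bmfB.
rewrite RintB// !Rint_cst Rint_half2 Rint_wind; ring.
Qed.

Lemma hoeffding_rest_r k x : \int[L (ordS k)]_y hoeffding_rest k x y = 0.
Proof.
have bh : bmf (fun y => half x y) by exact: bmf_half.
have bw := bmf_losed k; have bC (c : R) := bmf_cst R c.
rewrite RintD; [|by apply: bmfB => //; exact: bmfB|by []].
rewrite RintB//; last exact: bmfB.
rewrite RintB// !Rint_cst Rint_half1 Rint_losed; ring.
Qed.

Let Rint_centered d (T : measurableType d) (P : probability T R) (f g : T -> R) a b :
  bmf f -> bmf g -> \int[P]_x f x = a -> \int[P]_x g x = b ->
  \int[P]_x ((f x - a) * (g x - b)) = \int[P]_x (f x * g x) - a * b.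
Proof.
move=> bf bh fa gb; have bC (c : R) := bmf_cst T c.
transitivity (\int[P]_x (f x * g x - (a * g x + (f x * b - a * b)))).
  by apply: eq_Rintegral => x _; ring.
have b1 : bmf (fun x => f x * b - a * b) by solve_bmf.
have b2 : bmf (fun x => a * g x) by solve_bmf.
rewrite RintB; [|exact: bmfM|exact: bmfD].
rewrite RintD// RintB//; last exact: bmfM.
by rewrite RintZl// RintZr// fa gb Rint_cst; ring.
Qed.

(** Adding [u / 2] and [v / 2] moves a covariance only through terms containing [u] or [v], which
    are controlled by their means. With draws for [u] and [v], the three estimates below follow. *)
Let Rint_perturb d (T : measurableType d) (P : probability T R) (f g u v : T -> R) a b s t :
  bmf f -> bmf g -> bmf u -> bmf v ->
  (forall x, 0 <= f x <= 1) -> (forall x, 0 <= g x <= 1) ->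
  (forall x, 0 <= u x <= 1) -> (forall x, 0 <= v x <= 1) ->
  \int[P]_x f x = a -> \int[P]_x g x = b -> \int[P]_x u x = s -> \int[P]_x v x = t ->
  `|\int[P]_x ((f x + 2^-1 * u x - (a + 2^-1 * s)) * (g x + 2^-1 * v x - (b + 2^-1 * t))) -
    (\int[P]_x (f x * g x) - a * b)| <= 2 * (s + t).
Proof.
move=> bf bh bu bv f01 g01 u01 v01 fa gb us vt.
have bC (c : R) := bmf_cst T c.
have bfu : bmf (fun x => f x + 2^-1 * u x) by solve_bmf.
have bgv : bmf (fun x => g x + 2^-1 * v x) by solve_bmf.
have b1 : bmf (fun x => 2^-1 * u x) by solve_bmf.
have b2 : bmf (fun x => 2^-1 * v x) by solve_bmf.
rewrite Rint_centered//; last 2 first.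
- by rewrite RintD// RintZl// fa us.
- by rewrite RintD// RintZl// gb vt.
have bfg : bmf (fun x => f x * g x) by exact: bmfM.
have I1 : \int[P]_x (f x * g x) <= \int[P]_x ((f x + 2^-1 * u x) * (g x + 2^-1 * v x)).
  apply: ler_Rint => //; first exact: bmfM.
  move=> x; have /andP[? ?] := f01 x; have /andP[? ?] := g01 x.
  by have /andP[? ?] := u01 x; have /andP[? ?] := v01 x; apply: ler_pM => //; lra.
have I2 : \int[P]_x ((f x + 2^-1 * u x) * (g x + 2^-1 * v x)) <= \int[P]_x (f x * g x) + (s + t).
  rewrite -us -vt -RintD// -RintD//; last exact: bmfD.
  apply: ler_Rint; [exact: bmfM|by apply: bmfD => //; exact: bmfD|].
  move=> x; have /andP[? ?] := f01 x; have /andP[? ?] := g01 x.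
  have /andP[? ?] := u01 x; have /andP[? ?] := v01 x.
  have : f x * v x <= v x by rewrite ler_piMl.
  have : u x * g x <= u x by rewrite ler_piMr.
  have : u x * v x <= v x by rewrite ler_piMl.
  by rewrite mulrDl !mulrDr; lra.
have itv h c : bmf h -> (forall x, 0 <= h x <= 1) -> \int[P]_x h x = c -> 0 <= c <= 1.
  by move=> bh' h01 <-; exact: Rint_itv01.
have /andP[a0 a1] := itv _ _ bf f01 fa; have /andP[c0 c1] := itv _ _ bh g01 gb.
have /andP[s0 s1] := itv _ _ bu u01 us; have /andP[t0 t1] := itv _ _ bv v01 vt.
rewrite ler_norml; move: I1 I2.
set A := \int[P]_x _; set B := \int[P]_x _ => I1 I2.
have h1 : 0 <= a * t <= t by rewrite mulr_ge0//= ler_piMl.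
have h2 : 0 <= s * b <= s by rewrite mulr_ge0//= ler_piMr.
have h3 : 0 <= s * t <= t by rewrite mulr_ge0//= ler_piMl.
case/andP: h1 => ? ?; case/andP: h2 => ? ?; case/andP: h3 => ? ?.
by apply/andP; split; lra.
Qed.

(** Relates the kernel with ties to the strict comparisons that define [sigmak]. *)
Lemma wind_variance k :
  `|\int[L k]_x ((wind k x - kap k) * (wind k x - kap k)) - (rk L k - pk L k ^+ 2)|
     <= 2 * (tie L k + tie L k).
Proof.
rewrite rk_win expr2; under [X in _ - (X - _)]eq_Rintegral do rewrite expr2.
apply: Rint_perturb; do ?[exact: bmf_win|exact: bmf_draw|exact: win_itv|exact: draw_itv];
  by rewrite -?pk_win -?tie_draw.
Qed.

Lemma losed_variance k :
  `|\int[L (ordS k)]_x ((losed k x - kap k) * (losed k x - kap k)) - (qk L k - pk L k ^+ 2)|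
     <= 2 * (tie L k + tie L k).
Proof.
rewrite qk_lose expr2; under [X in _ - (X - _)]eq_Rintegral do rewrite expr2.
apply: Rint_perturb; do ?[exact: bmf_lose|exact: bmf_draw'|exact: lose_itv|exact: draw'_itv];
  by rewrite -?pk_lose -?tie_draw'.
Qed.

Lemma losed_wind_cov k :
  `|\int[L k]_x ((losed (ord_pred k) x - kap (ord_pred k)) * (wind k x - kap k)) -
    (sk L k - pk L (ord_pred k) * pk L k)|
     <= 2 * (tie L (ord_pred k) + tie L k).
Proof.
have Sp : ordS (ord_pred k) = k by exact: ord_predK.
rewrite sk_lose_win.
apply: Rint_perturb; do ?[exact: bmf_lose|exact: bmf_draw'|exact: lose_itv|exact: draw'_itv|
  exact: bmf_win|exact: bmf_draw|exact: win_itv|exact: draw_itv].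
- by rewrite pk_lose Sp.
- by rewrite -pk_win.
- by rewrite tie_draw' Sp.
- by rewrite -tie_draw.
Qed.

End dice_laws.

(** * Statistics of a finite collection of dice *)

Section dice_statistics.
Context d (Omega : measurableType d) (R : realType) (P : probability Omega R).
Variables (l : nat) (n : 'I_l -> nat) (L : 'I_l -> probability R R).
Variable D : forall k : 'I_l, 'I_(n k) -> {RV P >-> R}.
Hypothesis hD : independent_random_dice L D.
Hypothesis l2 : (2 <= l)%N.
Implicit Types k : 'I_l.

Definition score k w := \sum_(i < n k) \sum_(j < n (ordS k)) half (D i w) (D j w).

Definition excess k w := score k w - (n k)%:R * (n (ordS k))%:R / 2.

Lemma halfE (x y : R) : half x y = 2^-1 + 2^-1 * (gtm x y - gtm y x).
Proof. by rewrite /half /gtm /eqm; case: (ltgtP x y) => _ /=; lra. Qed.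

(** By [halfE], the excess is half the difference between the two counts in [beats]; ties cancel
    against the subtracted constant. *)
Lemma beats_excess k w :
  beats (fun i : 'I_(n k) => D i w) (fun j : 'I_(n (ordS k)) => D j w) <-> 0 < excess k w.
Proof.
have cnt (e : R -> R -> bool) :
    #|[pred ij : 'I_(n k) * 'I_(n (ordS k)) | e (D ij.1 w) (D ij.2 w)]|%:R =
    \sum_(i < n k) \sum_(j < n (ordS k)) (e (D i w) (D j w))%:R :> R.
  rewrite -sum1_card natr_sum pair_bigA/= big_mkcond/=.
  by apply: eq_bigr => p _; rewrite inE; case: (e _ _).
have E : excess k w = 2^-1 *
   (#|[pred ij : 'I_(n k) * 'I_(n (ordS k)) | (D ij.1 w > D ij.2 w)%R]|%:R -
    #|[pred ij : 'I_(n k) * 'I_(n (ordS k)) | (D ij.2 w > D ij.1 w)%R]|%:R).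
  rewrite (cnt (fun x y => y < x)) (cnt (fun x y => x < y)) /excess /score.
  rewrite -sumrB mulr_sumr.
  have -> : (n k)%:R * (n (ordS k))%:R / 2 = \sum_(i < n k) \sum_(j < n (ordS k)) (2^-1 : R).
    by rewrite !sumr_const !card_ord -[RHS]mulr_natl -[X in _ = _ * X]mulr_natl; ring.
  rewrite -sumrB; apply: eq_bigr => i _; rewrite -!sumrB mulr_sumr.
  by apply: eq_bigr => j _; rewrite halfE /gtm addrAC subrr add0r.
by rewrite E pmulr_rgt0 ?invr_gt0// subr_gt0 ltr_nat.
Qed.

Lemma cyclic_chainE :
  cyclic_chain D = [set w | forall k, 0 < excess k w].
Proof. by apply/seteqP; split => w /= H k; apply/beats_excess; exact: H. Qed.

Let I : finType := {k : 'I_l & 'I_(n k)}.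
Let X (u : I) : {RV P >-> R} := D (tagged u).
Let mu (u : I) : probability R R := L (tag u).
Let hX : mutually_independent X := hD.2.
Let hmu u A : measurable A -> distribution P (X u) A = mu u A.
Proof. by move=> mA; exact: hD.1. Qed.

Let mD k (i : 'I_(n k)) : measurable_fun setT (D i : Omega -> R).
Proof. by []. Qed.

Lemma bmf_excess k : bmf (excess k).
Proof.
apply: bmfB; last exact: bmf_cst.
by apply: bmf_sum => i; apply: bmf_sum => j; exact: bmf_half.
Qed.

Definition rest k w :=
  \sum_(p : 'I_(n k) * 'I_(n (ordS k))) hoeffding_rest L k (D p.1 w) (D p.2 w).

Lemma bmf_rest k : bmf (rest k).
Proof.
apply: bmf_sum => p; split; last by exists 4 => w; exact: hoeffding_rest_le.
exact: (measurableT_comp (measurable_hoeffding_rest L k)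
  (measurable_fun_pair (mD p.1) (mD p.2))).
Qed.

(** Guarantees that the two faces compared in a kernel belong to different dice, hence are
    independent. *)
Lemma ordS_neq k : ordS k != k.
Proof.
apply/eqP => /(congr1 val)/= h; have kl := ltn_ord k.
have [kl'|] := ltnP k.+1 l; first by rewrite modn_small// in h; have := leqnn k; rewrite -{1}h ltnn.
move=> lk; have e : k.+1 = l by apply/eqP; rewrite eqn_leq kl lk.
by rewrite e modnn in h; move: l2; rewrite -e -h.
Qed.

Lemma rest_sq k : \int[P]_w (rest k w ^+ 2) <= (n k * n (ordS k))%:R * 4 ^+ 2.
Proof.
have := @degenerate_sum_sq _ _ _ _ _ X hX mu hmu _ _
  (fun i : 'I_(n k) => Tagged (fun k => 'I_(n k)) i)
  (fun j : 'I_(n (ordS k)) => Tagged (fun k => 'I_(n k)) j) _ _ _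
  (hoeffding_rest L k) 4 (measurable_hoeffding_rest L k) (@hoeffding_rest_le _ _ L k).
rewrite !card_ord; apply.
- by move=> i i' /eqP; rewrite eq_Tagged => /eqP.
- by move=> i i' /eqP; rewrite eq_Tagged => /eqP.
- by move=> i j; apply/eqP => /(congr1 tag)/= /eqP; rewrite eq_sym (negbTE (ordS_neq k)).
- by move=> i y; exact: hoeffding_rest_l.
- by move=> j x; exact: hoeffding_rest_r.
Qed.

Variable a : 'I_l -> R.

(** A face of die [k] enters two excesses, against the successor and against the predecessor.
    Grouping both contributions makes the linear part a sum of independent terms; the factors [n]
    count the opposing faces. *)
Definition psi k x := a k * (n (ordS k))%:R * (wind L k x - kap L k) +
  a (ord_pred k) * (n (ord_pred k))%:R * (losed L (ord_pred k) x - kap L (ord_pred k)).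

Definition linear_part w := \sum_(u : I) psi (tag u) (X u w).

Definition bias := \sum_k a k * ((n k)%:R * (n (ordS k))%:R * (kap L k - 2^-1)).

Lemma excess_decomposition w :
  \sum_k a k * excess k w = \sum_k a k * rest k w + linear_part w + bias.
Proof.
have lin : linear_part w = \sum_k a k * ((n (ordS k))%:R * (\sum_(i < n k) (wind L k (D i w) - kap L k)))
   + \sum_k a k * ((n k)%:R * (\sum_(j < n (ordS k)) (losed L k (D j w) - kap L k))).
  have -> : linear_part w = \sum_k \sum_(i < n k) psi k (D i w).
    by rewrite sig_big_dep/=; exact: eq_bigl.
  pose H k k' := \sum_(j < n k) (losed L k' (D j w) - kap L k').
  transitivity (\sum_k (a k * ((n (ordS k))%:R * (\sum_(i < n k) (wind L k (D i w) - kap L k)))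
     + a (ord_pred k) * ((n (ord_pred k))%:R * H k (ord_pred k)))).
    by apply: eq_bigr => k _; rewrite big_split/= /H !mulr_sumr; congr (_ + _);
      apply: eq_bigr => i _; rewrite mulrA.
  rewrite big_split/=; congr (_ + _).
  (* The contributions against the predecessor are moved back to the index of the excess they come
     from. *)
  rewrite (reindex_inj (@ordS_inj l))/=; apply: eq_bigr => k _.
  by rewrite ordSK.
rewrite lin /bias -!big_split/=; apply: eq_bigr => k _; rewrite -!mulrDr; congr (_ * _).
rewrite /excess /score /rest -(pair_bigA _ (fun i j => hoeffding_rest L k (D i w) (D j w)))/=.
set N1 : R := (n k)%:R; set N2 : R := (n (ordS k))%:R; set K := kap L k.
set W := \sum_(i < n k) (wind L k (D i w) - K).
set Lo := \sum_(j < n (ordS k)) (losed L k (D j w) - K).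
set H := \sum_(i < n k) \sum_(j < n (ordS k)) half (D i w) (D j w).
have -> : \sum_(i < n k) \sum_(j < n (ordS k)) hoeffding_rest L k (D i w) (D j w) =
   H - N2 * W - N1 * Lo - N1 * (N2 * K).
  have cst c : N2 * c = \sum_(j < n (ordS k)) c :> R.
    by rewrite sumr_const card_ord mulr_natl.
  have cst1 c : N1 * c = \sum_(i < n k) c :> R.
    by rewrite sumr_const card_ord mulr_natl.
  rewrite !cst1 [N2 * W]mulr_sumr -!sumrB; apply: eq_bigr => i _.
  rewrite !cst -!sumrB; apply: eq_bigr => j _; rewrite /hoeffding_rest -/K.
  by move: (half _ _) (wind _ _ _) (losed _ _ _) => ? ? ?; ring.
by clearbody N1 N2 K W Lo H; field.
Qed.

Lemma bmf_psi k : bmf (psi k).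
Proof.
have bC (c : R) := bmf_cst R c.
apply: bmfD; apply: bmfM => //; apply: bmfB => //; first exact: bmf_wind.
exact: bmf_losed.
Qed.

Lemma psi_mean k : \int[L k]_x psi k x = 0.
Proof.
have bC (c : R) := bmf_cst R c.
have bw := bmf_wind L k; have bl := bmf_losed L (ord_pred k).
have bw' : bmf (fun x => wind L k x - kap L k) by exact: bmfB.
have bl' : bmf (fun x => losed L (ord_pred k) x - kap L (ord_pred k)) by exact: bmfB.
rewrite RintD; [|exact: bmfM|exact: bmfM].
rewrite !RintZl// !RintB// !Rint_cst Rint_wind.
have -> : \int[L k]_x losed L (ord_pred k) x = kap L (ord_pred k).
  by have := Rint_losed L (ord_pred k); rewrite ord_predK.
by rewrite !subrr !mulr0 addr0.
Qed.

(** The cross term is the source of the covariance of neighbouring excesses. *)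
Lemma psi_variance k : \int[L k]_x psi k x ^+ 2 =
  (a k * (n (ordS k))%:R) ^+ 2 *
    \int[L k]_x ((wind L k x - kap L k) * (wind L k x - kap L k)) +
  (a (ord_pred k) * (n (ord_pred k))%:R) ^+ 2 *
    \int[L k]_x ((losed L (ord_pred k) x - kap L (ord_pred k)) *
                 (losed L (ord_pred k) x - kap L (ord_pred k))) +
  2 * ((a k * (n (ordS k))%:R) * (a (ord_pred k) * (n (ord_pred k))%:R)) *
    \int[L k]_x ((losed L (ord_pred k) x - kap L (ord_pred k)) * (wind L k x - kap L k)).
Proof.
have bC (c : R) := bmf_cst R c.
have bw : bmf (fun x => wind L k x - kap L k) by apply: bmfB => //; exact: bmf_wind.
have bl : bmf (fun x => losed L (ord_pred k) x - kap L (ord_pred k)).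
  by apply: bmfB => //; exact: bmf_losed.
rewrite -!RintZl; try exact: bmfM.
rewrite -RintD; try by apply: bmfM => //; exact: bmfM.
rewrite -RintD; [|by apply: bmfD; apply: bmfM => //; exact: bmfM|by apply: bmfM => //; exact: bmfM].
by apply: eq_Rintegral => x _; rewrite /psi; ring.
Qed.

Variables (m alpha : R).
Hypothesis nm : forall k, (n k)%:R <= m.
Hypothesis aalpha : forall k, `|a k| <= alpha.
Hypothesis m0 : 0 < m.
Hypothesis alpha1 : 4 * alpha * m <= 1.

Let alpha0 (k : 'I_l) : 0 <= alpha. Proof. exact: le_trans (normr_ge0 _) (aalpha k). Qed.

(** Two terms, each with a coefficient at most [alpha], at most [m] opposing faces and a centered
    projection at most 2. *)
Lemma psi_le k x : `|psi k x| <= 4 * alpha * m.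
Proof.
apply: le_trans (ler_normD _ _) _; rewrite !normrM !normr_nat.
have h c c' (z : R) : `|z| <= 2 -> `|a c| * (n c')%:R * `|z| <= alpha * m * 2.
  by move=> z2; apply: ler_pM; rewrite ?mulr_ge0//; apply: ler_pM.
have hw : `|wind L k x - kap L k| <= 2.
  have := wind_itv L k x; have := kap_itv L k; rewrite ler_norml.
  by move=> /andP[? ?] /andP[? ?]; apply/andP; split; lra.
have hl : `|losed L (ord_pred k) x - kap L (ord_pred k)| <= 2.
  have := losed_itv L (ord_pred k) x; have := kap_itv L (ord_pred k); rewrite ler_norml.
  by move=> /andP[? ?] /andP[? ?]; apply/andP; split; lra.
have := h k (ordS k) _ hw; have := h (ord_pred k) (ord_pred k) _ hl.
set A := _ * _ * `|_|; set B := _ * _ * `|_|; lra.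
Qed.

Definition linear_variance := \sum_k (n k)%:R * \int[L k]_x psi k x ^+ 2.

Let varE : \sum_(u : I) \int[mu u]_x psi (tag u) x ^+ 2 = linear_variance.
Proof.
have -> : \sum_(u : I) \int[mu u]_x psi (tag u) x ^+ 2 =
    \sum_k \sum_(i < n k) \int[L k]_x psi k x ^+ 2.
  by rewrite sig_big_dep/=; exact: eq_bigl.
by apply: eq_bigr => k _; rewrite sumr_const card_ord mulr_natl.
Qed.

Let sizeE : (size (index_enum I))%:R <= l%:R * m.
Proof.
have -> : (size (index_enum I))%:R = \sum_(u : I) (1 : R).
  by rewrite -sum1_size natr_sum.
have -> : \sum_(u : I) (1 : R) = \sum_k \sum_(i < n k) 1.
  by rewrite sig_big_dep/=; exact: eq_bigl.
apply: (@le_trans _ _ (\sum_(k < l) m)).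
  by apply: ler_sum => k _; rewrite sumr_const card_ord.
by rewrite sumr_const card_ord mulr_natl.
Qed.

(** At most [l * m] faces, each with a third-order error: for [alpha] of order [m ^ (- 3/2)] the
    bound is of order [m ^ (- 1/2)]. *)
Lemma linear_part_cos c :
  `|\int[P]_w cos (linear_part w + c) - expR (- (linear_variance / 2)) * cos c| <=
    3 * (l%:R * m) * (4 * alpha * m) ^+ 3.
Proof.
have := @cos_sum_approx _ _ _ _ _ X hX mu hmu (fun u => psi (tag u)) (4 * alpha * m) alpha1
  (fun u => (bmf_psi (tag u)).1) (fun u x => psi_le (tag u) x)
  (fun u => psi_mean (tag u)) (index_enum I) c (index_enum_uniq _).
rewrite varE => h; apply: (le_trans h); apply: ler_wpM2r; last exact: ler_wpM2l.
by rewrite exprn_ge0// !mulr_ge0 ?(alpha0 (Ordinal l2))// ltW.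
Qed.

Lemma linear_part_sq : \int[P]_w (linear_part w ^+ 2) = linear_variance.
Proof.
by rewrite -varE; apply: (sum_sq_moment hX hmu (fun u => (bmf_psi (tag u)).1)
  (fun u x => psi_le (tag u) x) (fun u => psi_mean (tag u)) (index_enum_uniq _)).
Qed.

Let bmf_linear : bmf linear_part.
Proof. by apply: bmf_sum => u; apply: (bmf_comp _ (bmf_psi _)). Qed.

Let bmf_lin_excess : bmf (fun w => \sum_k a k * excess k w).
Proof. by apply: bmf_sum => k; apply: bmfM; [exact: bmf_cst|exact: bmf_excess]. Qed.

Let bmf_norm_rest k : bmf (fun w => `|rest k w|) := bmf_norm (bmf_rest k).

Let rest_sq_le k : \int[P]_w (rest k w ^+ 2) <= (4 * m) ^+ 2.
Proof.
apply: le_trans (rest_sq k) _; rewrite natrM exprMn mulrC ler_wpM2l//.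
by rewrite expr2; apply: ler_pM.
Qed.

(** Follows from the second moment by [z <= (M + z ^ 2 / M) / 2] with [M = 4 * m]. *)
Lemma rest_abs k : \int[P]_w `|rest k w| <= 4 * m.
Proof.
have m4 : 0 < 4 * m by exact: mulr_gt0.
apply: (@le_trans _ _ (\int[P]_w (2^-1 * (4 * m + (4 * m)^-1 * rest k w ^+ 2)))).
  apply: ler_Rint => //.
    apply: bmfM; first exact: bmf_cst.
    apply: bmfD; first exact: bmf_cst.
    by apply: bmfM; [exact: bmf_cst|exact: bmfX (bmf_rest k)].
  move=> w; rewrite -[rest k w ^+ 2]real_normK ?num_real//; set z := `|_|.
  have := sqr_ge0 (z - 4 * m); move: m4; set M := 4 * m => m4 h.
  have : M * (M^-1 * z ^+ 2) = z ^+ 2 by rewrite mulVKf ?gt_eqF.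
  by rewrite -(ler_pM2l m4); set q := M^-1 * _ => hq; nra.
have b2 : bmf (fun w => rest k w ^+ 2) := bmfX 2 (bmf_rest k).
have b3 : bmf (fun w => (4 * m)^-1 * rest k w ^+ 2) by apply: bmfM => //; exact: bmf_cst.
rewrite RintZl; last by apply: bmfD => //; exact: bmf_cst.
rewrite RintD//; last exact: bmf_cst.
rewrite Rint_cst RintZl//.
have : (4 * m)^-1 * \int[P]_w (rest k w ^+ 2) <= 4 * m.
  by rewrite ler_pdivrMl// -expr2.
set z := _^-1 * _; lra.
Qed.

Let cos_lipschitz (x y : R) : `|cos (x + y) - cos x| <= `|y|.
Proof.
have df (z : R) : is_derive z (1:R) (fun z => cos (x + z) - cos x) (- sin (x + z)).
  have d0 : is_derive z (1:R) (fun z => x + z) 1.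
    by apply: (is_derive_eq (is_deriveD (is_derive_cst x z 1) (is_derive_id _ _))); rewrite add0r.
  apply: (is_derive_eq (is_deriveB (is_derive1_comp (is_derive_cos _) d0) (is_derive_cst (cos x) z 1))).
  by rewrite mulr1 subr0.
have [|z _ ->] := MVT_origin df _ y; first by rewrite addr0 subrr.
by rewrite normrM normrN ler_piMl// ler_norml sin_geN1 sin_le1.
Qed.

(** The cosine is 1-Lipschitz, so passing to the linear part costs the mean absolute value of the
    remainder plus the bias. *)
Lemma excess_cos c :
  `|\int[P]_w cos (\sum_k a k * excess k w + c) - expR (- (linear_variance / 2)) * cos c| <=
    3 * (l%:R * m) * (4 * alpha * m) ^+ 3 + (l%:R * (alpha * (4 * m)) + `|bias|).
Proof.
rewrite -[X in `|X|](subrKA (\int[P]_w cos (linear_part w + c))) addrC.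
apply: le_trans (ler_normD _ _) _; apply: lerD; first exact: linear_part_cos.
have bC (z : R) := bmf_cst Omega z.
have b1 : bmf (fun w => cos (\sum_k a k * excess k w + c)).
  by apply: bmf_cos; apply: (bmfD bmf_lin_excess (bC c)).1.
have b2 : bmf (fun w => cos (linear_part w + c)).
  by apply: bmf_cos; apply: (bmfD bmf_linear (bC c)).1.
have b3 : bmf (fun w => \sum_k alpha * `|rest k w|).
  by apply: bmf_sum => k; apply: bmfM.
rewrite -RintB//.
apply: le_trans (le_normr_Rintegral _ _) _ => //; first exact: bmf_integrable (bmfB b1 b2).
apply: (@le_trans _ _ (\int[P]_w (\sum_k alpha * `|rest k w| + `|bias|))).
  apply: ler_Rint; [exact: bmf_norm (bmfB b1 b2)|exact: bmfD b3 (bC _)|].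
  move=> w; rewrite excess_decomposition.
  rewrite (_ : _ + c = linear_part w + c + (\sum_k a k * rest k w + bias)); last ring.
  apply: le_trans (cos_lipschitz _ _) _; apply: le_trans (ler_normD _ _) _.
  rewrite lerD2r; apply: le_trans (ler_norm_sum _ _ _) _.
  by apply: ler_sum => k _; rewrite normrM ler_wpM2r.
rewrite RintD// Rint_cst lerD2r Rint_sum; last first.
  by move=> k; apply: bmf_integrable (bmfM (bC _) (bmf_norm_rest k)).
apply: (@le_trans _ _ (\sum_(k < l) alpha * (4 * m))).
  apply: ler_sum => k _; rewrite RintZl//.
  by rewrite ler_wpM2l ?(alpha0 k)//; exact: rest_abs.
by rewrite sumr_const card_ord [leRHS]mulr_natl.
Qed.

Let sum_sq_le (x : 'I_l -> R) : (\sum_k x k) ^+ 2 <= l%:R * \sum_k x k ^+ 2.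
Proof.
rewrite expr2 big_distrl/=.
apply: (@le_trans _ _ (\sum_i \sum_j (2^-1 * x i ^+ 2 + 2^-1 * x j ^+ 2))).
  apply: ler_sum => i _; rewrite big_distrr/=; apply: ler_sum => j _.
  by have := sqr_ge0 (x i - x j); nra.
pose S := \sum_k 2^-1 * x k ^+ 2.
rewrite (eq_bigr (fun i => l%:R * (2^-1 * x i ^+ 2) + S)); last first.
  by move=> i _; rewrite big_split/= sumr_const card_ord mulr_natl.
rewrite big_split/= sumr_const card_ord -[X in _ + X]mulr_natl -mulr_sumr -/S.
by rewrite -mulrDr ler_wpM2l// /S -mulr_sumr; set Q := \sum_k _; lra.
Qed.

(** The second-moment bound behind the Chebyshev terms: [(x + y + z) ^ 2 <= 3 * (x ^ 2 + y ^ 2 + z ^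
    2)] avoids any cross moment between the parts. *)
Lemma excess_sq :
  \int[P]_w ((\sum_k a k * excess k w) ^+ 2) <=
    3 * (l%:R * (l%:R * (alpha * (4 * m)) ^+ 2) + linear_variance + bias ^+ 2).
Proof.
have bC (z : R) := bmf_cst Omega z.
have b1 k : bmf (fun w => rest k w ^+ 2) := bmfX 2 (bmf_rest k).
have b2 : bmf (fun w => l%:R * \sum_k alpha ^+ 2 * rest k w ^+ 2).
  by apply: bmfM => //; apply: bmf_sum => k; exact: bmfM.
have b3 : bmf (fun w => linear_part w ^+ 2) := bmfX 2 bmf_linear.
have b4 : bmf (fun w => l%:R * (\sum_k alpha ^+ 2 * rest k w ^+ 2) + linear_part w ^+ 2) by exact: bmfD.
have b5 : bmf (fun w => l%:R * (\sum_k alpha ^+ 2 * rest k w ^+ 2) + linear_part w ^+ 2 + bias ^+ 2) by exact: bmfD.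
apply: (@le_trans _ _ (\int[P]_w (3 * (l%:R * (\sum_k alpha ^+ 2 * rest k w ^+ 2) + linear_part w ^+ 2 + bias ^+ 2)))).
  apply: ler_Rint; [exact: bmfX bmf_lin_excess|exact: bmfM|].
  move=> w; rewrite excess_decomposition.
  have h : (\sum_k a k * rest k w) ^+ 2 <= l%:R * (\sum_k alpha ^+ 2 * rest k w ^+ 2).
    apply: le_trans (sum_sq_le _) _; rewrite ler_wpM2l//; apply: ler_sum => k _.
    rewrite exprMn ler_wpM2r ?sqr_ge0// -real_normK ?num_real//.
    by rewrite lerXn2r ?nnegrE ?(alpha0 k).
  move: h; set A := \sum_k _; set B := l%:R * _; set C := linear_part w; set E := bias => h.
  have := sqr_ge0 (A - C); have := sqr_ge0 (A - E); have := sqr_ge0 (C - E); nra.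
rewrite RintZl// RintD// RintD// Rint_cst linear_part_sq ler_wpM2l// !lerD2r.
rewrite RintZl; last by apply: bmf_sum => k; exact: bmfM.
rewrite ler_wpM2l// Rint_sum; last by move=> k; apply: bmf_integrable (bmfM (bC _) (b1 k)).
apply: (@le_trans _ _ (\sum_(k < l) (alpha * (4 * m)) ^+ 2)).
  by apply: ler_sum => k _; rewrite RintZl// exprMn ler_wpM2l ?sqr_ge0.
by rewrite sumr_const card_ord [leRHS]mulr_natl.
Qed.

End dice_statistics.

(** * Asymptotics *)

Section real_sequences.
Variable R : realType.
Implicit Types u v e : nat -> R.

Lemma cvg_near_dist u v e (x : R) : (\forall m \near \oo, `|u m - v m| <= e m) ->
  e @ \oo --> (0 : R) -> v @ \oo --> x -> u @ \oo --> x.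
Proof.
move=> uv e0 vx; have d0 : (fun m => u m - v m) @ \oo --> (0 : R).
  apply: norm_cvg0; apply: (@squeeze_cvgr _ _ _ _ (fun=> 0) e) => //; last exact: cvg_cst.
  by near do rewrite normr_ge0/=.
rewrite (_ : u = (fun m => (u m - v m) + v m)); last by apply/funext => m; rewrite subrK.
by rewrite -[X in _ --> X]add0r; apply: cvgD.
Unshelve. all: by end_near.
Qed.

Lemma cvg_bigsum (I : Type) (s : seq I) (u : I -> nat -> R) (x : I -> R) :
  (forall i, u i @ \oo --> x i) ->
  (fun m => \sum_(i <- s) u i m) @ \oo --> \sum_(i <- s) x i.
Proof.
move=> ux; elim: s => [|i s ih].
  by rewrite big_nil; under eq_fun do rewrite big_nil; exact: cvg_cst.
by rewrite big_cons; under eq_fun do rewrite big_cons; exact: cvgD.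
Qed.

Lemma cvg_cstM (c : R) u x : u @ \oo --> x -> (fun m => c * u m) @ \oo --> c * x.
Proof. by move=> ux; apply: cvgM => //; exact: cvg_cst. Qed.

Lemma cvg_inv_sqrt_nat : (fun m : nat => (Num.sqrt m%:R)^-1 : R) @ \oo --> (0 : R).
Proof.
apply/cvgrPdist_le => e e0; near=> m; rewrite sub0r normrN.
have m1 : (e ^+ 2)^-1 <= m%:R by near: m; exact: nbhs_infty_ger.
have e2 : 0 < (e ^+ 2)^-1 by rewrite invr_gt0 exprn_gt0.
have m0 : 0 < m%:R :> R := lt_le_trans e2 m1.
rewrite ger0_norm ?invr_ge0 ?sqrtr_ge0// -[leRHS]invrK lef_pV2 ?posrE ?sqrtr_gt0 ?invr_gt0//.
by rewrite -(ger0_norm (ltW e0)) -normfV -sqrtr_sqr ler_wsqrtr// exprVn.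
Unshelve. all: by end_near.
Qed.

End real_sequences.

(** For [l >= 3] the predecessor and the successor of an index differ ([pk2]), so each entry is a
    sum of three Kronecker symbols without overlap. The factor 2 comes from symmetry. *)
Lemma cyclic_cov_quad (R : realType) (l : nat) (g t : 'I_l -> R) : (3 <= l)%N ->
  \sum_i \sum_j t i * t j * cyclic_cov g i j =
  \sum_k t k ^+ 2 + \sum_k 2 * (t k * t (ord_pred k)) * g k.
Proof.
move=> l3.
have pk1 (k : 'I_l) : ord_pred k != k.
  rewrite -(inj_eq (@ordS_inj l)) ord_predK eq_sym; exact: (@ordS_neq l (ltnW l3)).
have pk2 (k : 'I_l) : ord_pred (ord_pred k) != k.
  apply/eqP => /(congr1 (fun j => val (ordS (ordS j)))).
  rewrite !ord_predK /= -addn1 modnDml addn1 => e.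
  have : (k.+2 == k %[mod l])%N by rewrite -e (modn_small (ltn_ord k)).
  rewrite eqn_mod_dvd ?(leq_trans (leqnSn k))// -addn2 addnC addnK => /dvdn_leq.
  by move=> /(_ isT); rewrite leqNgt l3.
have split_cov (i j : 'I_l) : cyclic_cov g i j = (i == j)%:R + (i == ord_pred j)%:R * g j +
    (j == ord_pred i)%:R * g i.
  rewrite mxE; have [->|ij] := eqVneq i j.
    by rewrite !(eq_sym j) (negbTE (pk1 j)) !mul0r !addr0.
  have [->|ij2] := eqVneq i (ord_pred j).
    by rewrite eq_sym (negbTE (pk2 j)) mul0r mul1r add0r addr0.
  by have [->|] := eqVneq j (ord_pred i); rewrite !mul0r ?mul1r !add0r.
have delta (F : 'I_l -> R) k : \sum_j (j == k)%:R * F j = F k.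
  by rewrite (bigD1 k)//= eqxx mul1r big1 ?addr0// => j /negbTE ->; rewrite mul0r.
transitivity (\sum_i (t i ^+ 2 + t i * t (ord_pred i) * g i) + \sum_j t j * t (ord_pred j) * g j).
  transitivity (\sum_i \sum_j ((j == i)%:R * (t i * t j) + (j == ord_pred i)%:R * (t i * t j * g i)) +
     \sum_j \sum_i (i == ord_pred j)%:R * (t i * t j * g j)).
    rewrite [X in _ + X]exchange_big -big_split/=; apply: eq_bigr => i _.
    rewrite -big_split/=; apply: eq_bigr => j _.
    by rewrite split_cov (eq_sym j i); ring.
  congr (_ + _); apply: eq_bigr => i _.
    by rewrite big_split/= !delta expr2.
  by rewrite delta; ring.
rewrite -big_split -big_split/=; apply: eq_bigr => k _; ring.
Qed.

(** * Limits of the variance and of the bias *)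

Section limits.
Variables (R : realType) (l : nat) (n : nat -> 'I_l -> nat)
  (L : nat -> 'I_l -> probability R R) (f : nat -> 'I_l -> R)
  (finf s gammainf : 'I_l -> R).
Hypothesis hn : forall m k, (n m k <= m)%N.
Hypothesis hf : forall m k, f m k = (n m k)%:R / m%:R.
Hypothesis s0 : forall k, 0 < s k.
Hypothesis cvf : forall k, f m k @[m --> \oo] --> finf k.
Hypothesis cvsigma : forall k, sigmak (L m) (f m) k @[m --> \oo] --> s k.
Hypothesis cvgamma : forall k, gammak (L m) (f m) k @[m --> \oo] --> gammainf k.
Hypothesis htie : forall k, tie (L m) k @[m --> \oo] --> (0 : R).
Hypothesis hbal : forall k,
  (fun m : nat => 2^-1 - pk (L m) k - 2^-1 * tie (L m) k : R^o) =o_\oo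
  (fun m : nat => m%:R `^ (- 2^-1) : R^o).

(** This is [m ^ (- 3/2)]: the linear part of an excess has order [m] independent terms of order
    [m]. *)
Definition scaling m : R := (m%:R * Num.sqrt m%:R)^-1.

Let f01 m k : 0 <= f m k <= 1.
Proof.
(* At [m = 0] the quotient has the default value 0. *)
rewrite hf divr_ge0//=; have [->|m0] := posnP m; first by rewrite invr0 mulr0 ler01.
by rewrite ler_pdivrMr ?ltr0n// mul1r ler_nat.
Qed.

Let tie0 m k : 0 <= tie (L m) k.
Proof. by case/andP: (tie_itv (L m) k). Qed.

Let nE m k : (0 < m)%N -> (n m k)%:R = f m k * m%:R.
Proof. by move=> m0; rewrite hf divfK// pnatr_eq0 -lt0n. Qed.

(** [W], [Lo] and [C] are the counterparts, with ties counted for one half, of the differences of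
    [rk], [qk] and [sk] with products of [pk]. *)
Let W m k := \int[L m k]_x ((wind (L m) k x - kap (L m) k) * (wind (L m) k x - kap (L m) k)).
Let Lo m k := \int[L m (ordS k)]_x ((losed (L m) k x - kap (L m) k) * (losed (L m) k x - kap (L m) k)).
Let C m k := \int[L m k]_x ((losed (L m) (ord_pred k) x - kap (L m) (ord_pred k)) *
  (wind (L m) k x - kap (L m) k)).

Let sigma_sq k :
  (fun m => f m k * f m (ordS k) ^+ 2 * W m k + f m k ^+ 2 * f m (ordS k) * Lo m k) @ \oo
    --> s k ^+ 2.
Proof.
pose Y m := f m k * f m (ordS k) * (f m k * (qk (L m) k - pk (L m) k ^+ 2)
  + f m (ordS k) * (rk (L m) k - pk (L m) k ^+ 2)).
apply: (@cvg_near_dist _ _ (fun m => sigmak (L m) (f m) k ^+ 2) (fun m => 8 * tie (L m) k)).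
- near=> m.
  (* A positive square root has a positive radicand, so squaring undoes it; this is guaranteed only
     eventually, by the positive limit. *)
  have sp : 0 < sigmak (L m) (f m) k by near: m; exact: (cvgr_gt _ (@cvsigma k)).
  have -> : sigmak (L m) (f m) k ^+ 2 = Y m.
    by rewrite /sigmak sqr_sqrtr// ltW// -sqrtr_gt0.
  have := wind_variance (L m) k; rewrite -/(W m k).
  have := losed_variance (L m) k; rewrite -/(Lo m k) /Y.
  have /andP[a0 a1] := f01 m k; have /andP[b0 b1] := f01 m (ordS k); have := tie0 m k.
  move: (f m k) (f m (ordS k)) (W m k) (Lo m k) (qk _ _ - _) (rk _ _ - _) (tie _ _) a0 a1 b0 b1.
  move=> a b w z q r t a0 a1 b0 b1 t0; have ab0 : 0 <= a * b by exact: mulr_ge0.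
  have ab1 : a * b <= 1 by rewrite mulr_ile1.
  move=> hz hw; rewrite (_ : _ - _ = (a * b) * (b * (w - r)) + (a * b) * (a * (z - q))); last by ring.
  apply: le_trans (ler_normD _ _) _; rewrite !normrM (ger0_norm a0) (ger0_norm b0).
  have h (c x : R) : 0 <= c -> c <= 1 -> `|x| <= 2 * (t + t) -> a * b * (c * `|x|) <= 4 * t.
    move=> c0 c1 hx; rewrite mulrA; apply: (@le_trans _ _ (1 * (2 * (t + t)))); last by rewrite mul1r; lra.
    by apply: ler_pM => //; [exact: mulr_ge0|rewrite mulr_ile1].
  have := h _ _ b0 b1 hw; have := h _ _ a0 a1 hz; set A := a * b * _; set B := a * b * _; lra.
- by rewrite -[X in _ --> X](mulr0 8); apply: cvg_cstM; exact: htie.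
- rewrite expr2; apply: cvgM; exact: cvsigma.
Unshelve. all: by end_near.
Qed.

(** Multiplying by the two sigmas undoes the normalisation of [gammak], which is legitimate once
    both are positive. *)
Let gamma_cov k :
  (fun m => f m (ord_pred k) * f m k * f m (ordS k) * C m k) @ \oo
    --> s (ord_pred k) * s k * gammainf k.
Proof.
apply: (@cvg_near_dist _ _ (fun m => sigmak (L m) (f m) (ord_pred k) * sigmak (L m) (f m) k
   * gammak (L m) (f m) k) (fun m => 2 * (tie (L m) (ord_pred k) + tie (L m) k))).
- near=> m.
  have sp : 0 < sigmak (L m) (f m) k by near: m; exact: (cvgr_gt _ (@cvsigma k)).
  have sp' : 0 < sigmak (L m) (f m) (ord_pred k).
    by near: m; exact: (cvgr_gt _ (@cvsigma (ord_pred k))).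
  have -> : sigmak (L m) (f m) (ord_pred k) * sigmak (L m) (f m) k * gammak (L m) (f m) k =
     f m (ord_pred k) * f m k * f m (ordS k) * (sk (L m) k - pk (L m) (ord_pred k) * pk (L m) k).
    have cancel (x y z : R) : x != 0 -> x * (x^-1 * y * z) = y * z.
      by move=> x0; rewrite -mulrA mulVKf.
    by apply: cancel; rewrite mulf_neq0 ?gt_eqF.
  have /andP[? ?] := f01 m (ord_pred k); have /andP[? ?] := f01 m k.
  have /andP[? ?] := f01 m (ordS k).
  rewrite -mulrBr normrM; have := losed_wind_cov (L m) k; rewrite -/(C m k).
  apply: le_trans; rewrite ler_piMl// ger0_norm.
    by rewrite !mulr_ile1 ?mulr_ge0.
  by rewrite !mulr_ge0.
- rewrite -[X in _ --> X](mulr0 2); apply: cvg_cstM.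
  by rewrite -[X in _ --> X](addr0 0); apply: cvgD; exact: htie.
- by apply: cvgM; [apply: cvgM; exact: cvsigma|exact: cvgamma].
Unshelve. all: by end_near.
Qed.

Variable t : 'I_l -> R.

Let u k := t k / s k.

(** The normalisation uses the limits [s k], not [sigmak] at stage [m], so [m] enters through
    [scaling] alone. *)
Definition coeff m k := u k * scaling m.

Let scaling3 m : (0 < m)%N -> m%:R ^+ 3 * scaling m ^+ 2 = 1.
Proof.
move=> m0; have m1 : 0 < m%:R :> R by rewrite ltr0n.
rewrite /scaling exprVn exprMn sqr_sqrtr ?ltW// -exprSr divff//.
by rewrite expf_neq0// gt_eqF.
Qed.

Lemma linear_variance_cvg :
  (fun m => linear_variance (n m) (L m) (coeff m)) @ \oo -->
    \sum_k t k ^+ 2 + \sum_k 2 * (t k * t (ord_pred k)) * gammainf k.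
Proof.
pose G m := \sum_k u k ^+ 2 * (f m k * f m (ordS k) ^+ 2 * W m k + f m k ^+ 2 * f m (ordS k) * Lo m k)
  + \sum_k 2 * (u k * u (ord_pred k)) * (f m (ord_pred k) * f m k * f m (ordS k) * C m k).
have E m : (0 < m)%N -> linear_variance (n m) (L m) (coeff m) = G m.
  move=> m0; rewrite /linear_variance /G.
  pose H1 k := u k ^+ 2 * (f m k * f m (ordS k) ^+ 2 * W m k).
  pose H2 k := u (ord_pred k) ^+ 2 * (f m (ord_pred k) ^+ 2 * f m k * Lo m (ord_pred k)).
  pose H3 k := 2 * (u k * u (ord_pred k)) * (f m (ord_pred k) * f m k * f m (ordS k) * C m k).
  transitivity (\sum_k (H1 k + H2 k + H3 k)).
    apply: eq_bigr => k _; rewrite psi_variance.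
    have -> : \int[L m k]_x ((losed (L m) (ord_pred k) x - kap (L m) (ord_pred k)) *
        (losed (L m) (ord_pred k) x - kap (L m) (ord_pred k))) = Lo m (ord_pred k).
      by rewrite /Lo ord_predK.
    rewrite -/(W m k) -/(C m k) /H1 /H2 /H3 !nE// /coeff.
    have h := scaling3 m0.
    move: (f m k) (f m (ordS k)) (f m (ord_pred k)) (W m k) (Lo m (ord_pred k)) (C m k) (u k) (u (ord_pred k)).
    move=> a b c w z q x y; move: h; set M := m%:R; set S := scaling m => h.
    (* Three face counts, each [f * m], and two coefficients produce exactly
       [m ^ 3 * scaling m ^ 2 = 1]. *)
    rewrite -[RHS]mul1r -h; ring.
  rewrite !big_split/=; congr (_ + _).
  (* After the shift, [H2] joins [H1] to form the expression whose limit is [s k ^ 2]. *)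
  rewrite [X in _ + X](reindex_inj (@ordS_inj l))/= -big_split/=.
  by apply: eq_bigr => k _; rewrite /H1 /H2 ordSK; ring.
have cG : G @ \oo --> \sum_k u k ^+ 2 * s k ^+ 2 +
    \sum_k 2 * (u k * u (ord_pred k)) * (s (ord_pred k) * s k * gammainf k).
  apply: cvgD; apply: cvg_bigsum => k; apply: cvg_cstM; [exact: sigma_sq|exact: gamma_cov].
have us k : u k * s k = t k by rewrite /u divfK// gt_eqF.
have -> : \sum_k t k ^+ 2 + \sum_k 2 * (t k * t (ord_pred k)) * gammainf k =
  \sum_k u k ^+ 2 * s k ^+ 2 +
    \sum_k 2 * (u k * u (ord_pred k)) * (s (ord_pred k) * s k * gammainf k).
  congr (_ + _); apply: eq_bigr => k _; rewrite -!us; ring.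
apply: cvg_near_dist cG; last exact: cvg_cst.
by near=> m; rewrite E ?subrr ?normr0//; near: m; exact: nbhs_infty_gt.
Unshelve. all: by end_near.
Qed.

Let scaling2 m : (0 < m)%N -> m%:R ^+ 2 * scaling m = Num.sqrt m%:R.
Proof.
move=> m0; have m1 : 0 < m%:R :> R by rewrite ltr0n.
have sm : 0 < Num.sqrt m%:R :> R by rewrite sqrtr_gt0.
rewrite /scaling -{1}(sqr_sqrtr (ltW m1)); set r := Num.sqrt _ in sm *.
by rewrite -[m%:R](sqr_sqrtr (ltW m1)) -/r; field; rewrite gt_eqF.
Qed.

(** A number of pairs of order [m ^ 2] times [scaling m] leaves [sqrt m * (kap - 1/2)], which is
    what the balance hypothesis makes negligible. *)
Lemma bias_cvg : (fun m => bias (n m) (L m) (coeff m)) @ \oo --> (0 : R).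
Proof.
pose b m k := Num.sqrt m%:R * (kap (L m) k - 2^-1).
have cb k : (fun m => b m k) @ \oo --> (0 : R).
  apply/cvgrPdist_le => e e0; have /eqoP/(_ e e0) h := hbal k.
  near=> m; rewrite sub0r normrN.
  have m0 : (0 < m)%N by near: m; exact: nbhs_infty_gt.
  have sm : 0 < Num.sqrt m%:R :> R by rewrite sqrtr_gt0 ltr0n.
  have : `|2^-1 - pk (L m) k - 2^-1 * tie (L m) k| <= e * `|m%:R `^ (- 2^-1)| by near: m; exact: h.
  rewrite powRN powR12_sqrt// normfV (gtr0_norm sm) ler_pdivlMr// => H.
  rewrite /b normrM (gtr0_norm sm) mulrC distrC /kap opprD addrA; exact: H.
pose B m := \sum_k u k * (f m k * f m (ordS k) * b m k).
have cB : B @ \oo --> \sum_k u k * (finf k * finf (ordS k) * 0).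
  apply: cvg_bigsum => k; apply: cvg_cstM; apply: cvgM; last exact: cb.
  by apply: cvgM; exact: cvf.
rewrite (_ : 0 = \sum_k u k * (finf k * finf (ordS k) * 0)); last first.
  by rewrite big1// => k _; rewrite !mulr0.
apply: cvg_near_dist cB; last exact: cvg_cst.
near=> m; have m0 : (0 < m)%N by near: m; exact: nbhs_infty_gt.
rewrite (_ : bias _ _ _ = B m) ?subrr ?normr0//.
apply: eq_bigr => k _; rewrite /b !nE// -scaling2// /coeff; ring.
Unshelve. all: by end_near.
Qed.

End limits.

(** * Convergence of the probability of a cyclic chain *)

Theorem theorem6 (R : realType) (l : nat) (hl : (3 <= l)%N)
    (d : nat -> measure_display) (Omega : forall m, measurableType (d m))
    (P : forall m, probability (Omega m) R)
    (n : nat -> 'I_l -> nat) (hn : forall m k, (n m k <= m)%N)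
    (L : nat -> 'I_l -> probability R R)
    (D : forall m (k : 'I_l), 'I_(n m k) -> {RV (P m) >-> R})
    (hD : forall m, independent_random_dice (L m) (D m))
    (f : nat -> 'I_l -> R) (hf : forall m k, f m k = (n m k)%:R / m%:R)
    (finf pinf sigmainf gammainf : 'I_l -> R)
    (hfinf : forall k, 0 < finf k <= 1)
    (hpinf : forall k, 0 < pinf k <= 1)
    (hsigmainf : forall k, 0 < sigmainf k)
    (hgammainf : forall k, -1 <= gammainf k <= 1)
    (cvf : forall k, f m k @[m --> \oo] --> finf k)
    (cvp : forall k, pk (L m) k @[m --> \oo] --> pinf k)
    (cvsigma : forall k, sigmak (L m) (f m) k @[m --> \oo] --> sigmainf k)
    (cvgamma : forall k, gammak (L m) (f m) k @[m --> \oo] --> gammainf k)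
    (dX : measure_display) (OmegaX : measurableType dX)
    (PX : probability OmegaX R) (X : 'I_l -> {RV PX >-> R})
    (hXgauss : gaussian_vector X) (hXcent : centered X)
    (hXcov : covariance_mx X = cyclic_cov gammainf)
    (htie : forall k, tie (L m) k @[m --> \oo] --> (0 : R))
    (hbal : forall k,
      (fun m : nat => 2^-1 - pk (L m) k - 2^-1 * tie (L m) k : R^o) =o_\oo
      (fun m : nat => m%:R `^ (- 2^-1) : R^o)) :
  [/\ (PX [set w | forall j, (0 < X j w)%R] <=
         limn_einf (fun m => P m (cyclic_chain (D m))))%E,
      (limn_einf (fun m => P m (cyclic_chain (D m))) <=
         limn_esup (fun m => P m (cyclic_chain (D m))))%E,
      (limn_esup (fun m => P m (cyclic_chain (D m))) <=
         PX [set w | forall j, (0 <= X j w)%R])%E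
    & nondegenerate_vector X ->
      P m (cyclic_chain (D m)) @[m --> \oo] -->
        PX [set w | forall j, (0 <= X j w)%R]].
Proof.
have l2 : (1 < l)%N := ltnW hl.
pose s := sigmainf; pose V m k w := (s k)^-1 * scaling R m * excess (D m) k w.
have l0 m : (0 < m)%N -> 0 < m%:R :> R by rewrite ltr0n.
have sqrt0 m : (0 < m)%N -> 0 < Num.sqrt m%:R :> R by move=> m0; rewrite sqrtr_gt0 l0.
have scal0 m : (0 < m)%N -> 0 < scaling R m.
  by move=> m0; rewrite invr_gt0 mulr_gt0 ?l0 ?sqrt0.
have scal1 m : (0 < m)%N -> scaling R m * m%:R = (Num.sqrt m%:R)^-1.
  by move=> m0; rewrite /scaling invfM mulrAC mulVf ?mul1r// gt_eqF// l0.
have bV m k : bmf (V m k) by apply: bmfM; [exact: bmf_cst|exact: bmf_excess].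
have lin t m w : \sum_k t k * V m k w = \sum_k coeff s t m k * excess (D m) k w.
  by apply: eq_bigr => k _; rewrite /V /coeff; ring.
have nm m k : (n m k)%:R <= m%:R :> R by rewrite ler_nat.
pose A (t : 'I_l -> R) := \sum_k `|t k / s k|.
have A0 t : 0 <= A t by exact: sumr_ge0.
have coeff_le t m k : (0 < m)%N -> `|coeff s t m k| <= A t * scaling R m.
  move=> m0; rewrite normrM (gtr0_norm (scal0 m m0)); apply: ler_wpM2r; first by rewrite ltW// scal0.
  by rewrite /A (bigD1 k)//= lerDl sumr_ge0.
have lv t := linear_variance_cvg hn hf hsigmainf cvsigma cvgamma htie t.
have bias0 t := bias_cvg s hf cvf hbal t.
pose Q t := \sum_k t k ^+ 2 + \sum_k 2 * (t k * t (ord_pred k)) * gammainf k.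
have rlim := @cvg_inv_sqrt_nat R.
have cosX t c : \int[PX]_w cos (\sum_j t j * X j w + c) = expR (- (Q t / 2)) * cos c.
  by rewrite (gaussian_vector_cos hXgauss hXcent hXcov) cyclic_cov_quad.
have cosV t c : (fun m => \int[P m]_w cos (\sum_j t j * V m j w + c)) @ \oo -->
    \int[PX]_w cos (\sum_j t j * X j w + c).
  rewrite cosX; pose B := A t; pose r m : R := (Num.sqrt m%:R)^-1.
  apply: (@cvg_near_dist _ _
    (fun m => expR (- (linear_variance (n m) (L m) (coeff s t m) / 2)) * cos c)
    (fun m => (3 * l%:R * 64 * B ^+ 3 + 4 * l%:R * B) * r m + `|bias (n m) (L m) (coeff s t m)|)).
  - near=> m; have m0 : (0 < m)%N by near: m; exact: nbhs_infty_gt.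
    (* The smallness condition of the third-order estimates, with [alpha * m = B / sqrt m]. *)
    have small : 4 * B * r m <= 1.
      near: m; apply: (cvgr_le (4 * B * 0)); last by rewrite mulr0.
      exact: cvg_cstM.
    have am : 4 * (B * scaling R m) * m%:R = 4 * B * r m by rewrite /r -scal1//; ring.
    have := excess_cos (hD m) l2 (nm m) (fun k => coeff_le t m k m0) (l0 m m0) _ c.
    rewrite am => /(_ small); under eq_Rintegral do rewrite -lin.
    move=> h; apply: (le_trans h); rewrite addrA lerD2r.
    (* The number of faces cancels two of the three factors [r m]; the remaining one tends to 0. *)
    have r1 : m%:R * r m ^+ 2 = 1 by rewrite exprVn sqr_sqrtr ?mulfV// gt_eqF ?l0.
    rewrite (_ : B * scaling R m * (4 * m%:R) = 4 * B * r m); last by rewrite -am; ring.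
    rewrite le_eqVlt; apply/orP; left; apply/eqP.
    rewrite (_ : 3 * (l%:R * m%:R) * (4 * B * r m) ^+ 3 =
      3 * l%:R * 64 * B ^+ 3 * r m * (m%:R * r m ^+ 2)); last by ring.
    rewrite r1; ring.
  - rewrite -[X in _ --> X](addr0 0); apply: cvgD.
      by rewrite -[X in _ --> X](mulr0 (3 * l%:R * 64 * B ^+ 3 + 4 * l%:R * B)); exact: cvg_cstM.
    by rewrite -[X in _ --> X](@normr0 _ R); apply: cvg_norm; exact: bias0.
  - apply: cvgM; last exact: cvg_cst.
    apply: (continuous_cvg _ (f := fun m => - (linear_variance (n m) (L m) (coeff s t m) / 2))).
      exact: continuous_expR.
    by apply: cvgN; apply: cvgM; [exact: lv|exact: cvg_cst].
have S11 k : (cyclic_cov gammainf) k k = 1 by rewrite mxE eqxx.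
(* The bound of [excess_sq] tends to 3, its factor 3 times the limiting variance [Q t = 1] of a
   coordinate; 4 leaves room. *)
have VB : \forall m \near \oo, forall j, \int[P m]_w (V m j w ^+ 2) <= 4.
  apply: filter_forall => j; pose t k : R := (k == j)%:R.
  have Qt : Q t = 1.
    rewrite /Q -cyclic_cov_quad// (bigD1 j)//= [X in _ + X]big1 ?addr0; last first.
      by move=> i /negbTE ij; rewrite big1// => k _; rewrite /t ij !mul0r.
    rewrite (bigD1 j)//= [X in _ + X]big1 ?addr0; last first.
      by move=> i /negbTE ij; rewrite /t ij mulr0 mul0r.
    by rewrite S11 /t eqxx !mulr1.
  have tV m w : V m j w = \sum_k t k * V m k w.
    by rewrite (bigD1 j)//= /t eqxx mul1r big1 ?addr0// => k /negbTE ->; rewrite mul0r.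
  pose bnd m := 3 * (l%:R * (l%:R * (4 * A t * (Num.sqrt m%:R)^-1) ^+ 2) +
     linear_variance (n m) (L m) (coeff s t m) + bias (n m) (L m) (coeff s t m) ^+ 2).
  have bndc : bnd @ \oo --> 3 * (l%:R * (l%:R * (4 * A t * 0) ^+ 2) + 1 + 0 ^+ 2).
    apply: cvg_cstM; apply: cvgD; [apply: cvgD|].
    - apply: cvg_cstM; apply: cvg_cstM; rewrite !expr2.
      by apply: cvgM; exact: cvg_cstM.
    - by rewrite -Qt; exact: lv.
    - by rewrite !expr2; apply: cvgM; exact: bias0.
  near=> m; have m0 : (0 < m)%N by near: m; exact: nbhs_infty_gt.
  have : bnd m <= 4.
    near: m; apply: (cvgr_le _ bndc).
    by rewrite !mulr0 expr0n/= !mulr0 add0r addr0 mulr1; lra.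
  apply: le_trans; under eq_Rintegral do rewrite tV lin.
  have := excess_sq (hD m) l2 (nm m) (fun k => coeff_le t m k m0).
  rewrite (_ : A t * scaling R m * (4 * m%:R) = 4 * A t * (Num.sqrt m%:R)^-1)//.
  by rewrite -scal1//; ring.
have X0 k : PX (X k @^-1` [set 0]) = 0%E.
  apply: (gaussian_coord_null hXgauss hXcent hXcov).
  by rewrite S11 oner_neq0.
have X2 k : \int[PX]_w (X k w ^+ 2) <= 4.
  under eq_Rintegral do rewrite expr2.
  by rewrite (gaussian_coord_cov hXcent hXcov) S11; lra.
have mX k : measurable_fun setT (X k : OmegaX -> R) by [].
have lim := orthant_cvg bV VB mX (gaussian_coord_integrable2 hXgauss hXcent) X2 X0 cosV.
(* Rescaling by a positive factor keeps signs; at [m = 0] the factor would be 0. *)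
have chainV m : (0 < m)%N -> cyclic_chain (D m) = [set w | forall k, 0 < V m k w].
  move=> m0; rewrite cyclic_chainE; apply/seteqP.
  have c0 k : 0 < (s k)^-1 * scaling R m 
    by apply: mulr_gt0; [rewrite invr_gt0; exact: hsigmainf|exact: scal0].
  by split => w /= H k; have := H k; rewrite pmulr_rgt0.
have main : P m (cyclic_chain (D m)) @[m --> \oo] --> PX [set w | forall j, 0 <= X j w].
  rewrite -[X in _ --> X]fineK; last by rewrite fin_num_measure//; exact: measurable_orthant_ge.
  have : (fun m => (fine (P m [set w | forall j, 0 < V m j w]))%:E) @ \oo -->
    (fine (PX [set w | forall j, 0 <= X j w]))%:E.
    by apply: cvg_EFin; [exact: nearW|exact: lim].
  apply: cvg_trans; apply: near_eq_cvg; near=> m.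
  have m0 : (0 < m)%N by near: m; exact: nbhs_infty_gt.
  rewrite chainV// fineK// fin_num_measure//.
  by apply: measurable_orthant_gt => k; exact: (bV m k).1.
(* Both extreme limits equal the limit, and the null boundary identifies the open orthant with the
   closed one. *)
have [-> ->] := cvg_limn_einf_sup main.
by split => //; rewrite (orthant_boundary mX X0).
Unshelve. all: by end_near.
Qed.
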